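(* Let $\Omega\subset\mathbb{R}^n$ be an open domain and let $X$, $Y$ be $L^2$ spaces on $\Omega$ (with values in finite-dimensional Euclidean spaces). Let $\alpha>0$, $K\in C^2(X;Y)$, and let $F^*(v)=\int_\Omega f^*(v(x))\,dx$ on $Y$ for a proper, convex, lower semicontinuous $f^*$ with $\partial f^*$ proto-differentiable. For $\gamma\ge0$ let $F^*_\gamma(v)=F^*(v)+\frac{\gamma}{2}\|v\|^2$, and suppose that for every $\gamma\ge0$ and every $(v,\eta)$ with $\eta\in\partial F^*_\gamma(v)$ there is a cone $V_\gamma(v|\eta)\subset Y$ such that $$\widetilde{D[\partial F^*_\gamma]}(v|\eta)(\Delta v)=\begin{cases}\gamma\Delta v+V_\gamma(v|\eta)^\circ,&\Delta v\in V_\gamma(v|\eta),\\ \emptyset,&\Delta v\notin V_\gamma(v|\eta).\end{cases}$$ Denote by $\hat q_\gamma=(\hat u_\gamma,\hat v_\gamma)$ a solution to the optimality conditions $$\alpha u+\nabla K(u)^*v=0,\qquad K(u)\in\partial F^*_\gamma(v)$$ of the problem $\min_u\max_v\frac{\alpha}{2}\|u\|^2+\langle K(u),v\rangle-F^*_\gamma(v)$. Suppose a solution $\hat q=\hat q_0=(\hat u,\hat v)$ (for $\gamma=0$) exists, that there is a constant $c_G>0$ such that $$\alpha\|\xi\|^2+\langle\nabla_u[\nabla K(\hat u)^*\hat v]\xi,\xi\rangle\ge c_G\|\xi\|^2\qquad(\xi\in X),$$ and that $\bar b>0$, where, with $\bar B=\nabla K(\hat u)\bigl(\alpha I+\nabla_u[\nabla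 K(\hat u)^*\hat v]\bigr)^{-1}\nabla K(\hat u)^*$, $$\bar b=\sup_{t>0}\inf\left\{\frac{\|\bar Bz-\nu\|}{\|z\|}\ \middle|\ \begin{array}{l}0\ne z\in V_0(v'|\eta'),\ \nu\in V_0(v'|\eta')^\circ,\ \eta'\in\partial F^*(v'),\\ \|v'-\hat v\|<t,\ \|\eta'-K(\hat u)\|<t\end{array}\right\}.$$ Then for some $\rho,\ell>0$ there exist solutions $\hat q_\gamma$ with $$\|\hat q-\hat q_\gamma\|\le\ell\gamma\quad\text{whenever}\quad0\le\gamma\le\rho.$$
   Context: Hilbert spaces are identified with their duals; $\nabla K(u)^*$ is the adjoint of the Fréchet derivative and $\nabla_u[\nabla K(\hat u)^*\hat v]$ is the Fréchet derivative at $\hat u$ of $\tilde u\mapsto\nabla K(\tilde u)^*\hat v$; $\partial$ is the convex subdifferential. The polar cone of a cone $V$ is $V^\circ=\{z\mid\langle z,z'\rangle\le0\ \forall z'\in V\}$. Tangent vectors: $T(u;U)=\{z\mid \exists\,\tau^i\searrow 0,\ u^i\in U: z=\lim_i (u^i-u)/\tau^i\}$. For $S:Q\rightrightarrows W$ between Hilbert spaces, $DS(q|w)(\Delta q)=\{\Delta w\mid(\Delta q,\Delta w)\in T((q,w);\operatorname{graph}S)\}$, and $\widetilde{DS}(q|w)$ is defined by $\operatorname{graph}\widetilde{DS}(q|w)=\operatorname{conv}\operatorname{graph}[DS(q|w)]$. A set $U$ is geometrically derivable if for every $u\in U$ and $z\in T(u;U)$ there are $\varepsilon>0$ and a curve $\xi:[0,\varepsilon]\to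 U$ with $\xi(0)=u$ and $\lim_{t\searrow0}(\xi(t)-\xi(0))/t=z$; $S$ is proto-differentiable if $\operatorname{graph}S$ is geometrically derivable. $F^*$ is assumed proper. The infimum over an empty set is $+\infty$. *)

(* Defs.v *)
From HB Require Import structures.
From mathcomp Require Import all_boot all_order all_algebra.
From mathcomp Require Import all_classical all_reals all_analysis.
From mathcomp Require Import measurable_realfun ring_quotient ring lra.
Set Implicit Arguments.
Unset Strict Implicit.
Unset Printing Implicit Defensive.
Import Order.TTheory GRing.Theory Num.Theory.
Import numFieldNormedType.Exports.
Local Open Scope classical_set_scope.
Local Open Scope ring_scope.

(* R^n is 'rV[R]_n, with the sigma-algebra generated by the coordinates; by
   open_measurable_rV it contains all open sets, so it is the Borel
   sigma-algebra. *)
Section measurable_rV.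
Context {R : realType} (n : nat).

Let coord (i : 'I_n) (v : 'rV[R]_n) : R := v ord0 i.

Let rV_set0 : g_sigma_preimage coord set0.
Proof. exact: sigma_algebra0. Qed.

Let rV_setC A : g_sigma_preimage coord A -> g_sigma_preimage coord (~` A).
Proof. exact: sigma_algebraC. Qed.

Let rV_bigcup (F : (set 'rV[R]_n)^nat) :
  (forall i, g_sigma_preimage coord (F i)) ->
  g_sigma_preimage coord (\bigcup_i F i).
Proof. exact: sigma_algebra_bigcup. Qed.

HB.instance Definition _ := @isMeasurable.Build default_measure_display
  'rV[R]_n (g_sigma_preimage coord) rV_set0 rV_setC rV_bigcup.

Lemma measurable_coord_rV (i : 'I_n) :
  measurable_fun [set: 'rV[R]_n] (fun v => v ord0 i).
Proof.
move=> _ Y mY; rewrite setTI; apply: sub_sigma_algebra => /=.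
rewrite -bigcup_seq/=; exists i => /=; first by rewrite mem_index_enum.
by exists Y => //; rewrite setTI.
Qed.

Lemma measurable_fun_rV d (T : measurableType d) (f : T -> 'rV[R]_n) :
  (forall i, measurable_fun [set: T] (fun x => f x ord0 i)) ->
  measurable_fun [set: T] f.
Proof.
move=> mf; apply: (@measurability _ _ _ _ _ _
  (\big[setU/set0]_(i < n) preimage_set_system setT (coord i) measurable)) => //.
rewrite -bigcup_seq => _ [_ [i _ [A mA <-]] <-].
by rewrite !setTI -comp_preimage -[_ @^-1` _]setTI; exact: mf.
Qed.

Lemma open_measurable_rV (U : set 'rV[R]_n) : open U -> measurable U.
Proof.
move=> oU.
pose box (qr : 'rV[rat]_n * rat) : set 'rV[R]_n :=
  [set v | forall i, `|ratr (qr.1 ord0 i) - v ord0 i| < ratr qr.2].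
pose B k : set 'rV[R]_n :=
  if unpickle k is Some qr then
    if `[< box qr `<=` U >] then box qr else set0 else set0.
have mbox qr : measurable (box qr).
  have -> : box qr = \bigcap_(i in [set: 'I_n])
      [set v : 'rV[R]_n | `|ratr (qr.1 ord0 i) - v ord0 i| < ratr qr.2].
    by apply/seteqP; split => [v vb i _ /=|v vb i]; [exact: vb|exact: vb].
  apply: fin_bigcap_measurable; first exact: finite_finset.
  move=> i _.
  have -> : [set v : 'rV[R]_n | `|ratr (qr.1 ord0 i) - v ord0 i| < ratr qr.2] =
      (fun v => v ord0 i) @^-1` ball (ratr (qr.1 ord0 i) : R) (ratr qr.2).
    by apply/seteqP; split=> v /=; rewrite -ball_normE.
  rewrite -[_ @^-1` _]setTI.
  exact: (@measurable_coord_rV i measurableT _ (measurable_ball _ _)).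
have -> : U = \bigcup_k B k.
  apply/seteqP; split => [v Uv|v [k _]]; last first.
    rewrite /B; case: unpickle => // qr.
    by case: asboolP => // /[apply].
  have /nbhs_ballP[e /= e0 vU] : nbhs v U by exact: open_nbhs_nbhs.
  have e20 : 0 < e / 2 by rewrite divr_gt0.
  have [r /itvP rE] := rat_in_itvoo e20.
  have r0 : 0 < ratr r :> R by rewrite rE.
  have re : ratr r < e / 2 by rewrite rE.
  have qP (i : 'I_n) : {q : rat | `|ratr q - v ord0 i| < ratr r}.
    apply: cid.
    have vr : v ord0 i - ratr r < v ord0 i + ratr r by rewrite ltrD2l gtrN.
    have [q] := rat_in_itvoo vr.
    by rewrite in_itv/= -ltr_distl => qi; exists q.
  pose q : 'rV[rat]_n := \row_i sval (qP i).
  exists (pickle (q, r)) => //; rewrite /B pickleK.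
  have vbox : box (q, r) v by move=> i /=; rewrite mxE; exact: (svalP (qP i)).
  case: asboolP => // -[] w wbox; apply: vU; split=> // j i.
  rewrite (ord1 j) -ball_normE /=.
  rewrite (splitr e) -(subrK (ratr (q ord0 i)) (v ord0 i)) -addrA.
  rewrite (le_lt_trans (ler_normD _ _))// ltrD//.
    by rewrite distrC (lt_trans (vbox i)).
  by rewrite (lt_trans (wbox i)).
apply: bigcup_measurable => k _; rewrite /B.
by case: unpickle => // qr; case: ifP.
Qed.

End measurable_rV.

Section lebesgue_rV.
Context {R : realType}.

Section step.
Variables (n : nat) (mu : {sigma_finite_measure set 'rV[R]_n -> \bar R}).

Definition cons_rV (p : R * 'rV[R]_n) : 'rV[R]_n.+1 :=
  row_mx (p.1)%:M p.2 : 'rV[R]_(1 + n).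

Lemma measurable_cons_rV :
  measurable_fun [set: measurableTypeR R * 'rV[R]_n] cons_rV.
Proof.
apply: measurable_fun_rV => i.
have [j|j] := @split_ordP 1 n i => ->.
  apply: (eq_measurable_fun fst) => // p _.
  by rewrite /cons_rV (row_mxEl (p.1)%:M) (ord1 j) mxE.
apply: (eq_measurable_fun ((fun v : 'rV[R]_n => v ord0 j) \o snd)).
  by move=> p _; rewrite /cons_rV (row_mxEr (p.1)%:M).
by apply: measurableT_comp => //; exact: measurable_coord_rV.
Qed.

Definition lebesgue_rV_step : set 'rV[R]_n.+1 -> \bar R :=
  pushforward (lebesgue_measure \x mu)%E cons_rV.

Let step0 : lebesgue_rV_step set0 = 0%E.
Proof. by rewrite /lebesgue_rV_step /pushforward preimage_set0 measure0. Qed.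

Let step_ge0 A : (0 <= lebesgue_rV_step A)%E.
Proof. exact: (measure_ge0 (lebesgue_measure \x mu)%E). Qed.

Let step_sigma_additive : semi_sigma_additive lebesgue_rV_step.
Proof.
move=> F mF tF mUF; rewrite /lebesgue_rV_step /pushforward preimage_bigcup.
apply: measure_semi_sigma_additive.
- by move=> k; rewrite -[X in measurable X]setTI; exact: measurable_cons_rV.
- apply/trivIsetP => /= i j _ _ ij; rewrite -preimage_setI.
  by move/trivIsetP : tF => /(_ _ _ _ _ ij) ->//; rewrite preimage_set0.
- rewrite -preimage_bigcup -[X in measurable X]setTI.
  exact: measurable_cons_rV.
Qed.

HB.instance Definition _ := isMeasure.Build _ _ _ lebesgue_rV_step
  step0 step_ge0 step_sigma_additive.

Let measurable_fst_rV : measurable_fun [set: 'rV[R]_n.+1]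
  (fun v => (v ord0 ord0 : measurableTypeR R)).
Proof. exact: measurable_coord_rV. Qed.

Let tail (v : 'rV[R]_n.+1) : 'rV[R]_n := \row_i v ord0 (rshift 1 i).

Let measurable_tail : measurable_fun [set: 'rV[R]_n.+1] tail.
Proof.
apply: measurable_fun_rV => i.
apply: (eq_measurable_fun (fun v : 'rV[R]_n.+1 => v ord0 (rshift 1 i))).
  by move=> v _; rewrite mxE.
exact: measurable_coord_rV.
Qed.

Let step_sigma_finite : sigma_finite setT lebesgue_rV_step.
Proof.
have [F TF Foo] : sigma_finite [set: measurableTypeR R * 'rV[R]_n]
    (lebesgue_measure \x mu)%E.
  have /sigma_finiteP[F [TF ndF Foo]] :=
    sigma_finiteT (@lebesgue_measure R : {sigma_finite_measure set _ -> \bar R}).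
  have /sigma_finiteP[G [TG ndG Goo]] := sigma_finiteT mu.
  exists (fun k => F k `*` G k).
    rewrite -setXTT TF TG predeqE => -[x y]; split.
      move=> [/= [i _ Fx] [j _ Gy]]; exists (maxn i j) => //; split.
      - by move: x Fx; exact/subsetPset/ndF/leq_maxl.
      - by move: y Gy; exact/subsetPset/ndG/leq_maxr.
    by move=> [i _ []/= ? ?]; split; exists i.
  move=> k; have [? ?] := Foo k; have [? ?] := Goo k.
  split; first exact: measurableX.
  by rewrite product_measure1E// lte_mul_pinfty// ge0_fin_numE.
pose g (v : 'rV[R]_n.+1) : measurableTypeR R * 'rV[R]_n := (v ord0 ord0, tail v).
have mg : measurable_fun [set: 'rV[R]_n.+1] g.
  exact: (measurable_fun_pair measurable_fst_rV measurable_tail).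
have gK p : g (cons_rV p) = p.
  case: p => x v; congr pair => /=.
    rewrite /cons_rV (_ : ord0 = lshift n (ord0 : 'I_1)) //; last exact/val_inj.
    by rewrite (row_mxEl x%:M) mxE.
  by apply/rowP => i; rewrite mxE /cons_rV (row_mxEr x%:M).
exists (fun k => g @^-1` F k).
  by rewrite -preimage_bigcup -TF preimage_setT.
move=> k; have [mF Fk] := Foo k; split.
  by rewrite -[X in measurable X]setTI; exact: mg.
rewrite /lebesgue_rV_step /pushforward -comp_preimage.
by rewrite (_ : g \o cons_rV = id)//; apply/funext => p; exact: gK.
Qed.

HB.instance Definition _ := Measure_isSigmaFinite.Build _ _ _ lebesgue_rV_step
  step_sigma_finite.

End step.

(* n-dimensional Lebesgue measure, as the iterated product: for n = k.+1, the
   image of lebesgue_measure \x lebesgue_rV k under (x, v) |-> row_mx x v. *)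
Fixpoint lebesgue_rV (n : nat) : {sigma_finite_measure set 'rV[R]_n -> \bar R} :=
  if n is k.+1 then lebesgue_rV_step (lebesgue_rV k) else \d_(0 : 'rV[R]_0).

End lebesgue_rV.

(* Euclidean inner product of R^k; the library's norm on 'rV[R]_k is the
   sup-norm, and only its topology is used below. *)
Definition rVdot (R : realType) k (a b : 'rV[R]_k) : R :=
  \sum_i a ord0 i * b ord0 i.

(* L^2(mu; R^m), as the quotient of the m-tuples of scalar square-integrable
   functions by mu-a.e. equality, with the inner product
   \int v(x) . w(x) dmu and its norm. *)
Section L2.
Context d (T : measurableType d) (R : realType).
Variables (mu : {measure set T -> \bar R}) (m : nat).

Local Notation preL2 := {ffun 'I_m -> LfunType mu (lee1n 2)}.

Definition ae_null : {pred preL2} :=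
  fun f => `[< {ae mu, forall x, forall i, f i x = 0} >].

Lemma ae_null_submod : submod_closed ae_null.
Proof.
split.
  by apply/asboolP; apply/aeW => x i; rewrite ffunE.
move=> a f g /asboolP f0 /asboolP g0; apply/asboolP.
move: f0 g0; apply: filterS2 => x f0 g0 i.
have -> : (a *: f + g) i x = a * f i x + g i x by rewrite !ffunE.
by rewrite f0 g0 mulr0 addr0.
Qed.
HB.instance Definition _ := GRing.isSubmodClosed.Build _ _ ae_null ae_null_submod.

Definition L2 : Type := Quotient.quot ae_null.
HB.instance Definition _ := GRing.Zmodule.on L2.
HB.instance Definition _ := EqQuotient.on L2.

Local Open Scope quotient_scope.

Lemma piL2P (f g : preL2) : {ae mu, forall x, forall i, f i x = g i x} <->
  \pi_L2 f = \pi_L2 g.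
Proof.
split=> [fg|/eqP].
  apply/eqP; rewrite -Quotient.idealrBE; apply/asboolP.
  apply: filterS fg => x fg i.
  have -> : (f - g) i x = f i x - g i x by rewrite !ffunE.
  by rewrite fg subrr.
rewrite -Quotient.idealrBE => /asboolP; apply: filterS => x fg i.
apply/eqP; rewrite -subr_eq0; apply/eqP; rewrite -[RHS](fg i).
by rewrite !ffunE.
Qed.

Definition L2scale (a : R) (v : L2) : L2 := \pi_L2 (a *: (repr v : preL2)).

Lemma piL2Z a (f : preL2) : L2scale a (\pi_L2 f) = \pi_L2 (a *: f).
Proof.
apply/piL2P; have /piL2P := reprK (\pi_L2 f); apply: filterS => x fE i.
have -> : (a *: (repr (\pi_L2 f) : preL2)) i x = a * (repr (\pi_L2 f) : preL2) i x.
  by rewrite !ffunE.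
by rewrite fE !ffunE.
Qed.

Lemma piL2D (f g : preL2) : \pi_L2 (f + g) = \pi_L2 f + \pi_L2 g :> L2.
Proof. by rewrite (Quotient.pi_add ae_null f g). Qed.

Lemma L2scaleA a b (v : L2) : L2scale a (L2scale b v) = L2scale (a * b) v.
Proof.
by rewrite -[v]reprK (piL2Z b) (piL2Z a) (piL2Z (a * b)) scalerA.
Qed.

Lemma L2scale1 : left_id 1 L2scale.
Proof. by move=> v; rewrite -[v]reprK (piL2Z 1) scale1r. Qed.

Lemma L2scaleDr : right_distributive L2scale +%R.
Proof.
move=> a v w; rewrite -[v]reprK -[w]reprK -piL2D (piL2Z a) scalerDr piL2D.
by rewrite -!(piL2Z a).
Qed.

Lemma L2scaleDl (v : L2) : {morph L2scale^~ v : a b / a + b}.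
Proof.
move=> a b; rewrite -[v]reprK (piL2Z (a + b)) scalerDl piL2D.
by rewrite -(piL2Z a) -(piL2Z b).
Qed.

HB.instance Definition _ := GRing.Zmodule_isLmodule.Build R L2
  L2scaleA L2scale1 L2scaleDr L2scaleDl.

(* A representative of the class v; it is determined only up to mu-a.e.
   equality (L2val_eq). *)
Definition L2val (v : L2) (x : T) : 'rV[R]_m := \row_i (repr v : preL2) i x.

Definition L2dot (v w : L2) : R := (\int[mu]_x rVdot (L2val v x) (L2val w x))%R.

Lemma L2valD (v w : L2) : {ae mu, forall x, L2val (v + w) x = L2val v x + L2val w x}.
Proof.
have /piL2P : \pi_L2 (repr (v + w)) = \pi_L2 ((repr v : preL2) + repr w).
  by rewrite piL2D !reprK.
apply: filterS => x vw; apply/rowP => i; rewrite !mxE vw.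
by rewrite !ffunE.
Qed.

Lemma L2valZ a (v : L2) : {ae mu, forall x, L2val (a *: v) x = a *: L2val v x}.
Proof.
have /piL2P : \pi_L2 (repr (a *: v)) = \pi_L2 (a *: (repr v : preL2)).
  by rewrite reprK.
apply: filterS => x vw; apply/rowP => i; rewrite !mxE vw.
by rewrite !ffunE.
Qed.

Lemma L2val_eq (v w : L2) : {ae mu, forall x, L2val v x = L2val w x} <-> v = w.
Proof.
split=> [vw|->]; last exact: aeW.
rewrite -[v]reprK -[w]reprK; apply/piL2P; apply: filterS vw => x vw i.
by move/rowP : vw => /(_ i); rewrite !mxE.
Qed.

Lemma L2val_Lfun (v : L2) i : (fun x => L2val v x ord0 i) \in Lfun mu 2%:E.
Proof.
rewrite (_ : (fun _ => _) = (repr v : preL2) i); last first.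
  by apply/funext => x; rewrite mxE.
exact: LfunP.
Qed.

Lemma L2dot_integrable (v w : L2) :
  mu.-integrable setT (EFin \o (fun x => rVdot (L2val v x) (L2val w x))).
Proof.
rewrite /rVdot (_ : _ \o _ = fun x =>
  (\sum_(i < m) (L2val v x ord0 i * L2val w x ord0 i)%:E)%E); last first.
  by apply/funext => x /=; rewrite sumEFin.
apply: integrable_sum => // i _.
by apply/Lfun1_integrable; apply: Lfun2_mul_Lfun1; exact: L2val_Lfun.
Qed.

Let dot_measurable (v w : L2) :
  measurable_fun setT (EFin \o (fun x => rVdot (L2val v x) (L2val w x))).
Proof. by have /integrableP[] := L2dot_integrable v w. Qed.

Lemma L2dotC (v w : L2) : L2dot v w = L2dot w v.
Proof.
by apply: eq_Rintegral => x _; apply: eq_bigr => i _; rewrite mulrC.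
Qed.

Lemma L2dotDl (u v w : L2) : L2dot (u + v) w = L2dot u w + L2dot v w.
Proof.
rewrite /L2dot -RintegralD//; try exact: L2dot_integrable.
rewrite /Rintegral; congr fine; apply: ae_eq_integral => //.
- exact: dot_measurable.
- have := emeasurable_funD (dot_measurable u w) (dot_measurable v w).
  exact.
- apply: filterS (L2valD u v) => x uv _ /=; rewrite uv; congr EFin.
  by rewrite /rVdot -big_split; apply: eq_bigr => i _; rewrite mxE mulrDl.
Qed.

Lemma L2dotZl a (v w : L2) : L2dot (a *: v) w = a * L2dot v w.
Proof.
rewrite /L2dot -RintegralZl//; last exact: L2dot_integrable.
rewrite /Rintegral; congr fine; apply: ae_eq_integral => //.
- exact: dot_measurable.
- have := measurable_funeM a%:E (dot_measurable v w).
  exact.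
- apply: filterS (L2valZ a v) => x av _ /=; rewrite av; congr EFin.
  by rewrite /rVdot big_distrr /=; apply: eq_bigr => i _; rewrite mxE -mulrA.
Qed.

Lemma L2dot_ge0 (v : L2) : 0 <= L2dot v v.
Proof.
by apply: Rintegral_ge0 => x _; apply: sumr_ge0 => i _; rewrite -expr2 sqr_ge0.
Qed.

Lemma L2dot_eq0 (v : L2) : L2dot v v = 0 -> v = 0.
Proof.
move=> v0.
have dge0 x : 0 <= rVdot (L2val v x) (L2val v x).
  by apply: sumr_ge0 => i _; rewrite -expr2 sqr_ge0.
have /(ae_eq_integral_abs mu measurableT (dot_measurable v v)) : 
  (\int[mu]_x `|(EFin \o (fun x => rVdot (L2val v x) (L2val v x))) x|)%E = 0%E.
  transitivity (\int[mu]_x (rVdot (L2val v x) (L2val v x))%:E)%E.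
    by apply: eq_integral => x _ /=; rewrite ger0_norm.
  rewrite -[LHS]fineK; last exact: integrable_fin_num (L2dot_integrable v v).
  by congr EFin.
move=> dv0; apply/L2val_eq.
have z0 : {ae mu, forall x, L2val (0 : L2) x = 0}.
  have := L2valZ 0 0; rewrite scale0r; apply: filterS => x ->.
  by rewrite scale0r.
move: dv0 z0; apply: filterS2 => x /(_ I) /= [] /eqP dv0 ->.
apply/rowP => i; rewrite [RHS]mxE; move: dv0.
rewrite psumr_eq0; last by move=> j _; rewrite -expr2 sqr_ge0.
by move=> /allP/(_ i); rewrite mem_index_enum => /(_ isT) /=; rewrite mulf_eq0 orbb => /eqP.
Qed.

Let L2norm (v : L2) : R := Num.sqrt (L2dot v v).

Let L2normD (v w : L2) : L2norm (v + w) <= L2norm v + L2norm w.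
Proof.
rewrite /L2norm -ler_sqr ?nnegrE ?addr_ge0 ?sqrtr_ge0//.
rewrite sqrrD !sqr_sqrtr ?L2dot_ge0//.
have E (s t : R) : L2dot (s *: v + t *: w) (s *: v + t *: w) =
    s ^+ 2 * L2dot v v + s * t * L2dot v w *+ 2 + t ^+ 2 * L2dot w w.
  rewrite L2dotDl !L2dotZl !(L2dotC _ (s *: v + _)) !L2dotDl !L2dotZl.
  rewrite (L2dotC w v); ring.
have -> : L2dot (v + w) (v + w) = L2dot v v + L2dot v w *+ 2 + L2dot w w.
  by have := E 1 1; rewrite !scale1r => ->; rewrite !expr1n !mul1r.
rewrite lerD2r lerD2l lerMn2r /=.
rewrite -sqrtrM ?L2dot_ge0// (le_trans (ler_norm _))//.
rewrite -sqrtr_sqr ler_sqrt ?mulr_ge0 ?L2dot_ge0//.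
have [vv0|vv0] := eqVneq (L2dot v v) 0.
  rewrite (L2dot_eq0 vv0) -(scale0r (0 : L2)) L2dotZl mul0r expr0n /=.
  by rewrite L2dotZl !mul0r.
have := L2dot_ge0 (- L2dot v w *: v + L2dot v v *: w); rewrite E.
have vv : 0 < L2dot v v by rewrite lt_neqAle eq_sym vv0 L2dot_ge0.
rewrite (_ : _ + _ = L2dot v v * (L2dot v v * L2dot w w - L2dot v w ^+ 2)); last by ring.
by rewrite pmulr_rge0// subr_ge0.
Qed.

Let L2normZ (a : R) (v : L2) : L2norm (a *: v) = `|a| * L2norm v.
Proof.
rewrite /L2norm L2dotZl L2dotC L2dotZl mulrA -expr2 sqrtrM ?sqr_ge0//.
by rewrite sqrtr_sqr.
Qed.

Let L2norm_eq0 (v : L2) : L2norm v = 0 -> v = 0.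
Proof.
move/eqP; rewrite sqrtr_eq0 => vv; apply: L2dot_eq0; apply/eqP.
by rewrite eq_le vv L2dot_ge0.
Qed.

HB.instance Definition _ := @Lmodule_isNormed.Build R L2 L2norm
  L2normD L2normZ L2norm_eq0.

Lemma L2normE (v : L2) : `|v| = Num.sqrt (L2dot v v).
Proof. by []. Qed.

End L2.

(* Lebesgue measure A |-> lebesgue_rV n (A `&` Omega), still as a measure on
   R^n: L2 (lebesgue_on oOmega) m is L^2(Omega; R^m), since values outside
   Omega are ignored by a.e. equality and by integration. *)
Definition lebesgue_on (R : realType) n (Omega : set 'rV[R]_n)
    (oOmega : open Omega) : {measure set 'rV[R]_n -> \bar R} :=
  mrestr (lebesgue_rV n) (open_measurable_rV oOmega).

Notation "''L2(' oOmega ')_' m" := (L2 (lebesgue_on oOmega) m)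
  (at level 8, m at level 2, format "''L2(' oOmega ')_' m") : type_scope.

Section variational_analysis.
Context {R : realType}.

Definition tangent (V : normedModType R) (U : set V) (u : V) : set V :=
  [set z | exists (tau : R^nat) (x : V^nat),
    [/\ forall i, 0 < tau i, nonincreasing_seq tau, tau @ \oo --> (0 : R),
        forall i, U (x i) &
        (fun i => (tau i)^-1 *: (x i - u)) @ \oo --> z]].

Definition geometrically_derivable (V : normedModType R) (U : set V) :=
  forall u z, U u -> tangent U u z ->
  exists (eps : R) (xi : R -> V),
    [/\ 0 < eps, forall t, 0 <= t <= eps -> U (xi t), xi 0 = u &
        (fun t : R => t^-1 *: (xi t - xi 0)) @ 0^'+ --> z].

Section set_valued.
Context {Q W : normedModType R}.
Implicit Type S : Q -> set W.

Definition graph S : set (Q * W) := [set qw | S qw.1 qw.2].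

Definition proto_differentiable S := geometrically_derivable (graph S).

Definition graphical_derivative S (q : Q) (w : W) : Q -> set W :=
  fun dq => [set dw | tangent (graph S) (q, w) (dq, dw)].

Definition convex_hull (V : lmodType R) (A : set V) : set V :=
  smallest (@convex_set R V) A.

Definition convexified_derivative S (q : Q) (w : W) : Q -> set W :=
  fun dq => [set dw |
    convex_hull (graph (graphical_derivative S q w)) (dq, dw)].

(* Twice continuous Frechet differentiability. There is no normed space of
   bounded operators in the library, so that the operator norms are written
   out: D2K u is a bounded bilinear map, it is the Frechet derivative at u of
   u |-> 'd K u for the operator norm, and it depends continuously on u for
   the norm of bounded bilinear maps. *)
Definition C2 (K : Q -> W) :=
  (forall u, differentiable K u) /\
  exists D2K : Q -> Q -> Q -> W,
  forall u,
  [/\ forall h, linear (D2K u h),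
      forall xi, linear (D2K u ^~ xi),
      exists C : R, forall h xi, `|D2K u h xi| <= C * `|h| * `|xi|,
      forall e : R, 0 < e -> \forall h \near (0 : Q), forall xi,
        `|'d K (u + h) xi - 'd K u xi - D2K u h xi| <= e * `|h| * `|xi| &
      forall e : R, 0 < e -> \forall u' \near u, forall h xi,
        `|D2K u' h xi - D2K u h xi| <= e * `|h| * `|xi|].

End set_valued.

Definition proper_fun (V : Type) (F : V -> \bar R) :=
  (forall v, -oo < F v)%E /\ exists v, (F v < +oo)%E.

(* Only used for functions which are never -oo. *)
Definition convex_efun (V : lmodType R) (F : V -> \bar R) :=
  forall (x y : V) (t : R), 0 < t < 1 ->
  (F (t *: x + (1 - t) *: y)%R <= t%:E * F x + (1 - t)%R%:E * F y)%E.

Definition subdifferential (V : zmodType) (dot : V -> V -> R)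
    (F : V -> \bar R) (v : V) : set V :=
  [set eta | forall w, (F v + (dot eta (w - v)%R)%:E <= F w)%E].

Definition cone (V : lmodType R) (C : set V) :=
  forall (t : R) z, 0 < t -> C z -> C (t *: z).

End variational_analysis.

Section saddle_point.
Context d (T : measurableType d) (R : realType).
Variable mu : {measure set T -> \bar R}.

Definition polar m (C : set (L2 mu m)) : set (L2 mu m) :=
  [set z | forall z', C z' -> L2dot z z' <= 0].

(* The Riesz representer of x |-> <y, A x>, which exists and is unique when A
   is linear and bounded. *)
Definition adjoint p m (A : L2 mu p -> L2 mu m) (y : L2 mu m) : L2 mu p :=
  get [set a | forall x, L2dot a x = L2dot y (A x)].

Definition subdiff m (F : L2 mu m -> \bar R) : L2 mu m -> set (L2 mu m) :=
  subdifferential (@L2dot _ _ _ mu m) F.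

(* The integral is -oo when both the positive and the negative parts have
   infinite integral; this is excluded wherever the functional is proper. *)
Definition integral_functional m (f : 'rV[R]_m -> \bar R) (v : L2 mu m) :
  \bar R := (\int[mu]_x f (L2val v x))%E.

Definition regularized m (F : L2 mu m -> \bar R) (gamma : R) (v : L2 mu m) :
  \bar R := (F v + (gamma / 2 * `|v| ^+ 2)%R%:E)%E.

Section operators.
Context {p m : nat}.
Variables (alpha : R) (K : L2 mu p -> L2 mu m).

Definition solves_optimality (F : L2 mu m -> \bar R) (u : L2 mu p)
    (v : L2 mu m) :=
  alpha *: u + adjoint ('d K u) v = 0 /\
  subdiff F v (K u).

(* nabla_u [nabla K(u)^* v], as an operator on X *)
Definition hessian (u : L2 mu p) (v : L2 mu m) : L2 mu p -> L2 mu p :=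
  'd (fun u' => adjoint ('d K u') v) u.

(* pinv is the inverse of alpha I + hessian u v when that operator is
   bijective. *)
Definition Bbar (u : L2 mu p) (v : L2 mu m) (z : L2 mu m) : L2 mu m :=
  'd K u (pinv [set: L2 mu p] (fun w => alpha *: w + hessian u v w)
            (adjoint ('d K u) z)).

(* The pairs x are (z, nu). *)
Definition bbar (F : L2 mu m -> \bar R)
    (V : L2 mu m -> L2 mu m -> set (L2 mu m)) (u : L2 mu p) (v : L2 mu m) :
  \bar R :=
  ereal_sup [set ereal_inf
    [set (`|Bbar u v x.1 - x.2| / `|x.1|)%:E | x in
      [set x | exists v' eta',
        [/\ subdiff F v' eta',
            `|v' - v| < t, `|eta' - K u| < t &
            [/\ x.1 != 0, V v' eta' x.1 & polar (V v' eta') x.2]]]]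
    | t in [set t : R | 0 < t]].

End operators.
End saddle_point.

(* Main.v *)
From HB Require Import structures.
Require Import Defs.
From mathcomp Require Import all_boot all_order all_algebra.
From mathcomp Require Import all_classical all_reals all_analysis.
From mathcomp Require Import measurable_realfun ring lra.
Set Implicit Arguments.
Unset Strict Implicit.
Unset Printing Implicit Defensive.
Import Order.TTheory GRing.Theory Num.Theory.
Import numFieldNormedType.Exports.
Local Open Scope classical_set_scope.
Local Open Scope ring_scope.

(* The subdifferential of F_gamma at v contains eta + gamma v for eta in the
   subdifferential of F at v, so a solution for gamma is a zero on
     S = {(u, v, eta) | eta in the subdifferential of F at v}
   of the residual r(u, v, eta) = |(alpha u + K'(u)^* v, K(u) - gamma v - eta)|.
   At (uhat, vhat, K(uhat)) this residual is gamma |vhat|. The smooth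
   variational principle of Borwein and Preiss yields, within ell * gamma of
   that point, a minimiser over S of r plus a linear term of slope at most
   32 |vhat| / ell and a quadratic term. If r is not 0 there, let (r1, r2) be
   the normalised residual vector. The first-order conditions in the direction
   (v, eta) hold on the tangent vectors of the graph, hence, being linear, on
   their convex hull V x V^o. Up to errors of order gamma + 1/ell they say that
     A r1 + K'(u)^* r2 = 0, r2 in V^oo = V and - K'(u) r1 in V^o,
   where A is the (selfadjoint, coercive) operator alpha I + Hessian. Hence
   B r2 = - K'(u) r1 is almost in V^o, so that bbar > 0 makes r2 small, and then
   r1 by coercivity, which contradicts |r1|^2 + |r2|^2 = 1. *)

(** * Variational principle and convex duality in Hilbert spaces *)

(** The perturbation has to be smooth. Minimality gives inequalities only along tangent vectors of
    the graph, which need not form a convex set, whereas the hypothesis describes the convexified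
    derivative. An Ekeland term eps |x - y| would leave a sublinear error: a convex combination of
    tangent vectors can be much shorter than the vectors combined, so the bound would be lost. A
    linear slope passes to the hull unchanged. The price is that S has to be closed; this is
    obtained by describing subgradients of [F] pointwise almost everywhere through those of [f],
    passing to the limit there and integrating back. Carrying eta as a separate variable keeps S
    independent of gamma, which enters only the smooth residual. Hence only the cones V_0 occur, and
    these are the ones that bbar controls. The tolerance s for all errors is fixed before gamma. The
    slope 32 gamma |vhat| / l at radius l = ell gamma must be at most s, which forces ell of size 32
    |vhat| / s and makes the estimate linear in gamma. *)

Section geometric_sequences.
Context {R : realType}.
Implicit Types (a b D e : R) (u : nat -> R).

Lemma cvg_geometric_half D : (fun n => D * 2^-1 ^+ n) @ \oo --> (0 : R).
Proof.
rewrite -[X in _ --> X](mulr0 D); apply: cvgMl_tmp.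
by apply: cvg_expr; rewrite ger0_norm ?invr_ge0// invf_lt1// ltr1n.
Qed.

Lemma ler_add_geometric a b D : (forall k, a <= b + D * 2^-1 ^+ k) -> a <= b.
Proof.
move=> ab; have cv : (fun k => b + D * 2^-1 ^+ k) @ \oo --> b.
  by rewrite -[X in _ --> X]addr0; apply: cvgD; [exact: cvg_cst|exact: cvg_geometric_half].
by apply: (ler_cvg_to (@cvg_cst _ a nat \oo _) cv); exact: nearW.
Qed.

Lemma geometric_cvg u a D : (forall n, `|u n - a| <= D * 2^-1 ^+ n) -> u @ \oo --> a.
Proof.
move=> ua; apply/subr_cvg0; apply/norm_cvg0P.
apply: (@squeeze_cvgr _ _ _ _ (fun _ => 0) (fun n => D * 2^-1 ^+ n)).
- by apply: nearW => n; rewrite normr_ge0 ua.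
- exact: cvg_cst.
- exact: cvg_geometric_half.
Qed.

Lemma first_order_ge0 a b : (forall t, 0 < t <= 1 -> 0 <= t * a + t ^+ 2 * b) -> 0 <= a.
Proof.
move=> ab; rewrite leNgt; apply/negP => a0.
(* If [a < 0], this [t] is at most 1 and gives [a + t |b| = - t (1 - a) < 0], against the hypothesis
   divided by [t]. *)
pose t := - a / (`|b| + 1 - a).
have d0 : 0 < `|b| + 1 - a by have := normr_ge0 b; lra.
have t0 : 0 < t by rewrite divr_gt0// oppr_gt0.
have t1 : t <= 1 by rewrite ler_pdivrMr// mul1r; have := normr_ge0 b; lra.
have /ab : 0 < t <= 1 by rewrite t0.
rewrite expr2 -mulrA -mulrDr pmulr_rge0// => h.
have tb : t * b <= t * `|b| by rewrite ler_pM2l// ler_norm.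
have tE : t * (`|b| + 1 - a) = - a by rewrite /t mulfVK// gt_eqF.
nra.
Qed.

End geometric_sequences.

Section inner_product.
Context {R : realType} {H : lmodType R}.

Definition dot_norm (dot : H -> H -> R) (x : H) : R := Num.sqrt (dot x x).

(** The form is kept apart from any norm of the module, so that one module can carry several: a
    product form, or the energy form of a coercive operator. It is semidefinite, so vectors are
    identified by their pairings with all others. *)
Record inner_product (dot : H -> H -> R) : Prop := InnerProduct {
  dotC : forall x y, dot x y = dot y x;
  dotDl : forall x y z, dot (x + y) z = dot x z + dot y z;
  dotZl : forall a x y, dot (a *: x) y = a * dot x y;
  dot_ge0 : forall x, 0 <= dot x x }.

(* Completeness, tested on the sequences which converge geometrically. *)
Definition geometrically_complete (dot : H -> H -> R) :=
  forall (x : nat -> H) (C : R),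
    (forall n, dot_norm dot (x n.+1 - x n) <= C * 2^-1 ^+ n) ->
  exists (y : H) (D : R), forall n, dot_norm dot (y - x n) <= D * 2^-1 ^+ n.

Context {dot : H -> H -> R} (ip : inner_product dot).
Local Notation N := (dot_norm dot).

Lemma dotDr x y z : dot x (y + z) = dot x y + dot x z.
Proof. by rewrite !(dotC ip x) (dotDl ip). Qed.

Lemma dotZr a x y : dot x (a *: y) = a * dot x y.
Proof. by rewrite !(dotC ip x) (dotZl ip). Qed.

Lemma dotNl x y : dot (- x) y = - dot x y.
Proof. by rewrite -scaleN1r (dotZl ip) mulN1r. Qed.

Lemma dotNr x y : dot x (- y) = - dot x y.
Proof. by rewrite !(dotC ip x) dotNl. Qed.

Lemma dotBl x y z : dot (x - y) z = dot x z - dot y z.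
Proof. by rewrite (dotDl ip) dotNl. Qed.

Lemma dotBr x y z : dot x (y - z) = dot x y - dot x z.
Proof. by rewrite dotDr dotNr. Qed.

Lemma dot0l x : dot 0 x = 0.
Proof. by rewrite -(scale0r 0) (dotZl ip) mul0r. Qed.

Lemma dot0r x : dot x 0 = 0.
Proof. by rewrite (dotC ip) dot0l. Qed.

Lemma dot_norm_ge0 x : 0 <= N x.
Proof. exact: sqrtr_ge0. Qed.

Lemma sqr_dot_norm x : N x ^+ 2 = dot x x.
Proof. by rewrite sqr_sqrtr// (dot_ge0 ip). Qed.

Lemma dot_normZ a x : N (a *: x) = `|a| * N x.
Proof.
by rewrite /dot_norm (dotZl ip) dotZr mulrA -expr2 sqrtrM ?sqr_ge0// sqrtr_sqr.
Qed.

Lemma dot_normN x : N (- x) = N x.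
Proof. by rewrite -scaleN1r dot_normZ normrN1 mul1r. Qed.

Lemma dot_norm0 : N 0 = 0.
Proof. by rewrite /dot_norm dot0l sqrtr0. Qed.

Lemma cauchy_schwarz x y : dot x y <= N x * N y.
Proof.
have h (t : R) : 0 <= N x ^+ 2 - 2 * t * dot x y + t ^+ 2 * N y ^+ 2.
  have := dot_ge0 ip (x - t *: y).
  rewrite !sqr_dot_norm dotBl !dotBr !(dotZl ip) !dotZr (dotC ip y x); lra.
have x0 := dot_norm_ge0 x; have y0 := dot_norm_ge0 y.
have [y1|y1] := eqVneq (N y) 0; last first.
  have yp : 0 < N y by rewrite lt_neqAle eq_sym y1.
  have := h (N x / N y); rewrite expr_div_n mulfVK ?expf_neq0// => h'.
  have [x1|x1] := eqVneq (N x) 0.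
    have := h (dot x y / N y ^+ 2); rewrite x1 mul0r expr_div_n => h2.
    have : 0 <= - (dot x y ^+ 2 / N y ^+ 2).
      apply: le_trans h2 _; rewrite le_eqVlt; apply/orP; left; apply/eqP.
      by field.
    rewrite oppr_ge0 pmulr_lle0 ?invr_gt0 ?exprn_gt0// => h3.
    have /eqP : dot x y ^+ 2 = 0 by apply/eqP; rewrite eq_le h3 sqr_ge0.
    by rewrite sqrf_eq0 => /eqP ->.
  have xp : 0 < N x by rewrite lt_neqAle eq_sym x1.
  have : 0 <= 2 * N x * (N x - dot x y / N y).
    by apply: le_trans h' _; rewrite le_eqVlt; apply/orP; left; apply/eqP; field.
  by rewrite pmulr_rge0 ?mulr_gt0// subr_ge0 ler_pdivrMr.
(* In a semidefinite form [N y = 0] does not give [y = 0]. The square taken at [t^-1] and multiplied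
   by [t ^+ 2 / 2] is a first-order inequality in [t] with leading coefficient [- dot x y]. *)
rewrite y1 mulr0 -oppr_ge0.
have h1 : forall t, 0 < t <= 1 -> 0 <= t * (N x ^+ 2) + t ^+ 2 * 0.
  by move=> t /andP[t0 _]; rewrite mulr0 addr0 mulr_ge0 ?sqr_ge0// ltW.
apply: (@first_order_ge0 _ _ (N x ^+ 2 / 2)) => t /andP[t0 t1].
have := h t^-1; rewrite y1 expr0n /= mulr0 addr0 => h2.
have : 0 <= (t ^+ 2 / 2) * (N x ^+ 2 - 2 * t^-1 * dot x y).
  by rewrite mulr_ge0// divr_ge0// sqr_ge0.
suff -> : (t ^+ 2 / 2) * (N x ^+ 2 - 2 * t^-1 * dot x y) =
    t * - dot x y + t ^+ 2 * (N x ^+ 2 / 2) by [].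
by field; rewrite gt_eqF.
Qed.

Lemma normr_dot_le x y : `|dot x y| <= N x * N y.
Proof.
by rewrite ler_norml cauchy_schwarz andbT lerNl -dotNl -(dot_normN x) cauchy_schwarz.
Qed.

Lemma ler_dot_normD x y : N (x + y) <= N x + N y.
Proof.
rewrite -ler_sqr ?nnegrE ?addr_ge0 ?dot_norm_ge0// sqrrD !sqr_dot_norm.
rewrite (dotDl ip) !dotDr (dotC ip y x); have := cauchy_schwarz x y; lra.
Qed.

Lemma dot_normB x y : N (x - y) = N (y - x).
Proof. by rewrite -dot_normN opprB. Qed.

Lemma ler_dot_norm_sqr a x : 0 <= a -> (N x <= a) = (dot x x <= a ^+ 2).
Proof. by move=> a0; rewrite -sqr_dot_norm ler_sqr// nnegrE ?dot_norm_ge0. Qed.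

Lemma geometric_tail (x : nat -> H) C n k :
  (forall n, N (x n.+1 - x n) <= C * 2^-1 ^+ n) ->
  N (x (n + k)%N - x n) <= 2 * C * (2^-1 ^+ n - 2^-1 ^+ (n + k)).
Proof.
move=> xC; elim: k => [|k IH]; first by rewrite addn0 !subrr mulr0 dot_norm0.
have -> : x (n + k.+1)%N - x n = (x (n + k).+1 - x (n + k)%N) + (x (n + k)%N - x n).
  by rewrite addrA subrK addnS.
apply: le_trans (ler_dot_normD _ _) _; apply: le_trans (lerD (xC _) IH) _.
by rewrite addnS [in leRHS]exprS; lra.
Qed.

(** Completeness supplies a rate [D] without control. Going through [x (n + k)] and letting [k] grow
    replaces it by the sum of the steps, which is what makes the constants of the variational
    principle explicit. *)
Lemma geometric_limit_dist (x : nat -> H) y C D n :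
  (forall n, N (x n.+1 - x n) <= C * 2^-1 ^+ n) ->
  (forall n, N (y - x n) <= D * 2^-1 ^+ n) ->
  N (y - x n) <= 2 * C * 2^-1 ^+ n.
Proof.
move=> xC xD; apply: (@ler_add_geometric _ _ _ D) => k.
have C0 : 0 <= C by apply: le_trans (dot_norm_ge0 (x 1%N - x 0%N)) _; have := xC 0%N; rewrite expr0 mulr1.
have D0 : 0 <= D by apply: le_trans (dot_norm_ge0 (y - x 0%N)) _; have := xD 0%N; rewrite expr0 mulr1.
have -> : y - x n = (y - x (n + k)%N) + (x (n + k)%N - x n) by rewrite addrA subrK.
apply: le_trans (ler_dot_normD _ _) _.
apply: le_trans (lerD (xD _) (geometric_tail n k xC)) _.
have q0 j : 0 <= 2^-1 ^+ j :> R by rewrite exprn_ge0 ?invr_ge0.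
have qk : D * 2^-1 ^+ (n + k) <= D * 2^-1 ^+ k.
  rewrite ler_wpM2l// exprD ler_piMl// exprn_ile1 ?invr_ge0//.
  by rewrite invf_le1// ler1n.
have := mulr_ge0 C0 (q0 (n + k)%N); have := mulr_ge0 C0 (q0 k); lra.
Qed.

Lemma geometric_cvg_dot (x y : nat -> H) u v D E :
  (forall n, N (u - x n) <= D * 2^-1 ^+ n) ->
  (forall n, N (v - y n) <= E * 2^-1 ^+ n) ->
  (fun n => dot (x n) (y n)) @ \oo --> dot u v.
Proof.
move=> xD yE; apply: (@geometric_cvg _ _ _ (D * (N v + E) + N u * E)) => n.
have D0 : 0 <= D by apply: le_trans (dot_norm_ge0 (u - x 0%N)) _; have := xD 0%N; rewrite expr0 mulr1.
have E0 : 0 <= E by apply: le_trans (dot_norm_ge0 (v - y 0%N)) _; have := yE 0%N; rewrite expr0 mulr1.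
have q0 : 0 <= 2^-1 ^+ n :> R by rewrite exprn_ge0 ?invr_ge0.
have q1 : 2^-1 ^+ n <= 1 :> R by rewrite exprn_ile1 ?invr_ge0// invf_le1// ler1n.
have yN : N (y n) <= N v + E.
  have -> : y n = v - (v - y n) by rewrite opprB addrC subrK.
  apply: le_trans (ler_dot_normD _ _) _; rewrite lerD2l dot_normN.
  by apply: le_trans (yE n) _; rewrite ler_piMr.
have -> : dot (x n) (y n) - dot u v = - dot (u - x n) (y n) - dot u (v - y n).
  by rewrite dotBl dotBr; ring.
apply: le_trans (ler_normB _ _) _; rewrite normrN mulrDl.
apply: lerD; apply: le_trans (normr_dot_le _ _) _.
  rewrite mulrAC; apply: ler_pM => //; exact: dot_norm_ge0.
rewrite -mulrA ler_wpM2l//; exact: dot_norm_ge0.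
Qed.

(** * The variational principle of Borwein and Preiss *)

Section variational_principle.
Hypothesis Hc : geometrically_complete dot.
Variables (S : set H) (f : H -> R) (x0 : H) (M l : R).
Hypotheses (M0 : 0 < M) (l0 : 0 < l) (Sx0 : S x0).
Hypothesis fM : forall x, S x -> f x0 <= f x + M.
Hypothesis Sf : forall (x : nat -> H) y D, (forall n, S (x n)) ->
  (forall n, N (y - x n) <= D * 2^-1 ^+ n) -> S y /\ f \o x @ \oo --> f y.

(* The quadratics c q_n^2 |y - x n|^2 are added one at a time and x n.+1 is a
   near-minimiser of the current sum, which is stored, up to a constant, as the
   pair (a, b) standing for a |y|^2 - 2 <b, y>. *)
Let c := 8 * M / l ^+ 2.
Let q (n : nat) : R := 2^-1 ^+ n.
Let pert (s : R * H) x := f x + s.1 * dot x x - 2 * dot s.2 x.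
Let near_min s e := [set x | S x /\ forall y, S y -> pert s x <= pert s y + e].
Let step n (s : R * H * H) : R * H * H :=
  let s' := (s.1.1 + c * q n ^+ 2, s.1.2 + (c * q n ^+ 2) *: s.2) in
  (s', xget x0 (near_min s' (M * q n.+1 ^+ 4))).
Let st := fix st n := if n is k.+1 then step k (st k) else ((0, 0), x0).
Let a n := (st n).1.1.
Let b n := (st n).1.2.
Let x n := (st n).2.

Let c0 : 0 < c.
Proof. by rewrite /c divr_gt0 ?exprn_gt0 ?mulr_gt0. Qed.

Let q0 n : 0 < q n.
Proof. by rewrite exprn_gt0 ?invr_gt0. Qed.

Let qS n : q n.+1 = q n / 2.
Proof. by rewrite /q exprSr. Qed.

Let aS n : a n.+1 = a n + c * q n ^+ 2. Proof. by []. Qed.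
Let bS n : b n.+1 = b n + (c * q n ^+ 2) *: x n. Proof. by []. Qed.

Let near_min_neq0 s e m : 0 < e -> (forall y, m <= s.1 * dot y y - 2 * dot s.2 y) ->
  near_min s e !=set0.
Proof.
move=> e0 ms.
have hi : has_inf [set pert s y | y in S].
  split; first by exists (pert s x0), x0.
  exists (f x0 - M + m) => _ [y Sy <-]; rewrite /pert -[leRHS]addrA lerD//.
  by rewrite lerBlDr fM.
have [_ [y Sy <-] ye] := inf_adherent e0 hi.
exists y; split=> // z Sz.
apply: le_trans (ltW ye) _; rewrite lerD2r; apply: inf_lbound; last by exists z.
by case: hi.
Qed.

Let bounded_below n : exists m, forall y, m <= a n * dot y y - 2 * dot (b n) y.
Proof.
elim: n => [|n [m IH]].
  by exists 0 => y; rewrite /a /b /= mul0r dot0l mulr0 subrr.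
exists (m - c * q n ^+ 2 * dot (x n) (x n)) => y.
rewrite aS bS (dotDl ip) (dotZl ip).
have := IH y; have := dot_ge0 ip (y - x n).
rewrite dotBl !dotBr (dotC ip y (x n)) => h1 h2.
have cq : 0 < c * q n ^+ 2 by rewrite mulr_gt0 ?exprn_gt0.
nra.
Qed.

Let x_near_min n : near_min (a n, b n) (M * q n ^+ 4) (x n).
Proof.
case: n => [|n].
  split=> //= y Sy; rewrite /pert /= !mul0r !dot0l mulr0 subr0 !addr0.
  by rewrite subr0 /q expr0 expr1n mulr1 fM.
have [m hm] := bounded_below n.+1.
have e0 : 0 < M * q n.+1 ^+ 4 by rewrite mulr_gt0 ?exprn_gt0.
have [y ny] := @near_min_neq0 (a n.+1, b n.+1) _ m e0 hm.
exact: (@xgetI _ x0 (near_min (a n.+1, b n.+1) (M * q n.+1 ^+ 4)) y ny).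
Qed.

Let x_geometric n : N (x n.+1 - x n) <= l / 2 * q n.
Proof.
have qn := q0 n.
rewrite ler_dot_norm_sqr; last by rewrite mulr_ge0 ?divr_ge0 ?ltW.
have [Sx h1] := x_near_min n; have [Sx' h2] := x_near_min n.+1.
have := lerD (h1 _ Sx') (h2 _ Sx).
rewrite /pert /= -/(a n.+1) -/(b n.+1) aS bS !(dotDl ip) !(dotZl ip) qS.
rewrite !dotDr !dotNl !dotNr (dotC ip (x n.+1) (x n)) => h.
have cq : 0 < c * q n ^+ 2 by rewrite mulr_gt0 ?exprn_gt0.
rewrite -(ler_pM2l cq).
(* This identity dictates [c]. Adding the near-minimality of [x n] and of [x n.+1] bounds
   [c q_n^2 |x_(n+1) - x_n|^2] by two errors of total at most [2 M q_n^4], so the steps are at most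
   [l / 2 * q n] and sum to [l]. *)
have -> : c * q n ^+ 2 * (l / 2 * q n) ^+ 2 = 2 * M * q n ^+ 4.
  by rewrite /c; field; rewrite gt_eqF.
have Mq : 0 < M * q n ^+ 4 by rewrite mulr_gt0 ?exprn_gt0.
lra.
Qed.

Let aE n : a n = 4 / 3 * c * (1 - q n ^+ 2).
Proof.
elim: n => [|n IH]; first by rewrite /a /q /= expr0 expr1n subrr mulr0.
by rewrite aS IH qS; field.
Qed.

(** The gradient at [x n] of the accumulated quadratic; its limit is the slope [v] of the
    principle. *)
Let e n := 2 *: (a n *: x n - b n).

(** The quadratic added at stage [n] is centred at [x n], where its gradient vanishes; so the
    gradient changes only because the point moves. *)
Let eS n : e n.+1 - e n = (2 * a n.+1) *: (x n.+1 - x n).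
Proof.
rewrite /e -scalerBr -scalerA; congr (_ *: _).
rewrite scalerBr bS; set X := a n.+1 *: x n.+1.
by rewrite aS scalerDl opprB !opprD -!addrA; congr (_ + _); rewrite addrCA addKr addrC.
Qed.

Let e_geometric n : N (e n.+1 - e n) <= 2 * c * l * q n.
Proof.
have qn := q0 n; have a0 : 0 <= a n.+1.
  have q1 : 0 <= 1 - q n.+1 ^+ 2.
    by rewrite subr_ge0 !exprn_ile1 ?exprn_ge0 ?invr_ge0 ?invf_le1 ?ler1n.
  rewrite aE; have := mulr_ge0 (ltW c0) q1; lra.
have a2 : a n.+1 <= 2 * c.
  rewrite aE; have := c0; have := mulr_gt0 c0 (exprn_gt0 2 (q0 n.+1)); lra.
rewrite eS dot_normZ ger0_norm ?mulr_ge0//.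
apply: le_trans (ler_wpM2l _ (x_geometric n)) _; first by rewrite mulr_ge0.
have := ler_wpM2r (ltW (mulr_gt0 l0 qn)) a2; lra.
Qed.

(** The accumulated quadratic is expanded exactly about [x n]: its linear part is [e n], its
    second-order coefficient [a n] stays below [2 * c]. *)
Let first_order n y : S y ->
  f (x n) <= f y + dot (e n) (y - x n) + 2 * c * dot (y - x n) (y - x n) +
    M * q n ^+ 4.
Proof.
move=> Sy; have [_ /(_ _ Sy)] := x_near_min n; rewrite /pert /e /= => h.
have a2 : a n <= 2 * c by rewrite aE; have := c0; have := mulr_gt0 c0 (exprn_gt0 2 (q0 n)); lra.
have := ler_wpM2r (dot_ge0 ip (y - x n)) a2.
rewrite (dotZl ip) !dotBl !dotBr !(dotZl ip) (dotC ip y (x n)); lra.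
Qed.

Lemma smooth_variational_principle : exists y v C,
  [/\ S y, N (y - x0) <= l, N v <= 32 * M / l &
      forall z, S z -> f y <= f z + dot v (z - y) + C * dot (z - y) (z - y)].
Proof.
have [y [D xy]] := Hc x_geometric.
have [v [E ev]] := Hc e_geometric.
have [Sy fy] := Sf (fun n => (x_near_min n).1) xy.
exists y, v, (2 * c); split=> //.
- have := geometric_limit_dist 0 x_geometric xy.
  by rewrite expr0 mulr1 mulrCA mulfV// mulr1.
(* Since [e 0 = 0], the slope is at most twice the constant of [e_geometric], that is
   [4 c l = 32 M / l]. *)
- have := geometric_limit_dist 0 e_geometric ev.
  rewrite expr0 mulr1 /e /a /b /= scale0r subrr scaler0 subr0.
  by move/le_trans; apply; rewrite le_eqVlt; apply/orP; left; apply/eqP; rewrite /c; field; rewrite gt_eqF.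
move=> z Sz.
have zy n : N ((z - y) - (z - x n)) <= D * 2^-1 ^+ n.
  by rewrite opprB addrC subrKA dot_normB.
have q4 : (fun n => M * q n ^+ 4) @ \oo --> (0 : R).
  apply: (@geometric_cvg _ _ _ M) => n.
  rewrite subr0 ger0_norm; last by rewrite mulr_ge0 ?exprn_ge0// ltW.
  by rewrite ler_wpM2l ?(ltW M0)// exprS ler_piMr ?(ltW (q0 _))// !exprn_ile1 ?exprn_ge0 ?invr_ge0 ?invf_le1 ?ler1n.
have cr : (fun n => f z + dot (e n) (z - x n) + 2 * c * dot (z - x n) (z - x n) +
    M * q n ^+ 4) @ \oo --> f z + dot v (z - y) + 2 * c * dot (z - y) (z - y).
  rewrite -[X in _ --> X]addr0; apply: cvgD q4; apply: cvgD.
    by apply: cvgD; [exact: cvg_cst|exact: geometric_cvg_dot ev zy].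
  by apply: cvgMl_tmp; exact: (geometric_cvg_dot zy zy).
apply: (ler_cvg_to fy cr).
by apply: nearW => n; exact: first_order.
Qed.

End variational_principle.

(** * Riesz representation and the bipolar theorem *)

Definition bounded_linear (phi : H -> R) :=
  [/\ forall x y, phi (x + y) = phi x + phi y,
      forall a x, phi (a *: x) = a * phi x &
      exists k, forall x, `|phi x| <= k * N x].

Hypothesis Hc : geometrically_complete dot.

Definition geometrically_closed (S : set H) := forall (x : nat -> H) y D,
  (forall n, S (x n)) -> (forall n, N (y - x n) <= D * 2^-1 ^+ n) -> S y.

(** A substitute for the exact minimiser of [|x|^2 - 2 phi x] on [S]: the variational principle
    gives a point satisfying the variational inequality up to a slope of norm at most [d]. Applied
    to the whole space it yields Riesz, applied to a closed cone it yields a near-projection. *)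
Lemma quadratic_near_minimum (S : set H) (phi : H -> R) (d : R) :
  geometrically_closed S -> S 0 -> bounded_linear phi -> 0 < d ->
  exists y v, [/\ S y, N v <= d &
    forall h, (forall t, 0 < t <= 1 -> S (y + t *: h)) ->
      0 <= 2 * dot y h - 2 * phi h + dot v h].
Proof.
move=> Scl S0 [phiD phiZ [k phik]] d0.
have k0 : 0 <= `|k| by [].
have phik' x : `|phi x| <= `|k| * N x.
  by apply: le_trans (phik x) _; rewrite ler_wpM2r ?dot_norm_ge0// ler_norm.
have phi0 : phi 0 = 0 by rewrite -(scale0r 0) phiZ mul0r.
have phiN x : phi (- x) = - phi x by rewrite -scaleN1r phiZ mulN1r.
(* The function is at least [- k^2] and vanishes at 0, so 0 minimises it up to [M], the added 1
   making [M] positive; [l] is chosen so that [32 M / l = d]. *)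
pose M := `|k| ^+ 2 + 1; pose l := 32 * M / d.
have M0 : 0 < M by rewrite ltr_wpDl ?sqr_ge0.
have l0 : 0 < l by rewrite divr_gt0// mulr_gt0.
pose f x := dot x x - 2 * phi x.
have fM x : S x -> f 0 <= f x + M.
  move=> _; rewrite /f phi0 dot0l mulr0 subrr -sqr_dot_norm /M.
  have := phik' x; rewrite ler_norml => /andP[_ h].
  have := sqr_ge0 (N x - `|k|); lra.
have Sf (x : nat -> H) y D : (forall n, S (x n)) ->
    (forall n, N (y - x n) <= D * 2^-1 ^+ n) -> S y /\ f \o x @ \oo --> f y.
  move=> Sx xy; split; first exact: Scl xy.
  apply: cvgB; first exact: (geometric_cvg_dot xy xy).
  apply: cvgMl_tmp; apply: (@geometric_cvg _ _ _ (`|k| * D)) => n.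
  rewrite -phiN -phiD; apply: le_trans (phik' _) _.
  by rewrite -mulrA ler_wpM2l// dot_normB xy.
have [y [v [C [Sy _ vd yv]]]] := smooth_variational_principle Hc M0 l0 S0 fM Sf.
exists y, v; split=> //.
  by apply: le_trans vd _; rewrite /l invf_div mulrCA mulfV ?mulr1// gt_eqF ?mulr_gt0.
move=> h yh; apply: (@first_order_ge0 _ _ ((1 + C) * dot h h)) => t t01.
have := yv _ (yh t t01); rewrite /f [_ - y]addrC addKr phiD phiZ.
rewrite !(dotDl ip) !dotDr !(dotZl ip) !dotZr (dotC ip h y); lra.
Qed.

(** On the whole space both [h] and [- h] are admissible, so the perturbed inequality is an equality
    and the slope can be absorbed: [y + v / 2] represents [phi] exactly. *)
Lemma riesz_representation (phi : H -> R) : bounded_linear phi ->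
  exists a, forall x, dot a x = phi x.
Proof.
move=> bphi; have [_ phiZ _] := bphi.
have cl : geometrically_closed [set: H] by [].
have [y [v [_ _ yv]]] := quadratic_near_minimum cl I bphi ltr01.
exists (y + 2^-1 *: v) => h; have := yv h (fun _ _ => I).
have := yv (- h) (fun _ _ => I).
by rewrite -scaleN1r phiZ !dotZr (dotDl ip) (dotZl ip); lra.
Qed.

Definition dot_polar (C : set H) : set H := [set x | forall y, C y -> dot x y <= 0].

(** With a near-projection [y] of [x] onto the closure of [C] and slope [v], put
    [p = x - y - v / 2]. Moving along [C] shows that [p] is polar, moving towards 0 that
    [dot p y >= 0]. Then [dot x p <= 0] forces [|p| <= |v| / 2], so [x] is close to [y], hence to
    [C]: the errors [d / 4], [d / 4] and [d / 2] add up to [d]. *)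
Lemma bipolar (C : set H) (x : H) (d : R) :
  C !=set0 -> (forall t y, 0 < t -> C y -> C (t *: y)) ->
  (forall y z, C y -> C z -> C (y + z)) -> 0 < d ->
  (forall y, dot_polar C y -> dot x y <= 0) ->
  exists2 y, C y & N (x - y) <= d.
Proof.
move=> [w Cw] CZ CD d0 Cx.
pose S := [set y | forall e, 0 < e -> exists2 z, C z & N (y - z) <= e].
have CS y : C y -> S y by move=> Cy e e0; exists y => //; rewrite subrr dot_norm0 ltW.
have SZ t y : 0 < t -> S y -> S (t *: y).
  move=> t0 Sy e e0; have [|z Cz yz] := Sy (e / t); first by rewrite divr_gt0.
  exists (t *: z); first exact: CZ.
  by rewrite -scalerBr dot_normZ gtr0_norm// mulrC -ler_pdivlMr.
have SD y z : S y -> C z -> S (y + z).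
  move=> Sy Cz e e0; have [u Cu yu] := Sy _ e0.
  by exists (u + z); [exact: CD|rewrite opprD addrACA subrr addr0].
have Scl : geometrically_closed S.
  move=> u y D Su uy e e0; have e2 : 0 < e / 2 by rewrite divr_gt0.
  have D0 : 0 <= D.
    by apply: le_trans (dot_norm_ge0 (y - u 0%N)) _; have := uy 0%N; rewrite expr0 mulr1.
  have [n un] : exists n, D * 2^-1 ^+ n <= e / 2.
    have /cvgrPdist_le/(_ _ e2)[n _ /(_ n (leqnn n))] := cvg_geometric_half D.
    rewrite /= sub0r normrN => h; exists n; apply: le_trans h; exact: ler_norm.
  have [z Cz uz] := Su n _ e2; exists z => //.
  rewrite -(subrKA (u n)); apply: le_trans (ler_dot_normD _ _) _.
  by have := uy n; lra.
(* [C] is stable under positive factors only, so 0 is reached as a limit of small multiples of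
   [w]. *)
have S0 : S 0.
  move=> e e0; have w0 := dot_norm_ge0 w.
  have w1 : 0 < N w + 1 by rewrite ltr_wpDl.
  exists ((e / (N w + 1)) *: w); first by apply: CZ => //; rewrite divr_gt0.
  rewrite sub0r dot_normN dot_normZ gtr0_norm ?divr_gt0// mulrAC ler_pdivrMr//.
  by rewrite ler_pM2l// lerDl.
have bx : bounded_linear (dot x).
  split; [exact: dotDr|by move=> *; exact: dotZr|].
  by exists (N x) => y; exact: normr_dot_le.
have d2 : 0 < d / 2 by rewrite divr_gt0.
have [y [v [Sy vd yv]]] := quadratic_near_minimum Scl S0 bx d2.
pose p := x - y - 2^-1 *: v.
have pC : dot_polar C p.
  move=> z Cz; have := yv z; rewrite /p !dotBl (dotZl ip) => h.
  have : 0 <= 2 * dot y z - 2 * dot x z + dot v z.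
    by apply: h => t /andP[t0 _]; apply: SD => //; exact: CZ.
  lra.
have py : 0 <= dot p y.
  have : 0 <= 2 * dot y (- y) - 2 * dot x (- y) + dot v (- y).
    apply: yv => t /andP[t0 t1]; rewrite scalerN -[X in X - _]scale1r -scalerBl.
    have [->|t1'] := eqVneq t 1; first by rewrite subrr scale0r.
    by apply: SZ => //; rewrite subr_gt0 lt_neqAle t1'.
  rewrite /p !dotBl (dotZl ip) !dotNr; lra.
have h1 := cauchy_schwarz (- v) p; rewrite dotNl dot_normN in h1.
have p0 := dot_norm_ge0 p; have v0 := dot_norm_ge0 v.
have xE : x = p + y + 2^-1 *: v by rewrite /p [X in X + _]addrAC !subrK.
clearbody p.
have := Cx _ pC; rewrite {1}xE !(dotDl ip) (dotZl ip) -(sqr_dot_norm p) (dotC ip y) => h2.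
have pv : N p <= N v / 2.
  have [->|p1] := eqVneq (N p) 0; first by rewrite divr_ge0.
  have pp : 0 < N p by rewrite lt_neqAle eq_sym p1.
  by rewrite -(ler_pM2r pp) -expr2; nra.
have [z Cz yz] := Sy _ d2; exists z => //.
have -> : x - z = p + 2^-1 *: v + (y - z) by rewrite {1}xE (addrAC p) addrA.
apply: le_trans (ler_dot_normD _ _) _.
have := ler_dot_normD p (2^-1 *: v); rewrite dot_normZ ger0_norm ?invr_ge0//; lra.
Qed.

End inner_product.

Section coercive_operators.
Context {R : realType} {H : lmodType R} {dot : H -> H -> R}.
Hypotheses (ip : inner_product dot) (Hc : geometrically_complete dot).

(** Lax-Milgram for a symmetric operator: [dot (A x) y] is an inner product whose norm is equivalent
    to the original one, so it is complete, and Riesz representation of [dot y] in it gives the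
    solution. *)
Lemma coercive_surjective (A : H -> H) (c k : R) : 0 < c ->
  (forall x y, A (x + y) = A x + A y) -> (forall a x, A (a *: x) = a *: A x) ->
  (forall x y, dot (A x) y = dot x (A y)) ->
  (forall x, c * dot x x <= dot (A x) x) ->
  (forall x, dot_norm dot (A x) <= k * dot_norm dot x) ->
  forall y, exists x, forall h, dot (A x) h = dot y h.
Proof.
move=> c0 AD AZ Asym Ac Ak y.
pose dotA u v := dot (A u) v.
have ipA : inner_product dotA.
  split=> [u v|u v w|a u v|u]; rewrite /dotA.
  - by rewrite Asym (dotC ip).
  - by rewrite AD (dotDl ip).
  - by rewrite AZ (dotZl ip).
  - by apply: le_trans (Ac u); rewrite mulr_ge0 ?(dot_ge0 ip) ?ltW.
have sc : 0 < Num.sqrt c by rewrite sqrtr_gt0.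
have NA u : Num.sqrt c * dot_norm dot u <= dot_norm dotA u.
  by rewrite /dot_norm -sqrtrM ?(ltW c0)// ler_wsqrtr.
have AN u : dot_norm dotA u <= Num.sqrt `|k| * dot_norm dot u.
  rewrite {2}/dot_norm -sqrtrM// ler_wsqrtr// -(sqr_dot_norm ip u) /dotA.
  apply: le_trans (cauchy_schwarz ip _ _) _.
  rewrite expr2 mulrA ler_wpM2r ?dot_norm_ge0//; apply: le_trans (Ak u) _.
  by rewrite ler_wpM2r ?dot_norm_ge0// ler_norm.
have HcA : geometrically_complete dotA.
  move=> x C xC.
  have [|z [D zD]] := Hc (x := x) (C := C / Num.sqrt c).
    move=> n; rewrite mulrAC ler_pdivlMr// mulrC; exact: le_trans (NA _) (xC n).
  exists z, (Num.sqrt `|k| * D) => n; apply: le_trans (AN _) _.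
  by rewrite -mulrA ler_wpM2l ?sqrtr_ge0.
have by_ : bounded_linear (dot := dotA) (dot y).
  split=> [u v|a u|]; [exact: (dotDr ip)|exact: (dotZr ip)|].
  exists (dot_norm dot y / Num.sqrt c) => x; apply: le_trans (normr_dot_le ip _ _) _.
  rewrite -mulrA ler_wpM2l ?dot_norm_ge0// ler_pdivlMl//; exact: NA.
by have [x xE] := riesz_representation ipA HcA by_; exists x.
Qed.

End coercive_operators.

Section product_inner_product.
Context {R : realType} {H1 H2 : lmodType R}.
Variables (dot1 : H1 -> H1 -> R) (dot2 : H2 -> H2 -> R).
Hypotheses (ip1 : inner_product dot1) (ip2 : inner_product dot2).

(** The norm of a product of normed modules is a maximum; this form is what makes the product a
    Hilbert space. *)
Definition dot_pair (x y : H1 * H2) : R := dot1 x.1 y.1 + dot2 x.2 y.2.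

Lemma inner_product_pair : inner_product dot_pair.
Proof.
split=> [x y|x y z|a x y|x]; rewrite /dot_pair /=.
- by rewrite (dotC ip1) (dotC ip2).
- by rewrite (dotDl ip1) (dotDl ip2) addrACA.
- by rewrite (dotZl ip1) (dotZl ip2) mulrDr.
- by rewrite addr_ge0 ?(dot_ge0 ip1) ?(dot_ge0 ip2).
Qed.

Lemma dot_norm_fst x : dot_norm dot1 x.1 <= dot_norm dot_pair x.
Proof. by rewrite ler_wsqrtr// lerDl (dot_ge0 ip2). Qed.

Lemma dot_norm_snd x : dot_norm dot2 x.2 <= dot_norm dot_pair x.
Proof. by rewrite ler_wsqrtr// lerDr (dot_ge0 ip1). Qed.

Lemma ler_dot_norm_pair x :
  dot_norm dot_pair x <= dot_norm dot1 x.1 + dot_norm dot2 x.2.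
Proof.
have x1 := dot_norm_ge0 (dot := dot1) x.1; have x2 := dot_norm_ge0 (dot := dot2) x.2.
rewrite (ler_dot_norm_sqr inner_product_pair) ?addr_ge0// sqrrD.
rewrite (sqr_dot_norm ip1) (sqr_dot_norm ip2) /dot_pair.
by rewrite addrAC lerDl mulrn_wge0// mulr_ge0.
Qed.

Lemma geometrically_complete_pair : geometrically_complete dot1 ->
  geometrically_complete dot2 -> geometrically_complete dot_pair.
Proof.
move=> c1 c2 x C xC.
have [n|y1 [D1 h1]] := c1 (fst \o x) C.
  by apply: le_trans (xC n); exact: (dot_norm_fst (x n.+1 - x n)).
have [n|y2 [D2 h2]] := c2 (snd \o x) C.
  by apply: le_trans (xC n); exact: (dot_norm_snd (x n.+1 - x n)).
exists (y1, y2), (D1 + D2) => n; apply: le_trans (ler_dot_norm_pair _) _.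
by rewrite mulrDl lerD//=; [exact: h1|exact: h2].
Qed.

End product_inner_product.

(** * Completeness of L2 *)

Section L2_complete.
Context d (T : measurableType d) (R : realType) (mu : {measure set T -> \bar R}).

Lemma rVB_coord m (a b : 'rV[R]_m) i : (a - b) ord0 i = a ord0 i - b ord0 i.
Proof. by rewrite !mxE. Qed.

Lemma rVdotC m (a b : 'rV[R]_m) : rVdot a b = rVdot b a.
Proof. by apply: eq_bigr => i _; rewrite mulrC. Qed.

Lemma rVdotDl m (a b c : 'rV[R]_m) : rVdot (a + b) c = rVdot a c + rVdot b c.
Proof. by rewrite /rVdot -big_split; apply: eq_bigr => i _; rewrite mxE mulrDl. Qed.

Lemma rVdotZl m k (a b : 'rV[R]_m) : rVdot (k *: a) b = k * rVdot a b.
Proof. by rewrite /rVdot big_distrr /=; apply: eq_bigr => i _; rewrite mxE mulrA. Qed.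

Lemma rVdot_ge0 m (a : 'rV[R]_m) : 0 <= rVdot a a.
Proof. by apply: sumr_ge0 => i _; rewrite -expr2 sqr_ge0. Qed.

Lemma sqr_coord_le_rVdot m (a : 'rV[R]_m) i : a ord0 i ^+ 2 <= rVdot a a.
Proof.
rewrite /rVdot (bigD1 i)//= expr2 lerDl; apply: sumr_ge0 => j _.
by rewrite -expr2 sqr_ge0.
Qed.

Lemma measurable_rVdot m (g h : T -> 'rV[R]_m) :
  (forall i, measurable_fun setT (fun t => g t ord0 i)) ->
  (forall i, measurable_fun setT (fun t => h t ord0 i)) ->
  measurable_fun setT (fun t => rVdot (g t) (h t)).
Proof. by move=> mg mh; apply: measurable_sum => i; exact: measurable_funM. Qed.

Lemma Lfun2P (h : T -> R) : measurable_fun setT h ->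
  (\int[mu]_t (h t ^+ 2)%:E < +oo)%E -> h \in Lfun mu 2%:E.
Proof.
move=> mh hoo; rewrite inE; apply/andP; split; first by rewrite inE.
rewrite inE /= /finite_norm unlock /Lnorm poweR_lty//.
apply: le_lt_trans hoo; rewrite le_eqVlt; apply/orP; left; apply/eqP.
apply: eq_integral => t _ /=.
by rewrite -[2%R]/(2%:R) powR_mulrn// -normrX ger0_norm ?sqr_ge0.
Qed.

Context (m : nat).
Implicit Types v w : L2 mu m.

Lemma measurable_L2val v i : measurable_fun setT (fun t => L2val v t ord0 i).
Proof. by have := L2val_Lfun v i; rewrite inE => /andP[]; rewrite inE. Qed.

Lemma L2_of_fun (g : T -> 'rV[R]_m) :
  (forall i, (fun t => g t ord0 i) \in Lfun mu 2%:E) ->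
  exists v : L2 mu m, {ae mu, forall t, L2val v t = g t}.
Proof.
move=> gL; pose G : {ffun 'I_m -> LfunType mu (lee1n 2)} :=
  [ffun i => Lfun_Sub (lee1n 2) (gL i)].
exists (\pi_(L2 mu m) G)%qT.
have /piL2P := reprK (\pi_(L2 mu m) G)%qT.
by apply: filterS => t h; apply/rowP => i; rewrite mxE h ffunE.
Qed.

Lemma L2_inner_product : inner_product (@L2dot _ _ _ mu m).
Proof.
split; [exact: L2dotC|exact: L2dotDl|exact: L2dotZl|exact: L2dot_ge0].
Qed.

Lemma L2_dot_norm v : dot_norm (@L2dot _ _ _ mu m) v = `|v|.
Proof. by []. Qed.

Lemma L2_sqr_norm v : `|v| ^+ 2 = L2dot v v.
Proof. by rewrite -L2_dot_norm (sqr_dot_norm L2_inner_product). Qed.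

Lemma integral_L2dot v w :
  (\int[mu]_t (rVdot (L2val v t) (L2val w t))%:E)%E = (L2dot v w)%:E.
Proof.
by rewrite /L2dot fineK//; exact: integrable_fin_num (L2dot_integrable v w).
Qed.

Lemma L2valB v w : {ae mu, forall t, L2val (v - w) t = L2val v t - L2val w t}.
Proof.
apply: filterS2 (L2valD v (- w)) (L2valZ (-1) w) => t ->.
by rewrite !scaleN1r => ->.
Qed.

Lemma nonneg_series_half_lty (C : R) : 0 <= C ->
  (\sum_(0 <= k <oo) (C * 2^-1 ^+ k)%:E < +oo)%E.
Proof.
move=> C0; have := @cvg_geometric_eseries_half R (2 * C) 0.
rewrite (_ : (fun k => _) = (fun k => (C * 2^-1 ^+ k)%:E)); last first.
  apply/funext => k; congr EFin; rewrite addn1 natrX exprS exprVn.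
  by field; rewrite expf_neq0.
by move/cvg_lim => h; rewrite [X in (X < _)%E](_ : _ = (2 * C / 2 ^+ 0)%:E) ?ltry//; exact: h.
Qed.

(** From [(2^k x - 1)^2 >= 0] each increment satisfies [|x| <= 2^k x^2 + 2^-k], so the telescoping
    series converges absolutely. *)
Lemma cvg_of_weighted_increments (u : nat -> R) :
  (\sum_(0 <= k <oo) (2 ^+ k * (u k.+1 - u k) ^+ 2)%:E < +oo)%E -> cvgn u.
Proof.
move=> h.
have cs : cvgn (series (fun k => 2 ^+ k * (u k.+1 - u k) ^+ 2)).
  by apply: nnseries_is_cvg h => k; rewrite mulr_ge0 ?sqr_ge0 ?exprn_ge0.
have cg : cvgn (series (geometric 1 (2^-1 : R))).
  by apply: is_cvg_geometric_series; rewrite ger0_norm ?invr_ge0// invf_lt1// ltr1n.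
have ct : cvgn (series (telescope u)).
  apply: normed_cvg; apply: (series_le_cvg (v_ := fun k =>
    2 ^+ k * (u k.+1 - u k) ^+ 2 + geometric 1 2^-1 k)).
  - by move=> n; exact: normr_ge0.
  - move=> n; apply: addr_ge0; rewrite /= ?mul1r ?exprn_ge0 ?invr_ge0//.
    by rewrite mulr_ge0 ?sqr_ge0 ?exprn_ge0.
  - move=> n; rewrite /= mul1r /telescope exprVn.
    set x := `|_|; have -> : (u n.+1 - u n) ^+ 2 = x ^+ 2 by rewrite /x -normrX ger0_norm ?sqr_ge0.
    have p0 : 0 < 2 ^+ n :> R by rewrite exprn_gt0.
    have := sqr_ge0 (2 ^+ n * x - 1); rewrite sqrrB1 => h2.
    have x0 : 0 <= x by exact: normr_ge0.
    rewrite -(ler_pM2l p0) mulrDr mulfV ?gt_eqF//; nra.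
  - have -> : series (fun k => 2 ^+ k * (u k.+1 - u k) ^+ 2 + geometric 1 2^-1 k) =
      series (fun k => 2 ^+ k * (u k.+1 - u k) ^+ 2) + series (geometric 1 2^-1).
      by apply/funext => n; rewrite seriesD.
    exact: is_cvgD.
have -> : u = (fun n => u 0%N + series (telescope u) n).
  by apply/funext => n; exact: eq_sum_telescope.
by apply: is_cvgD => //; exact: is_cvg_cst.
Qed.

(** The integrals of [2^n |x_(n+1) - x_n|^2] are at most [C^2 2^-n], so the series of these
    functions is integrable and finite almost everywhere. Squares are summed because on a space of
    infinite measure an L2 function need not be integrable. *)
Lemma ae_cvg_L2val (x : nat -> L2 mu m) (C : R) :
  (forall n, `|x n.+1 - x n| <= C * 2^-1 ^+ n) ->
  {ae mu, forall t, forall i, cvgn (fun n => L2val (x n) t ord0 i)}.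
Proof.
move=> xC; have C0 : 0 <= C.
  by apply: le_trans (normr_ge0 (x 1%N - x 0%N)) _; have := xC 0%N; rewrite expr0 mulr1.
pose dx n t := rVdot (L2val (x n.+1 - x n) t) (L2val (x n.+1 - x n) t).
pose G n t := (2 ^+ n * dx n t)%:E.
have p0 n : 0 <= 2 ^+ n :> R by rewrite exprn_ge0.
have mdx n : measurable_fun setT (dx n).
  by apply: measurable_rVdot => i; exact: measurable_L2val.
have mG n : measurable_fun setT (G n).
  by apply/measurable_EFinP; apply: measurable_funM.
have G0 n t : (0 <= G n t)%E by rewrite lee_fin mulr_ge0// rVdot_ge0.
have intG n : (\int[mu]_t G n t <= (C ^+ 2 * 2^-1 ^+ n)%:E)%E.
  rewrite /G /dx; under eq_integral do rewrite EFinM.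
  rewrite ge0_integralZl; [|exact: measurableT|exact/measurable_EFinP/mdx|
    by move=> t _; rewrite lee_fin rVdot_ge0|by rewrite lee_fin].
  rewrite integral_L2dot -EFinM lee_fin -L2_sqr_norm.
  have -> : C ^+ 2 * 2^-1 ^+ n = 2 ^+ n * (C * 2^-1 ^+ n) ^+ 2.
    by rewrite exprMn !exprVn; field; rewrite expf_neq0.
  by rewrite ler_wpM2l// ler_sqr ?nnegrE ?normr_ge0 ?mulr_ge0 ?exprn_ge0 ?invr_ge0.
have GE : {ae mu, forall t, (\sum_(0 <= n <oo) G n t < +oo)%E}.
  have mS : measurable_fun setT (fun t => \sum_(0 <= n <oo) G n t)%E.
    by apply: ge0_emeasurable_sum.
  have : mu.-integrable setT (fun t => \sum_(0 <= n <oo) G n t)%E.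
    apply/integrableP; split=> //.
    under eq_integral => t _ do rewrite gee0_abs ?nneseries_ge0//.
    rewrite integral_nneseries//; apply: le_lt_trans (nonneg_series_half_lty (sqr_ge0 C)).
    by apply: lee_nneseries => [n _ _|n _]; [exact: integral_ge0|exact: intG].
  move/(integrable_ae measurableT); apply: filterS => t /(_ I).
  by rewrite ge0_fin_numE// nneseries_ge0.
have xB : {ae mu, forall t, forall n,
    L2val (x n.+1 - x n) t = L2val (x n.+1) t - L2val (x n) t}.
  by apply: ae_foralln => n; exact: L2valB.
move: GE xB; apply: filterS2 => t Gt xB i.
apply: cvg_of_weighted_increments; apply: le_lt_trans Gt.
apply: lee_nneseries => [n _ _|n _].
  by rewrite lee_fin mulr_ge0 ?sqr_ge0.
rewrite lee_fin ler_wpM2l//; apply: le_trans (sqr_coord_le_rVdot _ i).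
by rewrite xB !mxE.
Qed.

Lemma L2_complete (x : nat -> L2 mu m) (C : R) :
  (forall n, `|x n.+1 - x n| <= C * 2^-1 ^+ n) ->
  exists y : L2 mu m, (forall n, `|y - x n| <= 2 * C * 2^-1 ^+ n) /\
    {ae mu, forall t, forall i,
      (fun n => L2val (x n) t ord0 i) @ \oo --> L2val y t ord0 i}.
Proof.
move=> xC; have xcv := ae_cvg_L2val xC; have C0 : 0 <= C.
  by apply: le_trans (normr_ge0 (x 1%N - x 0%N)) _; have := xC 0%N; rewrite expr0 mulr1.
(* The upper limit is measurable on the whole space, also where the sequence diverges, and is the
   limit almost everywhere. *)
pose g t : 'rV[R]_m := \row_i fine (limn_esup (fun n => (L2val (x n) t ord0 i)%:E)).
have mg i : measurable_fun setT (fun t => g t ord0 i).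
  under eq_fun do rewrite mxE.
  apply: (measurableT_comp (fine_measurable measurableT)).
  apply: measurable_fun_limn_esup => n; apply/measurable_EFinP.
  exact: measurable_L2val.
have gcv : {ae mu, forall t, forall i,
    (fun n => L2val (x n) t ord0 i) @ \oo --> g t ord0 i}.
  apply: filterS xcv => t h i; rewrite mxE.
  have := h i => /cvg_ex[l hl].
  have /cvg_limn_einf_sup[_ ->] : (fun n => (L2val (x n) t ord0 i)%:E) @ \oo --> l%:E.
    by apply/fine_cvgP; split; [exact: nearW|].
  exact: hl.
pose h n t : 'rV[R]_m := g t - L2val (x n) t.
have mh n i : measurable_fun setT (fun t => h n t ord0 i).
  under eq_fun do rewrite rVB_coord.
  by apply: measurable_funB => //; exact: measurable_L2val.
(* Fatou's lemma in [k] for the squared distances of [x (n + k)] and [x n], whose integrals are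
   bounded by the geometric tail. *)
have hh_le n : (\int[mu]_t (rVdot (h n t) (h n t))%:E <= ((2 * C * 2^-1 ^+ n) ^+ 2)%:E)%E.
  pose f k t := (rVdot (L2val (x (n + k)%N - x n) t) (L2val (x (n + k)%N - x n) t))%:E.
  have mf k : measurable_fun setT (f k).
    by apply/measurable_EFinP; apply: measurable_rVdot => i; exact: measurable_L2val.
  have f0 k t : setT t -> (0 <= f k t)%E by move=> _; rewrite lee_fin rVdot_ge0.
  have := fatou mu measurableT mf f0.
  have hE : {ae mu, forall t, limn_einf (f^~ t) = (rVdot (h n t) (h n t))%:E}.
    have xB : {ae mu, forall t, forall k,
        L2val (x (n + k)%N - x n) t = L2val (x (n + k)%N) t - L2val (x n) t}.
      by apply: ae_foralln => k; exact: L2valB.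
    move: gcv xB; apply: filterS2 => t gt xB.
    suff /cvg_limn_einf_sup[-> _] : f^~ t @ \oo --> (rVdot (h n t) (h n t))%:E by [].
    apply/fine_cvgP; split; first exact: nearW.
    have -> : fine \o f^~ t = fun k => \sum_i (L2val (x (n + k)%N) t - L2val (x n) t) ord0 i *
       (L2val (x (n + k)%N) t - L2val (x n) t) ord0 i.
      by apply/funext => k /=; rewrite xB.
    apply: (cvg_big (x0 := 0) (op := +%R)) => [|i _]; first exact: add_continuous.
    have ci : (fun k => (L2val (x (n + k)%N) t - L2val (x n) t) ord0 i) @ \oo --> h n t ord0 i.
      rewrite /h rVB_coord; under eq_fun do rewrite rVB_coord.
      apply: cvgB; last exact: cvg_cst.
      have := gt i; rewrite -(cvg_shiftn n).
      by under eq_fun do rewrite addnC.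
    exact: cvgM.
  have mlim : measurable_fun setT (fun t => limn_einf (f^~ t)).
    rewrite (_ : (fun _ => _) = fun t => (- limn_esup (fun k => - f k t))%E); last first.
      by apply/funext => t; rewrite -limn_einfN; congr limn_einf; apply/funext => k; rewrite [RHS]oppeK.
    apply: measurableT_comp => //; apply: measurable_fun_limn_esup => k.
    exact: measurableT_comp.
  rewrite (ae_eq_integral (fun t => (rVdot (h n t) (h n t))%:E) _ measurableT mlim); last 2 first.
  - exact/measurable_EFinP/measurable_rVdot.
  - by apply: filterS hE => t -> _.
  move/le_trans; apply.
  rewrite limn_einf_lim; apply: lime_le; first exact: is_cvg_einfs.
  apply: nearW => k; apply: ge_ereal_inf; exists (\int[mu]_t f k t)%E.
    by exists k => /=.
  rewrite integral_L2dot lee_fin -L2_sqr_norm ler_sqr ?nnegrE ?normr_ge0 ?mulr_ge0 ?exprn_ge0 ?invr_ge0//.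
  apply: le_trans (geometric_tail L2_inner_product n k xC) _.
  by rewrite ler_wpM2l ?mulr_ge0// gerBl exprn_ge0 ?invr_ge0.
have hL n i : (fun t => h n t ord0 i) \in Lfun mu 2%:E.
  apply: Lfun2P => //; apply: le_lt_trans (le_lt_trans (hh_le n) (ltry _)).
  apply: ge0_le_integral => //.
  - by move=> t _; rewrite lee_fin sqr_ge0.
  - exact/measurable_EFinP/measurable_funX.
  - exact/measurable_EFinP/measurable_rVdot.
  - by move=> t _; rewrite lee_fin sqr_coord_le_rVdot.
(* Only the differences [g - x n] are known to be square-integrable, so the limit class is built as
   [x 0 + w]. *)
have [w wE] := L2_of_fun (hL 0%N).
have yE : {ae mu, forall t, L2val (x 0%N + w) t = g t}.
  apply: filterS2 (L2valD (x 0%N) w) wE => t -> ->.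
  by rewrite /h addrC subrK.
exists (x 0%N + w); split; last first.
  by move: yE gcv; apply: filterS2 => t yt gt i; rewrite yt.
move=> n; rewrite -ler_sqr ?nnegrE ?normr_ge0 ?mulr_ge0 ?exprn_ge0 ?invr_ge0//.
rewrite L2_sqr_norm -lee_fin -integral_L2dot; apply: le_trans (hh_le n).
rewrite le_eqVlt; apply/orP; left; apply/eqP; apply: ge0_ae_eq_integral => //.
- apply/measurable_EFinP/measurable_rVdot => i; exact: measurable_L2val.
- exact/measurable_EFinP/measurable_rVdot.
- by move=> t _; rewrite lee_fin rVdot_ge0.
- by move=> t _; rewrite lee_fin rVdot_ge0.
- apply: filterS2 (L2valB (x 0%N + w) (x n)) yE => t /= -> -> _.
  by [].
Qed.

Lemma L2_geometrically_complete : geometrically_complete (@L2dot _ _ _ mu m).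
Proof.
by move=> x C /L2_complete[y [xy _]]; exists y, (2 * C).
Qed.

(** The rate makes the increments of [x] geometric, so [L2_complete] gives a limit with convergence
    almost everywhere along the whole sequence, and limits are unique. *)
Lemma ae_cvg_of_geometric_cvg (x : nat -> L2 mu m) (y : L2 mu m) (D : R) :
  (forall n, `|y - x n| <= D * 2^-1 ^+ n) ->
  {ae mu, forall t, forall i,
      (fun n => L2val (x n) t ord0 i) @ \oo --> L2val y t ord0 i}.
Proof.
move=> xy.
have q0 n : 0 <= 2^-1 ^+ n :> R by rewrite exprn_ge0 ?invr_ge0.
have D0 : 0 <= D by apply: le_trans (normr_ge0 (y - x 0%N)) _; have := xy 0%N; rewrite expr0 mulr1.
have [n|z [xz zae]] := @L2_complete x (2 * D).
  rewrite -(subrKA y); apply: le_trans (ler_normD _ _) _.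
  rewrite distrC; have := xy n.+1; have := xy n.
  rewrite exprS; have := mulr_ge0 D0 (q0 n); lra.
suff -> : y = z by [].
apply/eqP; rewrite -subr_eq0 -normr_le0.
apply: (@ler_add_geometric _ _ _ (D + 2 * (2 * D))) => n; rewrite add0r.
rewrite -(subrKA (x n)); apply: le_trans (ler_normD _ _) _.
by rewrite mulrDl lerD// distrC.
Qed.

End L2_complete.

(** * Subdifferentials of integral functionals *)

Section euclidean.
Context {R : realType} {m : nat}.
Implicit Types f : 'rV[R]_m -> \bar R.

Lemma lsc_measurable_rV f : lower_semicontinuous f -> measurable_fun setT f.
Proof.
move=> lf; apply: (measurability _ (ErealGenOInfty.measurableE R)).
move=> /= _ [_ [a ->]] <-; rewrite setTI; apply: open_measurable_rV.
by rewrite preimage_itvoy; move/lower_semicontinuousP : lf; exact.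
Qed.

(** Since [f] is not continuous, density has to hold in its graph: values are approximated from
    above together with points. The sequence picks a point of each rational box meeting a rational
    strict sublevel set, and [y0] when there is none. *)
Lemma exists_dense_sequence_graph f : (exists y, f y < +oo)%E ->
  exists Y : nat -> 'rV[R]_m, (forall k, f (Y k) < +oo)%E /\
    forall y e, 0 < e -> f y \is a fin_num ->
    exists k, (forall i, `|Y k ord0 i - y ord0 i| < e) /\ (f (Y k) < f y + e%:E)%E.
Proof.
move=> [y0 fy0].
pose A (c : 'rV[rat]_m * rat * rat) : set 'rV[R]_m :=
  [set y : 'rV[R]_m | (forall i, `|ratr (c.1.1 ord0 i) - y ord0 i| < ratr c.1.2) /\
           (f y < (ratr c.2)%:E)%E].
pose Y k := if unpickle k is Some c then xget y0 (A c) else y0.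
exists Y; split=> [k|y e e0 fy].
  rewrite /Y; case: unpickle => // c; case: xgetP => // y -> [_ h].
  exact: lt_le_trans h (leey _).
have e20 : 0 < e / 2 by rewrite divr_gt0.
have [r /itvP rE] := rat_in_itvoo e20.
have r0 : 0 < ratr r :> R by rewrite rE.
have re : ratr r < e / 2 by rewrite rE.
have qP (i : 'I_m) : {q : rat | `|ratr q - y ord0 i| < ratr r}.
  apply: cid.
  have yr : y ord0 i - ratr r < y ord0 i + ratr r by rewrite ltrD2l gtrN.
  have [q] := rat_in_itvoo yr.
  by rewrite in_itv/= -ltr_distl => qi; exists q.
have fe : fine (f y) < fine (f y) + e by rewrite ltrDl.
have [s /itvP sE] := rat_in_itvoo fe.
pose c := (\row_i sval (qP i), r, s).
have Ay : A c y.
  split=> /= [i|]; first by rewrite mxE; exact: (svalP (qP i)).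
  by rewrite -[f y]fineK// lte_fin sE.
exists (pickle c); rewrite /Y pickleK.
case: xgetP => [z _ [/= zr zs]|/(_ y)//]; split=> [i|].
  have := svalP (qP i); have := zr i; rewrite mxE.
  set q := ratr _ => h1 h2; rewrite -(subrKA q) (splitr e).
  apply: le_lt_trans (ler_normD _ _) _; rewrite distrC.
  by apply: ltrD; [exact: lt_trans h1 re|exact: lt_trans h2 re].
by apply: lt_le_trans zs _; rewrite -[f y]fineK// -EFinD lee_fin ltW// sE.
Qed.

Lemma cvg_rV_coord (u : nat -> 'rV[R]_m) (l : 'rV[R]_m) :
  (forall i, (fun n => u n ord0 i) @ \oo --> l ord0 i) -> u @ \oo --> l.
Proof.
move=> ul; apply/cvg_ballP => e e0.
have : \forall n \near \oo, forall i, `|l ord0 i - u n ord0 i| < e.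
  by apply: filter_forall => i; have /cvgrPdist_lt/(_ e e0) := ul i.
apply: filterS => n h; split=> // j i.
by rewrite (ord1 j) -ball_normE /=; exact: h.
Qed.

Lemma cvg_rVdot (u w : nat -> 'rV[R]_m) (a b : 'rV[R]_m) :
  (forall i, (fun n => u n ord0 i) @ \oo --> a ord0 i) ->
  (forall i, (fun n => w n ord0 i) @ \oo --> b ord0 i) ->
  (fun n => rVdot (u n) (w n)) @ \oo --> rVdot a b.
Proof.
move=> ua wb; apply: (cvg_big (x0 := 0) (op := +%R)) => [|i _]; first exact: add_continuous.
by apply: cvgM; [exact: ua|exact: wb].
Qed.

Lemma subdifferential_closed f (v eta : nat -> 'rV[R]_m) (v0 eta0 : 'rV[R]_m) :
  lower_semicontinuous f -> (forall y, -oo < f y)%E ->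
  (forall n, subdifferential (@rVdot R m) f (v n) (eta n)) ->
  (forall i, (fun n => v n ord0 i) @ \oo --> v0 ord0 i) ->
  (forall i, (fun n => eta n ord0 i) @ \oo --> eta0 ord0 i) ->
  subdifferential (@rVdot R m) f v0 eta0.
Proof.
move=> lf fNy sub vv ee w.
have [->|fw] := eqVneq (f w) +oo%E; first exact: leey.
have fwf : f w \is a fin_num by rewrite fin_numE fw andbT gt_eqF ?fNy.
rewrite -leeBrDr// leNgt; apply/negP; rewrite -[f w]fineK// -EFinB.
set r := fine (f w) - _ => rv.
(* Lower semicontinuity keeps [f (v n)] above [a > r], while the subgradient inequalities bound it
   by a sequence tending to [r]. This also covers [f v0 = +oo]. *)
have [a ra /lf[U Uv0 Uf]] : exists2 a, r < a & (a%:E < f v0)%E.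
  move: rv (fNy v0); case: (f v0) => [s| |]//.
    by rewrite lte_fin => rs _; exists ((r + s) / 2); rewrite ?lte_fin ?midf_lt.
  by exists (r + 1); rewrite ?ltry// ltrDl.
have vU : \forall n \near \oo, U (v n) by exact: cvg_rV_coord vv _ Uv0.
have rn : (fun n => fine (f w) - rVdot (eta n) (w - v n)) @ \oo --> r.
  apply: cvgB; first exact: cvg_cst.
  apply: cvg_rVdot => // i; rewrite rVB_coord; under eq_fun do rewrite rVB_coord.
  by apply: cvgB; [exact: cvg_cst|exact: vv].
suff : a <= r by rewrite leNgt ra.
apply: (ler_cvg_to (@cvg_cst _ a nat \oo _) rn).
apply: filterS vU => n /Uf fa; rewrite -lee_fin EFinB fineK// leeBrDr//.
by apply: le_trans (sub n w); rewrite leeD2r// ltW.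
Qed.

End euclidean.

Section integral_subdifferential.
Context d (T : measurableType d) (R : realType) (mu : {measure set T -> \bar R}).

Lemma integrable_of_fin_num (g : T -> \bar R) : measurable_fun setT g ->
  (\int[mu]_t g t)%E \is a fin_num -> mu.-integrable setT g.
Proof.
move=> mg; rewrite integralE fin_numB => /andP[gp gn]; apply/integrableP; split=> //.
rewrite -[(fun t => `|g t|)%E]/(abse \o g) fune_abse.
rewrite ge0_integralD//; [|exact: measurable_funepos|exact: measurable_funeneg].
by rewrite lte_add_pinfty// ltey_eq ?gp ?gn.
Qed.

Lemma integral_ge0_ae_eq0 (g : T -> R) : mu.-integrable setT (EFin \o g) ->
  {ae mu, forall t, 0 <= g t} -> (\int[mu]_t g t <= 0)%R ->
  {ae mu, forall t, g t = 0}.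
Proof.
move=> ig g0 gle.
have mg := measurable_int _ ig.
have E : (\int[mu]_t `|(g t)%:E|)%E = (\int[mu]_t (g t)%:E)%E.
  apply: ae_eq_integral => //; first exact: measurableT_comp.
  by apply: filterS g0 => t g0 _; rewrite gee0_abs ?lee_fin.
have : (\int[mu]_t `|(g t)%:E|)%E = 0%E.
  apply/eqP; rewrite eq_le integral_ge0// andbT E -[leLHS]fineK ?lee_fin//.
  exact: integrable_fin_num ig.
move/(ae_eq_integral_abs mu measurableT mg); apply: filterS => t /(_ I).
by case.
Qed.

Context (m : nat) (f : 'rV[R]_m -> \bar R).
Hypotheses (f_proper : proper_fun f) (f_lsc : lower_semicontinuous f).
Let F := @integral_functional _ _ _ mu m f.
Implicit Types v w eta : L2 mu m.

Let fNy y : (-oo < f y)%E.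
Proof. by case: f_proper. Qed.

Let fv v t : R := fine (f (L2val v t)).

Let mf v : measurable_fun setT (fun t => f (L2val v t)).
Proof.
apply: (measurableT_comp (lsc_measurable_rV f_lsc)).
by apply: measurable_fun_rV => i; exact: measurable_L2val.
Qed.

Let integrable_f v : F v \is a fin_num -> mu.-integrable setT (fun t => f (L2val v t)).
Proof. by move=> Fv; apply: integrable_of_fin_num Fv; exact: mf. Qed.

Let f_ae_fin v : F v \is a fin_num -> {ae mu, forall t, f (L2val v t) \is a fin_num}.
Proof.
move=> /integrable_f /(integrable_ae measurableT); apply: filterS => t; exact.
Qed.

Let mfv v : measurable_fun setT (fv v).
Proof. by apply: (measurableT_comp (fine_measurable measurableT)); exact: mf. Qed.

Let integrable_fv v : F v \is a fin_num -> mu.-integrable setT (EFin \o fv v).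
Proof.
move=> Fv; have iv := integrable_f Fv.
apply: (le_integrable measurableT _ _ iv); first exact/measurable_EFinP/mfv.
move=> t _; rewrite /fv /=; case: (f (L2val v t)) => [r| |] //=; rewrite normr0 leey//.
Qed.

Let integral_fv v : F v \is a fin_num -> F v = (\int[mu]_t fv v t)%:E.
Proof.
move=> Fv; rewrite /Rintegral fineK; last exact: integrable_fin_num (integrable_fv Fv).
apply: ae_eq_integral => //; [exact/measurable_EFinP/mfv|].
by apply: filterS (f_ae_fin Fv) => t h _ /=; rewrite /fv fineK.
Qed.

Lemma subdiff_fin_num v eta : proper_fun F -> subdiff F v eta -> F v \is a fin_num.
Proof.
move=> [FNy [w Fw]] /(_ w) h; rewrite fin_numE gt_eqF ?FNy//=.
by apply/eqP => Fv; move: h; rewrite Fv addye// leye_eq => /eqP h; rewrite h in Fw.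
Qed.

Let L2dot_Rintegral v w : L2dot v w = (\int[mu]_t rVdot (L2val v t) (L2val w t))%R.
Proof. by []. Qed.

(** The pointwise subgradient inequalities are integrated, after the finiteness of [F v] has been
    secured. *)
Lemma subdiff_of_ae v eta : proper_fun F ->
  {ae mu, forall t, subdifferential (@rVdot R m) f (L2val v t) (L2val eta t)} ->
  subdiff F v eta.
Proof.
move=> [FNy [w0 Fw0]] sub.
have fin w : (F w < +oo)%E -> F w \is a fin_num.
  by move=> Fw; rewrite fin_numE gt_eqF ?FNy// lt_eqF.
pose H w t := fv w t - rVdot (L2val eta t) (L2val (w - v) t).
have iH w : F w \is a fin_num -> mu.-integrable setT (EFin \o H w).
  move=> Fw; have := integrableB measurableT (integrable_fv Fw) (L2dot_integrable eta (w - v)).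
  by apply: eq_integrable => //= t _; rewrite /H EFinB.
have fH w : F w \is a fin_num -> {ae mu, forall t, (f (L2val v t) <= (H w t)%:E)%E}.
  move=> Fw; move: sub (f_ae_fin Fw) (L2valB w v); apply: filterS3 => t + fw wE.
  by move=> /(_ (L2val w t)) h; rewrite /H EFinB /fv fineK// leeBrDr// wE.
(* Tested at [w0], where [F] is finite, the pointwise inequality bounds [f (v t)] above by the
   integrable [H w0]; so the positive part of [f (v t)] has finite integral and [F v] is not
   [+oo]. *)
have Fv : F v \is a fin_num.
  rewrite fin_numE gt_eqF ?FNy//=; apply/eqP => Fvy.
  have := iH _ (fin _ Fw0) => /integrableP[mH].
  have := fH _ (fin _ Fw0) => fle.
  have : (\int[mu]_t (fun t => f (L2val v t))^\+ t <= \int[mu]_t `|(EFin \o H w0) t|)%E.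
    apply: ae_ge0_le_integral => //.
    - exact: measurable_funepos.
    - exact: measurableT_comp.
    - apply: filterS fle => t h _; rewrite funeposE /= ge_max [X in _ && X]lee_fin normr_ge0 andbT.
      by apply: le_trans h _; rewrite lee_fin ler_norm.
  move=> /le_lt_trans /[apply].
  move: Fvy; rewrite /F /integral_functional integralE.
  case: (\int[mu]_t (fun t => f (L2val v t))^\+ t)%E => //= r.
  have : (0 <= \int[mu]_t (fun t => f (L2val v t))^\- t)%E by exact: integral_ge0.
  by case: (\int[mu]_t (fun t => f (L2val v t))^\- t)%E.
move=> w; have [->|Fw] := eqVneq (F w) +oo%E; first exact: leey.
have {}Fw : F w \is a fin_num by apply: fin; rewrite ltey.
rewrite (integral_fv Fv) (integral_fv Fw) -EFinD lee_fin L2dot_Rintegral.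
rewrite -lerBrDl -RintegralB//; [|exact: integrable_fv|exact: integrable_fv].
rewrite -subr_ge0 -RintegralB//; last 2 first.
- have := integrableB measurableT (integrable_fv Fw) (integrable_fv Fv).
  by apply: eq_integrable.
- exact: L2dot_integrable.
pose k t := fv w t - fv v t - rVdot (L2val eta t) (L2val (w - v) t).
have mk : measurable_fun setT k.
  apply: measurable_funB; first exact: measurable_funB.
  by apply: measurable_rVdot => i; exact: measurable_L2val.
rewrite -/(\int[mu]_t k t)%R /Rintegral fine_ge0//.
rewrite (ae_eq_integral (fun t => `|k t|%:E)) //.
- by apply: integral_ge0 => t _; rewrite lee_fin.
- exact/measurable_EFinP.
- by apply/measurable_EFinP; exact: measurableT_comp.
- move: (fH _ Fw) (f_ae_fin Fv); apply: filterS2 => t h fvt _.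
  rewrite ger0_norm// /k addrAC subr_ge0 -lee_fin /fv fineK//.
Qed.

(* Perturbing v to the constant y on a set of finite measure where the
   pointwise inequality fails contradicts the subgradient inequality of F. *)
Let subgradient_ae_on v eta y (E : set T) : F v \is a fin_num -> subdiff F v eta ->
  f y \is a fin_num -> measurable E -> (mu E < +oo)%E ->
  {ae mu, forall t, E t ->
    fv v t + rVdot (L2val eta t) (y - L2val v t) <= fine (f y)}.
Proof.
move=> Fv sub fy mE Eoo; set c := fine (f y).
pose k t := fv v t + rVdot (L2val eta t) (y - L2val v t) - c.
have mvy i : measurable_fun setT (fun t => (y - L2val v t) ord0 i).
  under eq_fun do rewrite rVB_coord.
  by apply: measurable_funB => //; exact: measurable_L2val.
have mk : measurable_fun setT k.
  apply: measurable_funB => //; apply: measurable_funD => //.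
  by apply: measurable_rVdot => // i; exact: measurable_L2val.
pose A := E `&` [set t | 0 < k t].
have mA : measurable A.
  apply: measurableI => //; rewrite -[X in measurable X]setTI.
  rewrite (_ : [set t | 0 < k t] = k @^-1` `]0, +oo[); first exact: mk.
  by apply/seteqP; split=> t /=; rewrite in_itv/= andbT.
have Aoo : (mu A < +oo)%E.
  by apply: le_lt_trans Eoo; apply: le_measure; rewrite ?inE// => t [].
have mI : measurable_fun setT (\1_A : T -> R) by [].
have cL a : (fun t => \1_A t * a : R) \in Lfun mu 2%:E.
  apply: Lfun2P; first exact: measurable_funM.
  have -> : (fun t => ((\1_A t * a) ^+ 2)%:E) = (fun t => (a ^+ 2)%:E * (\1_A t)%:E)%E.
    apply/funext => t; rewrite -EFinM exprMn mulrC; congr (_ * _)%:E.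
    by rewrite indicE; case: (_ \in _); rewrite ?expr1n ?expr0n.
  rewrite ge0_integralZl; [|exact: measurableT|exact/measurable_EFinP|
    by move=> t _; rewrite lee_fin|by rewrite lee_fin sqr_ge0].
  by rewrite integral_indic// setIT lte_mul_pinfty// lee_fin sqr_ge0.
have vL i : (fun t => \1_A t * L2val v t ord0 i) \in Lfun mu 2%:E.
  apply: Lfun2P; first by apply: measurable_funM => //; exact: measurable_L2val.
  have /integrableP[m2] := Lfun2_integrable_sqr (L2val_Lfun v i).
  apply: le_lt_trans; apply: ge0_le_integral => //.
  - by move=> t _; rewrite lee_fin sqr_ge0.
  - apply/measurable_EFinP/measurable_funX/measurable_funM => //; exact: measurable_L2val.
  - exact: measurableT_comp.
  - move=> t _; rewrite /= lee_fin (ger0_norm (sqr_ge0 _)) exprMn.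
    by rewrite indicE; case: (_ \in _); rewrite ?expr1n ?expr0n ?mul1r ?mul0r ?sqr_ge0.
pose z t : 'rV[R]_m := \1_A t *: (y - L2val v t).
have zL i : (fun t => z t ord0 i) \in Lfun mu 2%:E.
  have := (Lfun_submod_closed mu (lee1n 2)).2 (-1) _ _ (vL i) (cL (y ord0 i)).
  rewrite (_ : _ + _ = fun t => z t ord0 i)//; apply: funext => t.
  by rewrite /z mxE rVB_coord mulrBr addrC; congr (_ + _); exact: mulN1r.
have [w wE] := L2_of_fun zL.
pose P t := fv v t + (\1_A t * c - \1_A t * fv v t).
have iA : mu.-integrable setT (EFin \o (fun t => \1_A t * c)).
  have /Lfun1_integrable := Lfun2_mul_Lfun1 (cL 1) (cL c).
  apply: eq_integrable => // t _; rewrite /= mulr1 mulrA indicE.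
  by case: (_ \in _); rewrite ?mulr1 ?mulr0.
have iAf : mu.-integrable setT (EFin \o (fun t => \1_A t * fv v t)).
  apply: (le_integrable measurableT _ _ (integrable_fv Fv)).
    by apply/measurable_EFinP; exact: measurable_funM.
  move=> t _; rewrite /= lee_fin normrM indicE.
  by case: (_ \in _); rewrite ?normr1 ?normr0 ?mul1r ?mul0r.
have iP : mu.-integrable setT (EFin \o P).
  have := integrableD measurableT (integrable_fv Fv) (integrableB measurableT iA iAf).
  by apply: eq_integrable.
have FP : F (v + w) = (\int[mu]_t P t)%:E.
  rewrite /Rintegral fineK; last exact: integrable_fin_num iP.
  apply: ae_eq_integral => //; first exact: measurable_int _ iP.
  move: wE (L2valD v w) (f_ae_fin Fv); apply: filterS3 => t wt vwt ft _ /=.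
  rewrite vwt wt /z /P indicE; case: (_ \in _).
    by rewrite scale1r !mul1r (addrC (L2val v t)) subrK (addrC (fv v t)) subrK /c fineK.
  by rewrite scale0r !mul0r subrr !addr0 /fv fineK.
(* [P] represents [f] along [v + w]. The subgradient inequality at [v + w] says that the integral of
   [G] is at most 0, whereas [G] is [k] on [A] and 0 elsewhere, hence nonnegative; so [A] is
   negligible. *)
pose G t := fv v t + rVdot (L2val eta t) (L2val w t) - P t.
have iG : mu.-integrable setT (EFin \o G).
  have := integrableB measurableT (integrableD measurableT (integrable_fv Fv)
    (L2dot_integrable eta w)) iP.
  by apply: eq_integrable.
have GE : {ae mu, forall t, G t = \1_A t * k t}.
  apply: filterS wE => t wt; rewrite /G wt /z rVdotC rVdotZl rVdotC /P /k; ring.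
have : {ae mu, forall t, G t = 0}.
  apply: integral_ge0_ae_eq0 => //.
    apply: filterS GE => t ->; rewrite indicE; case: (boolP (_ \in _)); last by rewrite mul0r.
    by rewrite inE => -[_ /ltW]; rewrite mul1r.
  rewrite RintegralB//; last first.
    have := integrableD measurableT (integrable_fv Fv) (L2dot_integrable eta w).
    by apply: eq_integrable.
  rewrite RintegralD//; [|exact: integrable_fv|exact: L2dot_integrable].
  rewrite subr_le0 -lee_fin -FP EFinD -integral_fv//.
  by have := sub (v + w); rewrite (addrC v) addrK.
move: GE; apply: filterS2 => t -> Gt Et; rewrite leNgt; apply/negP => kt.
have : t \in A by rewrite inE; split=> //=; rewrite subr_gt0.
move: Gt; rewrite indicE => /[swap] ->; rewrite mul1r => k0.
by move: kt; rewrite -subr_gt0 -/(k t) k0 ltxx.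
Qed.

(** The exceptional null set of [subgradient_ae_on] depends on [y] and on [E]. Countably many sets
    exhaust the space and countably many [y] are dense in the graph of [f], so one null set serves
    for every [y]. *)
Lemma ae_of_subdiff v eta : sigma_finite setT mu -> proper_fun F ->
  subdiff F v eta ->
  {ae mu, forall t, subdifferential (@rVdot R m) f (L2val v t) (L2val eta t)}.
Proof.
move=> [E TE Eoo] Fp sub; have Fv := subdiff_fin_num Fp sub.
have [Y [Yoo Yd]] := exists_dense_sequence_graph f_proper.2.
have YE : {ae mu, forall t, forall j k, E j t ->
    fv v t + rVdot (L2val eta t) (Y k - L2val v t) <= fine (f (Y k))}.
  apply: ae_foralln => j; apply: ae_foralln => k; have [mE Ej] := Eoo j.
  apply: subgradient_ae_on => //.
  by rewrite fin_numE gt_eqF ?fNy//= lt_eqF.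
move: YE (f_ae_fin Fv); apply: filterS2 => t YE ft y.
have [->|fy] := eqVneq (f y) +oo%E; first exact: leey.
have {}fy : f y \is a fin_num by rewrite fin_numE gt_eqF ?fNy.
have [j _ Ejt] : (\bigcup_j E j) t by rewrite -TE.
rewrite -[f (L2val v t)]fineK// -[f y]fineK// -EFinD lee_fin.
pose s := \sum_i `|L2val eta t ord0 i|.
have s0 : 0 <= s by apply: sumr_ge0.
apply/ler_addgt0Pr => e e0.
(* Replacing [y] by [Y k] costs [e / (s + 1)] in the value and [s] times that in the pairing, which
   makes [e] in total. *)
have e1 : 0 < e / (s + 1) by rewrite divr_gt0// ltr_wpDl.
have [k [Yk fYk]] := Yd y _ e1 fy.
have h1 := YE j k Ejt.
have h2 : fine (f (Y k)) < fine (f y) + e / (s + 1).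
  rewrite -lte_fin EFinD !fineK//.
  by rewrite fin_numE gt_eqF ?fNy//= lt_eqF.
have h3 : rVdot (L2val eta t) (y - Y k) <= e / (s + 1) * s.
  rewrite /rVdot /s mulr_sumr; apply: ler_sum => i _.
  apply: le_trans (ler_norm _) _; rewrite normrM mulrC ler_wpM2r//.
  by rewrite rVB_coord distrC ltW.
have -> : y - L2val v t = (Y k - L2val v t) + (y - Y k) by rewrite [RHS]addrC subrKA.
rewrite rVdotC rVdotDl !(rVdotC _ (L2val eta t)).
have -> : e = e / (s + 1) + e / (s + 1) * s by field; rewrite gt_eqF// ltr_wpDl.
rewrite -/(fv v t); lra.
Qed.

(** The graph is closed because membership is a pointwise condition almost everywhere:
    [ae_of_subdiff], a pointwise limit, then [subdiff_of_ae]. *)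
Lemma subdiff_geometrically_closed (v eta : nat -> L2 mu m) v0 eta0 D :
  sigma_finite setT mu -> proper_fun F ->
  (forall n, subdiff F (v n) (eta n)) ->
  (forall n, `|v0 - v n| <= D * 2^-1 ^+ n) ->
  (forall n, `|eta0 - eta n| <= D * 2^-1 ^+ n) ->
  subdiff F v0 eta0.
Proof.
move=> sf Fp sub vD eD; apply: subdiff_of_ae => //.
have sub' : {ae mu, forall t, forall n,
    subdifferential (@rVdot R m) f (L2val (v n) t) (L2val (eta n) t)}.
  by apply: ae_foralln => n; exact: ae_of_subdiff.
move: (ae_cvg_of_geometric_cvg vD) (ae_cvg_of_geometric_cvg eD) sub'.
by apply: filterS3 => t vt et st; exact: subdifferential_closed f_lsc fNy st vt et.
Qed.

End integral_subdifferential.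

(** * First and second derivatives of K *)

Section frechet.
Context {R : realType} {V W : normedModType R}.

Definition frechet (f : V -> W) (u : V) (L : V -> W) := forall e : R, 0 < e ->
  \forall h \near (0 : V), `|f (u + h) - f u - L h| <= e * `|h|.

Lemma frechet_diff (f : V -> W) u : differentiable f u -> frechet f u ('d f u).
Proof.
move=> /diff_locally/eqaddoP fd e e0; have := fd _ e0; apply: filterS => h.
by rewrite !fctE /= opprD addrA [h + u]addrC.
Qed.

Lemma diff_frechet (f : V -> W) u (L : {linear V -> W}) :
  continuous L -> frechet f u L -> 'd f u = L :> (V -> W).
Proof.
move=> cL fL; apply: diff_unique => //; apply/eqaddoP => e e0.
have := fL _ e0; apply: filterS => h.
by rewrite !fctE /= opprD addrA [h + u]addrC.
Qed.

Lemma nbhs0_ball (P : V -> Prop) : (\forall h \near (0 : V), P h) ->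
  exists2 d : R, 0 < d & forall h, `|h| < d -> P h.
Proof.
move=> /nbhs_ballP[d /= d0 dP]; exists d => // h hd; apply: dP.
by rewrite -ball_normE /= sub0r normrN.
Qed.

Lemma near_distC_lt (u : V) (e : R) : 0 < e -> \forall u' \near u, `|u' - u| < e.
Proof.
move=> e0; apply/nbhs_ballP; exists e => // u'.
by rewrite -ball_normE /= distrC.
Qed.

Lemma frechet_cvg (f : V -> W) u (L : V -> W) h :
  (forall a x, L (a *: x) = a *: L x) -> frechet f u L ->
  (fun t : R => t^-1 *: (f (u + t *: h) - f u)) @ 0^' --> L h.
Proof.
move=> LZ fL; apply/cvgrPdist_le => e e0.
have h1 : 0 < `|h| + 1 by rewrite ltr_wpDl.
have [d d0 dP] := nbhs0_ball (fL _ (divr_gt0 e0 h1)).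
have : \forall t \near (0 : R)^', `|t| < d / (`|h| + 1).
  by apply: dnbhs0_lt; exact: divr_gt0.
have t0 : \forall t \near (0 : R)^', t != 0 :> R by exact: nbhs_dnbhs_neq.
move: t0; apply: filterS2 => t t0 td.
have := dP (t *: h); rewrite normrZ LZ => hd.
have {}hd : `|f (u + t *: h) - f u - t *: L h| <= e / (`|h| + 1) * (`|t| * `|h|).
  apply: hd; move: td; rewrite ltr_pdivlMr//; apply: le_lt_trans.
  by rewrite ler_wpM2l// lerDl.
have -> : L h - t^-1 *: (f (u + t *: h) - f u) =
    - (t^-1 *: (f (u + t *: h) - f u - t *: L h)).
  by rewrite [in RHS]scalerBr scalerA mulVf// scale1r opprB.
rewrite normrN normrZ normfV mulrC ler_pdivrMr ?normr_gt0//.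
apply: le_trans hd _.
have eh : e / (`|h| + 1) * `|h| <= e by rewrite mulrAC ler_pdivrMr// ler_pM2l// lerDl.
by have := ler_wpM2l (normr_ge0 t) eh; lra.
Qed.

Lemma frechet_continuous (f : V -> W) u (L : V -> W) (k : R) : 0 <= k ->
  frechet f u L -> (forall h, `|L h| <= k * `|h|) -> f @ u --> f u.
Proof.
move=> k0 fL Lk; apply/cvgrPdist_le => e e0.
have k1 : 0 < 1 + k by rewrite ltr_pwDl.
have [d d0 dP] := nbhs0_ball (fL _ ltr01).
have : \forall u' \near u, `|u' - u| < Num.min d (e / (1 + k)).
  by apply: near_distC_lt; rewrite lt_min d0 divr_gt0.
apply: filterS => u'; rewrite lt_min => /andP[ud ue].
have := dP _ ud; rewrite [u + _]addrC subrK mul1r => h.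
rewrite distrC -(subrK (L (u' - u)) (f u' - f u)).
apply: le_trans (ler_normD _ _) _; apply: le_trans (lerD h (Lk _)) _.
by rewrite -{1}[`|u' - u|]mul1r -mulrDl mulrC -ler_pdivlMr// ltW.
Qed.

Lemma diff_bounded (f : V -> W) u : differentiable f u ->
  exists2 k : R, 0 <= k & forall h, `|'d f u h| <= k * `|h|.
Proof.
move=> df; have /linear_bounded_continuous/linear_boundedP := @diff_continuous _ _ _ (nbhs u) f df.
move=> /pinfty_ex_gt0[k k0 kP]; exists k => //; exact: ltW.
Qed.

End frechet.

Section adjoint.
Context d (T : measurableType d) (R : realType) (mu : {measure set T -> \bar R}).

Lemma cvg_L2dot (I : Type) (F : set_system I) {FF : Filter F} m (a b : I -> L2 mu m) a0 b0 :
  a @ F --> a0 -> b @ F --> b0 -> (fun i => L2dot (a i) (b i)) @ F --> L2dot a0 b0.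
Proof.
move=> aa bb.
have ip := L2_inner_product mu m.
have -> : (fun i => L2dot (a i) (b i)) = (fun i => L2dot (a i - a0) (b i) +
    L2dot a0 (b i - b0) + L2dot a0 b0).
  by apply/funext => i; rewrite (dotBl ip) (dotBr ip); ring.
rewrite -[X in _ --> X]add0r; apply: cvgD; last exact: cvg_cst.
rewrite -[X in _ --> X]addr0; apply: cvgD; apply/norm_cvg0P.
  apply: (@squeeze_cvgr _ _ _ _ (fun=> 0) (fun i => `|a i - a0| * `|b i|)).
  - by apply: nearW => i; rewrite normr_ge0 (normr_dot_le ip).
  - exact: cvg_cst.
  - rewrite -[X in _ --> X](mul0r `|b0|); apply: cvgM; last exact: cvg_norm.
    by apply/norm_cvg0P/subr_cvg0.
apply: (@squeeze_cvgr _ _ _ _ (fun=> 0) (fun i => `|a0| * `|b i - b0|)).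
- by apply: nearW => i; rewrite normr_ge0 (normr_dot_le ip).
- exact: cvg_cst.
- rewrite -[X in _ --> X](mulr0 `|a0|); apply: cvgM; first exact: cvg_cst.
  by apply/norm_cvg0P/subr_cvg0.
Qed.

Lemma L2dot_ext m (a b : L2 mu m) : (forall x, L2dot a x = L2dot b x) -> a = b.
Proof.
move=> ab; apply/eqP; rewrite -subr_eq0; apply/eqP/L2dot_eq0.
by rewrite (dotBl (L2_inner_product mu m)) ab subrr.
Qed.

Lemma norm_le_L2dot m (a : L2 mu m) k : 0 <= k ->
  (forall x, L2dot a x <= k * `|x|) -> `|a| <= k.
Proof.
move=> k0 ak; have [->|a0] := eqVneq a 0; first by rewrite normr0.
have an : 0 < `|a| by rewrite normr_gt0.
by rewrite -(ler_pM2r an) -expr2 L2_sqr_norm.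
Qed.

Context {p m : nat}.
Implicit Types A : L2 mu p -> L2 mu m.

(** [adjoint] is a choice among representers; Riesz representation shows that there is one to
    choose. *)
Lemma adjointP A k : linear A -> (forall x, `|A x| <= k * `|x|) ->
  forall y x, L2dot (adjoint A y) x = L2dot y (A x).
Proof.
move=> lA Ak y.
have ipY := L2_inner_product mu m.
have AD x x' : A (x + x') = A x + A x' by have := lA 1 x x'; rewrite !scale1r.
have A0 : A 0 = 0.
  by apply: (@addrI _ (A 0)); rewrite -AD !addr0.
have AZ a x : A (a *: x) = a *: A x by have := lA a x 0; rewrite A0 !addr0.
have bl : bounded_linear (dot := @L2dot _ _ _ mu p) (fun x => L2dot y (A x)).
  split=> [x x'|a x|].
  - by rewrite AD (dotDr ipY).
  - by rewrite AZ (dotZr ipY).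
  - exists (`|y| * k) => x; apply: le_trans (normr_dot_le ipY _ _) _.
    by rewrite -mulrA ler_wpM2l ?dot_norm_ge0//; exact: Ak.
have [a aP] := riesz_representation (L2_inner_product mu p)
  (@L2_geometrically_complete _ _ _ mu p) bl.
exact: (@getPex _ [set a | forall x, L2dot a x = L2dot y (A x)] (ex_intro _ a aP)).
Qed.

End adjoint.

(* The first two derivatives of K in representable form: adj u and adj2 u v
   are the Riesz representations of y |-> <y, K'(u) .> and of the Hessian of
   <v, K(.)> at u. *)
Record second_order d (T : measurableType d) (R : realType)
    (mu : {measure set T -> \bar R}) (p m : nat) (K : L2 mu p -> L2 mu m)
    (DK : L2 mu p -> L2 mu p -> L2 mu m)
    (D2K : L2 mu p -> L2 mu p -> L2 mu p -> L2 mu m)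
    (adj : L2 mu p -> L2 mu m -> L2 mu p)
    (adj2 : L2 mu p -> L2 mu m -> L2 mu p -> L2 mu p) : Prop := SecondOrder {
  DK_linear : forall u, linear (DK u);
  DK_bounded : forall u,
    exists2 k : R, 0 <= k & forall x, `|DK u x| <= k * `|x|;
  K_frechet : forall u, frechet K u (DK u);
  adjP : forall u y x, L2dot (adj u y) x = L2dot y (DK u x);
  D2K_linear : forall u x, linear (D2K u ^~ x);
  D2K_bounded : forall u,
    exists2 C : R, 0 <= C & forall h x, `|D2K u h x| <= C * `|h| * `|x|;
  D2K_derivative : forall u (e : R), 0 < e ->
    \forall h \near (0 : L2 mu p), forall x,
      `|DK (u + h) x - DK u x - D2K u h x| <= e * `|h| * `|x|;
  D2K_continuous : forall u (e : R), 0 < e ->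
    \forall u' \near u, forall h x, `|D2K u' h x - D2K u h x| <= e * `|h| * `|x|;
  adj2P : forall u v h x, L2dot (adj2 u v h) x = L2dot v (D2K u h x) }.

Section second_order_theory.
Local Opaque L2dot.
Context d (T : measurableType d) (R : realType) (mu : {measure set T -> \bar R}).
Context {p m : nat} {K : L2 mu p -> L2 mu m}.
Context {DK : L2 mu p -> L2 mu p -> L2 mu m} {D2K : L2 mu p -> L2 mu p -> L2 mu p -> L2 mu m}.
Context {adj : L2 mu p -> L2 mu m -> L2 mu p}.
Context {adj2 : L2 mu p -> L2 mu m -> L2 mu p -> L2 mu p}.
Hypothesis hK : second_order K DK D2K adj adj2.

Let ipX := L2_inner_product mu p.
Let ipY := L2_inner_product mu m.

Lemma DKZ u a x : DK u (a *: x) = a *: DK u x.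
Proof.
have l := DK_linear hK u.
have l0 : DK u 0 = 0 by have := l (-1) 0 0; rewrite !scaleN1r oppr0 addr0 addNr.
by have := l a x 0; rewrite l0 !addr0.
Qed.

Lemma DKD u x y : DK u (x + y) = DK u x + DK u y.
Proof. by have := DK_linear hK u 1 x y; rewrite !scale1r. Qed.

Lemma adj_add u y z : adj u (y + z) = adj u y + adj u z.
Proof. by apply: L2dot_ext => x; rewrite (dotDl ipX) !(adjP hK) (dotDl ipY). Qed.

Lemma adj_scale u a y : adj u (a *: y) = a *: adj u y.
Proof. by apply: L2dot_ext => x; rewrite (dotZl ipX) !(adjP hK) (dotZl ipY). Qed.

Lemma adj_sub u y z : adj u (y - z) = adj u y - adj u z.
Proof. by rewrite adj_add -scaleN1r adj_scale scaleN1r. Qed.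

Lemma adj_bounded u : exists2 k : R, 0 <= k & forall y, `|adj u y| <= k * `|y|.
Proof.
have [k k0 kP] := DK_bounded hK u; exists k => // y.
apply: norm_le_L2dot => [|x]; first exact: mulr_ge0.
rewrite (adjP hK); apply: le_trans (cauchy_schwarz ipY _ _) _.
by rewrite (mulrC k) -mulrA ler_wpM2l ?dot_norm_ge0//; exact: kP.
Qed.

Lemma adj2_linear u v : linear (adj2 u v).
Proof.
move=> a h h'; apply: L2dot_ext => x.
rewrite (dotDl ipX) (dotZl ipX) !(adj2P hK) -(dotZr ipY) -(dotDr ipY).
by congr L2dot; exact: (D2K_linear hK).
Qed.

Lemma adj2Z u v a h : adj2 u v (a *: h) = a *: adj2 u v h.
Proof.
have l := adj2_linear u v.
have l0 : adj2 u v 0 = 0 by have := l (-1) 0 0; rewrite !scaleN1r oppr0 addr0 addNr.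
by have := l a h 0; rewrite l0 !addr0.
Qed.

Lemma adj2D u v h h' : adj2 u v (h + h') = adj2 u v h + adj2 u v h'.
Proof. by have := adj2_linear u v 1 h h'; rewrite !scale1r. Qed.

Lemma adj2_bounded u v :
  exists2 C : R, 0 <= C & forall h, `|adj2 u v h| <= C * `|h|.
Proof.
have [C C0 CP] := D2K_bounded hK u.
exists (`|v| * C); first exact: mulr_ge0.
move=> h; apply: norm_le_L2dot; first by rewrite !mulr_ge0.
move=> x; rewrite (adj2P hK); apply: le_trans (cauchy_schwarz ipY _ _) _.
by rewrite -!mulrA ler_wpM2l ?dot_norm_ge0// mulrA; exact: CP.
Qed.

(** Tested against [x], the remainder of the adjoint becomes the pairing of [v] with the remainder
    of [DK], so the operator-norm estimate carries over with a factor [|v|]. *)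
Lemma frechet_adj u v :
  frechet (fun u' => adj u' v) u (adj2 u v).
Proof.
move=> e e0; have v1 : 0 < `|v| + 1 by rewrite ltr_wpDl.
have := D2K_derivative hK u (divr_gt0 e0 v1); apply: filterS => h hP.
apply: norm_le_L2dot => [|x]; first by rewrite mulr_ge0// ltW.
rewrite !(dotBl ipX) !(adjP hK) (adj2P hK) -!(dotBr ipY).
apply: le_trans (cauchy_schwarz ipY _ _) _.
apply: le_trans (ler_wpM2l (dot_norm_ge0 v) (hP x)) _.
rewrite L2_dot_norm !mulrA ler_wpM2r// ler_wpM2r//.
by rewrite ler_pdivrMr// mulrC ler_pM2l// lerDl.
Qed.

Lemma DK_local_lipschitz u : exists2 C : R, 0 <= C &
  \forall h \near (0 : L2 mu p), forall x,
    `|DK (u + h) x - DK u x| <= C * `|h| * `|x|.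
Proof.
have [C C0 CP] := D2K_bounded hK u; exists (1 + C); first by rewrite addr_ge0.
have := D2K_derivative hK u ltr01; apply: filterS => h hP x.
rewrite -(subrK (D2K u h x) (_ - _)); apply: le_trans (ler_normD _ _) _.
by have := hP x; rewrite mul1r => hPx; rewrite !mulrDl mul1r lerD.
Qed.

Lemma DK_near u (k : R) : 0 < k ->
  \forall u' \near u, forall x, `|DK u' x - DK u x| <= k * `|x|.
Proof.
move=> k0; have [C C0 CP] := DK_local_lipschitz u.
have C1 : 0 < C + 1 by rewrite ltr_wpDl.
have [e e0 eP] := nbhs0_ball CP.
have : \forall u' \near u, `|u' - u| < Num.min e (k / (C + 1)).
  by apply: near_distC_lt; rewrite lt_min e0 divr_gt0.
apply: filterS => u'; rewrite lt_min => /andP[ue uk] x.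
have := eP _ ue x; rewrite [u + _]addrC subrK => /le_trans; apply.
rewrite ler_wpM2r//; apply: le_trans (_ : C * (k / (C + 1)) <= _).
  by rewrite ler_wpM2l// ltW.
by rewrite mulrA ler_pdivrMr// mulrC ler_pM2l// lerDl.
Qed.

Lemma adj2_near u v (k : R) : 0 < k ->
  \forall u' \near u & v' \near v,
    forall h, `|adj2 u' v' h - adj2 u v h| <= k * `|h|.
Proof.
move=> k0; have [C C0 CP] := D2K_bounded hK u.
pose e := k / 2 / (`|v| + 1); have v1 : 0 < `|v| + 1 by rewrite ltr_wpDl.
have e0 : 0 < e by rewrite !divr_gt0.
have C1 : 0 < C + 1 by rewrite ltr_wpDl.
have ev : `|v| * e <= k / 2.
  by rewrite /e mulrA ler_pdivrMr// mulrC ler_pM2l ?divr_gt0// lerDl.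
near=> u' v' => h.
apply: norm_le_L2dot => [|x]; first by rewrite mulr_ge0// ltW.
have D1 : forall h x, `|D2K u' h x - D2K u h x| <= 1 * `|h| * `|x|.
  by near: u'; exact: (D2K_continuous hK).
have D2 : forall h x, `|D2K u' h x - D2K u h x| <= e * `|h| * `|x|.
  by near: u'; exact: (D2K_continuous hK).
have vv : `|v' - v| <= k / 2 / (C + 1).
  by apply: ltW; near: v'; apply: near_distC_lt; rewrite !divr_gt0.
have D3 : `|D2K u' h x| <= (C + 1) * (`|h| * `|x|).
  rewrite -(subrK (D2K u h x) (D2K u' h x)); apply: le_trans (ler_normD _ _) _.
  by rewrite mulrDl addrC lerD// mulrA.
(* The changes in [v] and in [u] are separated; each is allowed half of [k]. *)
have -> : L2dot (adj2 u' v' h - adj2 u v h) x =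
    L2dot (v' - v) (D2K u' h x) + L2dot v (D2K u' h x - D2K u h x).
  by rewrite (dotBl ipX) !(adj2P hK) (dotBl ipY) (dotBr ipY); ring.
have hx : 0 <= `|h| * `|x| by rewrite mulr_ge0.
rewrite -mulrA (splitr k) mulrDl; apply: lerD.
  apply: le_trans (cauchy_schwarz ipY _ _) _.
  apply: le_trans (ler_pM (dot_norm_ge0 _) (dot_norm_ge0 _) vv D3) _.
  by rewrite le_eqVlt; apply/orP; left; apply/eqP; field; rewrite gt_eqF.
apply: le_trans (cauchy_schwarz ipY _ _) _.
apply: le_trans (ler_wpM2l (dot_norm_ge0 v) (D2 h x)) _.
rewrite L2_dot_norm; apply: le_trans (ler_wpM2r hx ev).
by rewrite -!mulrA.
Unshelve. all: by end_near. Qed.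

(** * Symmetry of the second derivative *)

Let is_derive_L2dot v w x r : is_derive r (1 : R)
  (fun s : R => L2dot v (K (w + s *: x))) (L2dot v (DK (w + r *: x) x)).
Proof.
pose g (s : R) := L2dot v (K (w + s *: x)).
have c : (fun t : R => t^-1 *: ((g \o shift r) (t *: 1) - g r)) @ 0^' -->
    L2dot v (DK (w + r *: x) x).
  have := frechet_cvg (h := x) (@DKZ (w + r *: x)) (K_frechet hK (w + r *: x)).
  move=> /(cvg_L2dot (cvg_cst v)).
  rewrite (_ : (fun t : R => L2dot v (t^-1 *: (K (w + r *: x + t *: x) - K (w + r *: x)))) =
    (fun t : R => t^-1 *: ((g \o shift r) (t *: 1) - g r)))//.
  apply/funext => t; rewrite (dotZr ipY) (dotBr ipY).
  have -> // : w + r *: x + t *: x = w + (t *: 1 + r) *: x.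
  by rewrite -addrA -scalerDl [t *: 1]mulr1 [r + t]addrC.
by apply: DeriveDef; [exact: (cvgP _ c)|exact: (cvg_lim _ c)].
Qed.

Let second_difference v u h x t := L2dot v (K (u + t *: h + t *: x)) -
  L2dot v (K (u + t *: h)) - L2dot v (K (u + t *: x)) + L2dot v (K u).

(** The mean value theorem along [x] turns the second difference into [t] times an increment of the
    first derivative, which [D2K_derivative] linearises at [u]; [M * t] bounds the weights of both
    remainders together. *)
Let second_difference_approx v u h x e : 0 < e -> exists2 d, 0 < d &
  forall t, 0 < t < d ->
  `|second_difference v u h x t - t ^+ 2 * L2dot v (D2K u h x)| <= e * t ^+ 2.
Proof.
move=> e0; pose M := `|v| * ((`|h| + 2 * `|x|) * `|x|).
have M0 : 0 <= M by rewrite !mulr_ge0// addr_ge0// mulr_ge0.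
have M1 : 0 < M + 1 by rewrite ltr_wpDl.
have [b b0 bP] := nbhs0_ball (D2K_derivative hK u (divr_gt0 e0 M1)).
have hx0 : 0 < `|h| + `|x| + 1 by rewrite ltr_wpDl// addr_ge0.
exists (b / (`|h| + `|x| + 1)); first exact: divr_gt0.
move=> t /andP[t0]; rewrite ltr_pdivlMr// => td.
pose psi r := L2dot v (K (u + t *: h + r *: x)) - L2dot v (K (u + r *: x)).
pose dpsi r := L2dot v (DK (u + t *: h + r *: x) x) - L2dot v (DK (u + r *: x) x).
have dpsiP r : is_derive r (1 : R) psi (dpsi r).
  by apply: is_deriveB; exact: is_derive_L2dot.
have cpsi : {within `[0, t], continuous psi}.
  apply: continuous_subspaceT => r; apply/differentiable_continuous/derivable1_diffP.
  by case: (dpsiP r).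
have [c /andP[]] := MVT t0 (fun r _ => dpsiP r) cpsi.
rewrite !bnd_simp => c0 ct.
have -> : psi t - psi 0 = second_difference v u h x t.
  rewrite /psi /second_difference scale0r !addr0.
  move: (L2dot v (K (u + t *: h + t *: x))) (L2dot v (K (u + t *: x)))
    (L2dot v (K (u + t *: h))) (L2dot v (K u)) => a1 a2 a3 a4; ring.
rewrite subr0 => ->.
have D2ZD : D2K u (t *: h + c *: x) x - D2K u (c *: x) x = t *: D2K u h x.
  by rewrite (D2K_linear hK u x t h (c *: x)) addrK.
have nx : `|c *: x| <= t * `|x| by rewrite normrZ gtr0_norm// ler_wpM2r// ltW.
have nhx : `|t *: h + c *: x| <= t * (`|h| + `|x|).
  apply: le_trans (ler_normD _ _) _.
  by rewrite normrZ (gtr0_norm t0) mulrDr (lerD (lexx _) nx).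
have td' : t * (`|h| + `|x|) < b by apply: le_lt_trans td; rewrite (ler_wpM2l (ltW t0))// lerDl.
have h1 := bP _ (le_lt_trans nhx td') x.
have td2 : t * `|x| < b by apply: le_lt_trans td'; rewrite (ler_wpM2l (ltW t0))// lerDr.
have h2 := bP _ (le_lt_trans nx td2) x.
(* The two terms [DK u x] cancel and, by linearity in the first slot, the [D2K] terms differ by
   exactly [t *: D2K u h x]; two linearisation errors remain. *)
have -> : dpsi c * t - t ^+ 2 * L2dot v (D2K u h x) = t * L2dot v (
    (DK (u + (t *: h + c *: x)) x - DK u x - D2K u (t *: h + c *: x) x) -
    (DK (u + c *: x) x - DK u x - D2K u (c *: x) x)).
  have -> : forall y y' z w w' : L2 mu m, (y - z - y') - (w - z - w') = (y - w) - (y' - w').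
    move=> y y' z w w'; rewrite !opprD !opprK addrACA; congr (_ + _).
    by rewrite [- w + z]addrC subrKA.
  by rewrite D2ZD (dotBr ipY) (dotZr ipY) (dotBr ipY) /dpsi addrA; ring.
rewrite normrM gtr0_norm// mulrC expr2 mulrA ler_wpM2r ?(ltW t0)//.
apply: le_trans (normr_dot_le ipY _ _) _; rewrite !L2_dot_norm.
apply: le_trans (ler_wpM2l (normr_ge0 v) (ler_normB _ _)) _.
apply: le_trans (ler_wpM2l (normr_ge0 v) (lerD h1 h2)) _.
apply: le_trans (_ : e / (M + 1) * (M * t) <= _); last first.
  rewrite mulrA ler_wpM2r ?(ltW t0)// mulrAC ler_pdivrMr// ler_pM2l//.
  by rewrite lerDl.
have hs : `|t *: h + c *: x| + `|c *: x| <= t * (`|h| + 2 * `|x|).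
  apply: le_trans (lerD nhx nx) _; move: `|h| `|x| => a3 a4.
  by rewrite -mulrDr -addrA mulr2n mulrDl mul1r.
have E0 : 0 <= `|v| * (e / (M + 1)) by rewrite mulr_ge0// divr_ge0// ltW.
have := ler_wpM2l E0 (ler_wpM2r (normr_ge0 x) hs).
rewrite /M; move: `|_ + _| `|c *: x| `|v| `|h| `|x| (e / _) => a1 a2 a3 a4 a5 E H.
have -> : a3 * (E * a1 * a5 + E * a2 * a5) = a3 * E * ((a1 + a2) * a5) by ring.
by apply: le_trans H _; rewrite le_eqVlt; apply/orP; left; apply/eqP; ring.
Qed.

(** The second difference is symmetric in [h] and [x], and both pairings are its limit after
    division by [t ^+ 2]. This is what makes [alpha I] plus the Hessian selfadjoint. *)
Lemma D2K_symmetric v u h x : L2dot v (D2K u h x) = L2dot v (D2K u x h).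
Proof.
apply/eqP; rewrite -subr_eq0 -normr_le0; apply/ler_addgt0Pr => e e0.
have e2 : 0 < e / 2 by rewrite divr_gt0.
have [d1 d10 d1P] := second_difference_approx v u h x e2.
have [d2 d20 d2P] := second_difference_approx v u x h e2.
pose t := Num.min d1 d2 / 2.
have m0 : 0 < Num.min d1 d2 by rewrite lt_min d10.
have t0 : 0 < t by rewrite divr_gt0.
have tm : t < Num.min d1 d2 by rewrite /t ltr_pdivrMr// ltr_pMr// ltr1n.
have := d1P t; have := d2P t; rewrite t0 /=.
have -> : second_difference v u x h t = second_difference v u h x t.
  rewrite /second_difference (addrAC u (t *: x)).
  move: (L2dot v (K (u + t *: h + t *: x))) (L2dot v (K (u + t *: x)))
    (L2dot v (K (u + t *: h))) (L2dot v (K u)) => a1 a2 a3 a4; ring.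
move: tm; rewrite lt_min => /andP[-> ->] /(_ isT) h2 /(_ isT) h1.
have tt : 0 < t ^+ 2 by rewrite exprn_gt0.
move: h1 h2; move: (L2dot v (D2K u h x)) (L2dot v (D2K u x h))
  (second_difference v u h x t) => A B D h1 h2.
rewrite add0r -(ler_pM2l tt) -[X in X * `|_|](gtr0_norm tt) -normrM.
have -> : t ^+ 2 * (A - B) = (D - t ^+ 2 * B) - (D - t ^+ 2 * A) by ring.
apply: le_trans (ler_normB _ _) _; apply: le_trans (lerD h2 h1) _.
by rewrite -mulrDl -splitr mulrC.
Qed.

End second_order_theory.

(** * Convex hulls *)

Section convex_hull.
Context {R : realType} {E : lmodType R}.
Implicit Types A : set E.

Lemma convex_setP A : convex_set (A : set (convex_lmodType E)) <->
  forall (x y : E) (t : R), 0 <= t <= 1 -> A x -> A y -> A (t *: x + (1 - t) *: y).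
Proof.
split=> [cA x y t /andP[t0 t1] /mem_set Ax /mem_set Ay|h x y t].
  exact: set_mem (cA x y (Itv01 t0 t1) Ax Ay).
rewrite !inE => Ax Ay; apply: h => //.
by rewrite ge0 le1.
Qed.

Lemma convex_hull_convex A (x y : E) (t : R) : 0 <= t <= 1 ->
  convex_hull A x -> convex_hull A y -> convex_hull A (t *: x + (1 - t) *: y).
Proof.
move=> t01 Ax Ay C hC; have [/convex_setP cC _] := hC.
exact: (cC _ _ _ t01 (Ax C hC) (Ay C hC)).
Qed.

(** Carries first-order inequalities from tangent vectors to the convexified derivative. *)
Lemma convex_hull_halfspace A (phi : E -> R) :
  (forall x y, phi (x + y) = phi x + phi y) ->
  (forall a x, phi (a *: x) = a * phi x) ->
  (forall x, A x -> 0 <= phi x) -> forall x, convex_hull A x -> 0 <= phi x.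
Proof.
move=> phiD phiZ phiA x; apply: (smallest_sub (X := [set x | 0 <= phi x])) => //.
apply/convex_setP => y z t /andP[t0 t1] /= y0 z0.
by rewrite phiD !phiZ addr_ge0// mulr_ge0// subr_ge0.
Qed.

End convex_hull.

(** * The operators of the theorem in representable form *)

Section second_order_data.
Context d (T : measurableType d) (R : realType) (mu : {measure set T -> \bar R}).
Context {p m : nat}.

Lemma C2_second_order (K : L2 mu p -> L2 mu m) : C2 K -> exists D2K adj2,
  second_order K (fun u => 'd K u) D2K (fun u => adjoint ('d K u)) adj2.
Proof.
move=> [dK [D2K hD]]; exists D2K, (fun u v h => adjoint (D2K u h) v).
have D2b u : exists2 C : R, 0 <= C & forall h x, `|D2K u h x| <= C * `|h| * `|x|.
  have [_ _ [C CP] _ _] := hD u; exists `|C| => // h x; apply: le_trans (CP h x) _.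
  by rewrite -!mulrA ler_wpM2r ?mulr_ge0// ler_norm.
split.
- by move=> u a x y; rewrite linearP.
- by move=> u; exact: diff_bounded.
- by move=> u; exact: frechet_diff.
- move=> u; have [k _ kP] := diff_bounded (dK u).
  by apply: (adjointP (k := k)) => // a x y; rewrite linearP.
- by move=> u x; have [_ + _ _ _] := hD u; exact.
- exact: D2b.
- by move=> u e; have [_ _ _ + _] := hD u; exact.
- by move=> u e; have [_ _ _ _ +] := hD u; exact.
- move=> u v h; have [C _ CP] := D2b u; have [l _ _ _ _] := hD u.
  by apply: (adjointP (k := C * `|h|)) => //; exact: l.
Qed.

(** [adj2 u v] is a bounded linear Frechet derivative by [frechet_adj], and such a derivative is
    unique. *)
Lemma hessianE (K : L2 mu p -> L2 mu m) D2K adj2 :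
  second_order K (fun u => 'd K u) D2K (fun u => adjoint ('d K u)) adj2 ->
  forall u v h, hessian K u v h = adj2 u v h.
Proof.
move=> hK u v h.
pose L : {linear L2 mu p -> L2 mu p} := HB.pack (adj2 u v)
  (GRing.isLinear.Build _ _ _ _ (adj2 u v) (adj2_linear hK u v)).
have cL : continuous L.
  apply/linear_bounded_continuous/linear_boundedP.
  have [C C0 CP] := adj2_bounded hK u v.
  apply: filterS (nbhs_pinfty_ge (num_real C)) => r Cr x.
  by apply: le_trans (CP x) _; rewrite ler_wpM2r.
by rewrite /hessian (diff_frechet (L := L) cL (frechet_adj hK u v)).
Qed.

Lemma bbar_gt0 (alpha : R) (K : L2 mu p -> L2 mu m) F V u v :
  (0 < bbar alpha K F V u v)%E ->
  exists t b : R, [/\ 0 < t, 0 < b & forall v' eta' z nu,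
    subdiff F v' eta' -> `|v' - v| < t -> `|eta' - K u| < t ->
    V v' eta' z -> polar (V v' eta') nu ->
    b * `|z| <= `|Bbar alpha K u v z - nu|].
Proof.
move=> /ereal_sup_gt[_ [t /= t0 <-]] I0.
set A := (X in ereal_inf X) in I0.
(* The infimum itself serves as [b], unless it is [+oo]: then no pair competes and 1 will do. *)
have [b b0 bA] : exists2 b : R, 0 < b & forall y, A y -> (b%:E <= y)%E.
  move: I0; case E : (ereal_inf A) => [b| |]//; first last.
    by move=> _; exists 1 => // y Ay; have := ereal_inf_lbound Ay; rewrite E leye_eq => /eqP ->; rewrite leey.
  by rewrite lte_fin => b0; exists b => // y Ay; rewrite -E; exact: ereal_inf_lbound.
exists t, b; split=> // v' eta' z nu sub vt et Vz Pnu.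
have [->|z0] := eqVneq z 0; first by rewrite normr0 mulr0.
rewrite -ler_pdivlMr ?normr_gt0// -lee_fin; apply: bA.
by exists (z, nu) => //=; exists v', eta'.
Qed.

(** Coercivity and symmetry make [A] onto, so [pinv] returns a true preimage of the adjoint
    vector. *)
Lemma Bbar_spec (alpha cG : R) (K : L2 mu p -> L2 mu m) D2K adj2 u v :
  second_order K (fun u => 'd K u) D2K (fun u => adjoint ('d K u)) adj2 ->
  0 < cG ->
  (forall x, cG * `|x| ^+ 2 <= alpha * `|x| ^+ 2 + L2dot (hessian K u v x) x) ->
  forall z, exists w, alpha *: w + adj2 u v w = adjoint ('d K u) z /\
    Bbar alpha K u v z = 'd K u w.
Proof.
move=> hK c0 cP z.
have ip := L2_inner_product mu p.
pose A w := alpha *: w + adj2 u v w.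
have hA w : alpha *: w + hessian K u v w = A w by rewrite (hessianE hK).
have [C C0 CP] := adj2_bounded hK u v.
have Asurj y : exists w, A w = y.
  have AD x x' : A (x + x') = A x + A x' by rewrite /A scalerDr (adj2D hK) addrACA.
  have AZ a x : A (a *: x) = a *: A x.
    by rewrite /A [RHS]scalerDr (adj2Z hK) !scalerA mulrC.
  have Asym x x' : L2dot (A x) x' = L2dot x (A x').
    rewrite /A (dotDl ip) (dotDr ip) (dotZl ip) (dotZr ip); congr (_ + _).
    by rewrite (adj2P hK) (D2K_symmetric hK) -(adj2P hK) L2dotC.
  have Ac x : cG * L2dot x x <= L2dot (A x) x.
    by rewrite /A (dotDl ip) (dotZl ip) -L2_sqr_norm -(hessianE hK); exact: cP.
  have Ak x : `|A x| <= (`|alpha| + C) * `|x|.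
    by rewrite /A mulrDl; apply: le_trans (ler_normD _ _) _; rewrite normrZ lerD.
  have [w wP] := coercive_surjective ip (@L2_geometrically_complete _ _ _ mu p)
    c0 AD AZ Asym Ac Ak y.
  by exists w; apply: L2dot_ext.
exists (pinv setT (fun w => alpha *: w + hessian K u v w) (adjoint ('d K u) z)); split=> //.
rewrite -/(A _) -hA; apply: (@pinvK _ _ _ setT (fun w => alpha *: w + hessian K u v w)).
have [w wz] := Asurj (adjoint ('d K u) z).
by rewrite inE; exists w => //; rewrite hA.
Qed.

End second_order_data.

(** * First-order conditions for the residual *)

Section convexified.
Context d (T : measurableType d) (R : realType) (mu : {measure set T -> \bar R}).
Context {m : nat} {F : L2 mu m -> \bar R} {v eta : L2 mu m} {V : set (L2 mu m)}.
Hypothesis sub : subdiff F v eta.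
Hypothesis V_cone : cone V.
Hypothesis V_derivative : forall dv, convexified_derivative (subdiff F) v eta dv =
  if `[< V dv >] then [set 0 *: dv + nu | nu in polar V] else set0.

Let hull := convex_hull (graph (graphical_derivative (subdiff F) v eta)).

Lemma tangent0 : tangent (graph (subdiff F)) (v, eta) (0, 0).
Proof.
exists (fun n => 1 * 2^-1 ^+ n), (fun=> (v, eta)); split=> //.
- move=> i j ij; rewrite !mul1r; apply: ler_wiXn2l => //.
  by rewrite invf_le1 ?ler1n.
- exact: cvg_geometric_half.
- have -> : (fun n => (1 * 2^-1 ^+ n)^-1 *: ((v, eta) - (v, eta))) = fun=> 0.
    by apply/funext => n; rewrite subrr scaler0.
  exact: cvg_cst.
Qed.

Lemma hull_of_cone z nu : V z -> polar V nu -> hull (z, nu).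
Proof.
move=> Vz Pnu; have := V_derivative z; case: asboolP => // _ E.
suff : convexified_derivative (subdiff F) v eta z nu by [].
by rewrite E; exists nu => //; rewrite scale0r add0r.
Qed.

Lemma cone_of_hull z nu : hull (z, nu) -> V z.
Proof.
move=> h; have := V_derivative z; case: asboolP => // _ E.
suff : convexified_derivative (subdiff F) v eta z nu by rewrite E.
exact: h.
Qed.

(** The zero vector is tangent to the graph, and a first component of the hull lies in [V] by the
    formula for the convexified derivative. *)
Lemma cone_0 : V 0.
Proof.
apply: (@cone_of_hull _ 0); apply: sub_gen_smallest.
exact: tangent0.
Qed.

Lemma polar_0 : polar V 0.
Proof. by move=> z _; rewrite (dot0l (L2_inner_product mu m)). Qed.

(** [V] inherits convexity from the hull, which contains [V] paired with 0: the midpoint of [y] and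
    [z] lies in [V], and [V_cone] doubles it. *)
Lemma cone_add y z : V y -> V z -> V (y + z).
Proof.
move=> Vy Vz; have half : 0 <= (2^-1 : R) <= 1 by rewrite invr_ge0 ler0n invf_le1// ler1n.
have := convex_hull_convex half (hull_of_cone Vy polar_0) (hull_of_cone Vz polar_0).
move=> /cone_of_hull /(V_cone (ltr0n R 2)).
have -> : 1 - 2^-1 = 2^-1 :> R by field.
by rewrite scalerDr !scalerA mulfV// !scale1r.
Qed.

End convexified.

Section first_order.
Local Opaque L2dot.
Context d (T : measurableType d) (R : realType) (mu : {measure set T -> \bar R}).
Context {p m : nat}.
Notation X := (L2 mu p).
Notation Y := (L2 mu m).
Let ipX := L2_inner_product mu p.
Let ipY := L2_inner_product mu m.

Lemma half_expr_cvg_dnbhs : (fun n => 2^-1 ^+ n : R) @ \oo --> (0 : R)^'.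
Proof.
move=> A A0.
have h : \forall n \near \oo, 1 * 2^-1 ^+ n != 0 :> R -> A (1 * 2^-1 ^+ n).
  exact: (cvg_geometric_half (1 : R) A0).
apply: filterS h => n /=; rewrite mul1r; apply.
by rewrite expf_neq0// invr_neq0.
Qed.

(** Differentiates a square root without dividing by [rho]: the descent inequality is multiplied by
    [rho], and [2 rho S <= rho^2 + S^2] replaces the root by [Q]. *)
Lemma sqrt_descent (Q rho t l s e C g : R) : 0 < t -> 0 <= rho -> 0 <= Q ->
  Q = rho ^+ 2 + 2 * t * l + t ^+ 2 * s ->
  rho <= Num.sqrt Q + t * e + C * (t ^+ 2 * g) ->
  0 <= l + rho * e + t * (2^-1 * s + rho * C * g).
Proof.
move=> t0 rho0 Q0 QE le.
have SQ := sqr_sqrtr Q0; have S0 := sqrtr_ge0 Q; set S := Num.sqrt Q in le SQ S0.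
have h1 := ler_wpM2l rho0 le; have h2 := sqr_ge0 (S - rho).
have t2 : 0 < 2 * t by rewrite mulr_gt0.
rewrite -(ler_pM2l t2) mulr0.
apply: le_trans (_ : 0 <= 2 * (rho * (S + t * e + C * (t ^+ 2 * g)) - rho * rho) + (S - rho) ^+ 2) _.
  by rewrite addr_ge0// mulr_ge0// subr_ge0.
by rewrite le_eqVlt; apply/orP; left; apply/eqP; rewrite sqrrB SQ QE; field.
Qed.

(** Formulated with sequences of difference quotients, so that it serves both for straight lines in
    [u] and for the sequences that define tangent vectors of the graph. *)
Lemma residual_first_order (r1 A1 eu a : X) (r2 A2 ev b ee c : Y) (C : R)
  (t : nat -> R) (D1 du : nat -> X) (D2 dv de : nat -> Y) (rho := Num.sqrt (L2dot r1 r1 + L2dot r2 r2)) :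
  (forall n, 0 < t n) -> t @ \oo --> (0 : R) ->
  D1 @ \oo --> A1 -> D2 @ \oo --> A2 -> du @ \oo --> a -> dv @ \oo --> b -> de @ \oo --> c ->
  (forall n, rho <= Num.sqrt (L2dot (r1 + t n *: D1 n) (r1 + t n *: D1 n) +
      L2dot (r2 + t n *: D2 n) (r2 + t n *: D2 n)) +
    t n * (L2dot eu (du n) + L2dot ev (dv n) + L2dot ee (de n)) +
    C * (t n ^+ 2 * (L2dot (du n) (du n) + L2dot (dv n) (dv n) + L2dot (de n) (de n)))) ->
  0 <= L2dot r1 A1 + L2dot r2 A2 + rho * (L2dot eu a + L2dot ev b + L2dot ee c).
Proof.
move=> t0 tc D1c D2c duc dvc dec h.
pose G n := L2dot r1 (D1 n) + L2dot r2 (D2 n) +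
  rho * (L2dot eu (du n) + L2dot ev (dv n) + L2dot ee (de n)) +
  t n * (2^-1 * (L2dot (D1 n) (D1 n) + L2dot (D2 n) (D2 n)) +
    rho * C * (L2dot (du n) (du n) + L2dot (dv n) (dv n) + L2dot (de n) (de n))).
have G0 n : 0 <= G n.
  apply: sqrt_descent (t0 n) (sqrtr_ge0 _) _ _ (h n).
    by rewrite addr_ge0 ?(dot_ge0 ipX) ?(dot_ge0 ipY).
  rewrite sqr_sqrtr; last by rewrite addr_ge0 ?(dot_ge0 ipX) ?(dot_ge0 ipY).
  rewrite !(dotDl ipX) !(dotDl ipY) !(dotDr ipX) !(dotDr ipY).
  rewrite !(dotZl ipX) !(dotZl ipY) !(dotZr ipX) !(dotZr ipY).
  rewrite (dotC ipX (D1 n)) (dotC ipY (D2 n)).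
  move: (L2dot r1 r1) (L2dot r2 r2) (L2dot r1 (D1 n)) (L2dot r2 (D2 n))
    (L2dot (D1 n) (D1 n)) (L2dot (D2 n) (D2 n)) (t n) => a1 a2 a3 a4 a5 a6 a7; ring.
suff GL : G @ \oo --> L2dot r1 A1 + L2dot r2 A2 + rho * (L2dot eu a + L2dot ev b + L2dot ee c).
  by apply: (ler_cvg_to (@cvg_cst _ 0 nat \oo _) GL); exact: nearW.
rewrite -[X in _ --> X]addr0; apply: cvgD.
  apply: cvgD; first by apply: cvgD; apply: cvg_L2dot => //; exact: cvg_cst.
  by apply: cvgMl_tmp; do ?apply: cvgD; apply: cvg_L2dot => //; exact: cvg_cst.
rewrite -[X in _ --> X](mul0r (2^-1 * (L2dot A1 A1 + L2dot A2 A2) +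
    rho * C * (L2dot a a + L2dot b b + L2dot c c))).
apply: cvgM => //; apply: cvgD; apply: cvgMl_tmp; do ?apply: cvgD; exact: cvg_L2dot.
Qed.

End first_order.

Section optimality.
Local Opaque L2dot.
Context d (T : measurableType d) (R : realType) (mu : {measure set T -> \bar R}).
Context {p m : nat} (K : L2 mu p -> L2 mu m).
Context {DK : L2 mu p -> L2 mu p -> L2 mu m} {D2K : L2 mu p -> L2 mu p -> L2 mu p -> L2 mu m}.
Context (adj : L2 mu p -> L2 mu m -> L2 mu p).
Context {adj2 : L2 mu p -> L2 mu m -> L2 mu p -> L2 mu p}.
Hypothesis hK : second_order K DK D2K adj adj2.
Variables (alpha gamma : R).
Notation X := (L2 mu p).
Notation Y := (L2 mu m).
Let ipX := L2_inner_product mu p.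
Let ipY := L2_inner_product mu m.

Definition residual1 (u : X) (v : Y) : X := alpha *: u + adj u v.
Definition residual2 (u : X) (v eta : Y) : Y := K u - gamma *: v - eta.

Definition residual (x : X * Y * Y) : R :=
  Num.sqrt (L2dot (residual1 x.1.1 x.1.2) (residual1 x.1.1 x.1.2) +
    L2dot (residual2 x.1.1 x.1.2 x.2) (residual2 x.1.1 x.1.2 x.2)).

Definition L2dot3 : X * Y * Y -> X * Y * Y -> R :=
  dot_pair (dot_pair (@L2dot _ _ _ mu p) (@L2dot _ _ _ mu m)) (@L2dot _ _ _ mu m).

Lemma adj_cvg (u0 : X) (v0 : Y) (u : nat -> X) (v : nat -> Y) :
  u @ \oo --> u0 -> v @ \oo --> v0 -> (fun n => adj (u n) (v n)) @ \oo --> adj u0 v0.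
Proof.
move=> uc vc; have [k k0 kP] := adj_bounded hK u0.
apply/cvgrPdist_le => e e0.
have v1 : 0 < `|v0| + 1 by rewrite ltr_wpDl.
have k1 : 0 < k + 1 by rewrite ltr_wpDl.
have eps1 : 0 < e / 2 / (`|v0| + 1) by rewrite !divr_gt0.
have eps2 : 0 < Num.min 1 (e / 2 / (k + 1)) by rewrite lt_min ltr01 !divr_gt0.
have h1 : \forall n \near \oo, forall x,
    `|DK (u n) x - DK u0 x| <= e / 2 / (`|v0| + 1) * `|x|.
  exact: (uc _ (DK_near hK u0 eps1)).
have h2 : \forall n \near \oo, `|v n - v0| < Num.min 1 (e / 2 / (k + 1)).
  exact: (vc _ (near_distC_lt v0 eps2)).
move: h1 h2; apply: filterS2 => n h1; rewrite lt_min => /andP[h2 h3].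
have vn : `|v n| <= `|v0| + 1.
  rewrite -(subrK v0 (v n)); apply: le_trans (ler_normD _ _) _.
  by rewrite addrC lerD2l ltW.
rewrite distrC -(subrK (adj u0 (v n)) (adj (u n) (v n))) -addrA -(adj_sub hK).
apply: le_trans (ler_normD _ _) _; rewrite (splitr e); apply: lerD.
  apply: norm_le_L2dot => [|x]; first by rewrite divr_ge0 ?(ltW e0).
  rewrite (dotBl ipX) !(adjP hK) -(dotBr ipY).
  apply: le_trans (cauchy_schwarz ipY _ _) _.
  apply: le_trans (ler_pM (dot_norm_ge0 _) (dot_norm_ge0 _) vn (h1 x)) _.
  by rewrite mulrA [X in X * _]mulrCA mulfV ?gt_eqF// mulr1.
apply: le_trans (kP _) _; apply: le_trans (ler_wpM2l k0 (ltW h3)) _.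
by rewrite mulrA ler_pdivrMr// mulrC ler_pM2l ?divr_gt0// lerDl.
Qed.

Context {F : Y -> \bar R} {u : X} {v eta : Y} {e : X * Y * Y} {C : R}.
Hypothesis descent : forall x : X * Y * Y, subdiff F x.1.2 x.2 ->
  residual (u, v, eta) <= residual x + L2dot3 e (x - (u, v, eta)) +
    C * L2dot3 (x - (u, v, eta)) (x - (u, v, eta)).
Hypothesis sub : subdiff F v eta.

Let rho := residual (u, v, eta).

Lemma first_order_u h : 0 <= L2dot (residual1 u v) (alpha *: h + adj2 u v h) +
  L2dot (residual2 u v eta) (DK u h) + rho * L2dot e.1.1 h.
Proof.
pose q n : R := 2^-1 ^+ n.
have q0 n : 0 < q n by rewrite exprn_gt0 ?invr_gt0.
have qn0 n : q n != 0 by rewrite gt_eqF.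
have qc : q @ \oo --> (0 : R).
  by rewrite (_ : q = fun n => 1 * 2^-1 ^+ n); [exact: cvg_geometric_half|apply/funext => n; rewrite mul1r].
have D1 : (fun n => (q n)^-1 *: (residual1 (u + q n *: h) v - residual1 u v)) @ \oo -->
    alpha *: h + adj2 u v h.
  have -> : (fun n => (q n)^-1 *: (residual1 (u + q n *: h) v - residual1 u v)) =
      (fun n => alpha *: h + (q n)^-1 *: (adj (u + q n *: h) v - adj u v)).
    apply/funext => n; rewrite /residual1 [alpha *: (u + _)]scalerDr opprD addrACA.
    by rewrite [alpha *: u + _]addrC addrK scalerDr !scalerA mulrCA mulVf// mulr1.
  apply: cvgD; first exact: cvg_cst.
  have := frechet_cvg (h := h) (adj2Z hK u v) (frechet_adj hK u v).
  by move/(cvg_comp _ _ (@half_expr_cvg_dnbhs R)).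
have D2 : (fun n => (q n)^-1 *: (K (u + q n *: h) - K u)) @ \oo --> DK u h.
  have := frechet_cvg (h := h) (DKZ hK u) (K_frechet hK u).
  by move/(cvg_comp _ _ (@half_expr_cvg_dnbhs R)).
have := residual_first_order (r1 := residual1 u v) (r2 := residual2 u v eta)
  (eu := e.1.1) (ev := e.1.2) (ee := e.2) (C := C)
  q0 qc D1 D2 (cvg_cst h) (cvg_cst (0 : Y)) (cvg_cst (0 : Y)).
rewrite !(dot0r ipY) !addr0; apply=> n.
have := descent (x := (u + q n *: h, v, eta)) sub.
have -> : (u + q n *: h, v, eta) - (u, v, eta) = (q n *: h, 0, 0).
  by rewrite -[LHS]/(u + q n *: h - u, v - v, eta - eta) !subrr addrC addKr.
rewrite /residual /= !scalerA !mulfV// !scale1r.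
rewrite [residual1 u v + _]addrC subrK.
have -> : residual2 u v eta + (K (u + q n *: h) - K u) = residual2 (u + q n *: h) v eta.
  by rewrite /residual2 addrC -!addrA addKr.
rewrite /L2dot3 /dot_pair /= !(dot0r ipY) !addr0 !(dotZr ipX) !(dotZl ipX).
by rewrite expr2 -mulrA.
Qed.

Lemma first_order_tangent z nu : tangent (graph (subdiff F)) (v, eta) (z, nu) ->
  0 <= L2dot (residual1 u v) (adj u z) + L2dot (residual2 u v eta) (- (gamma *: z) - nu) +
    rho * (L2dot e.1.2 z + L2dot e.2 nu).
Proof.
move=> [tau [x [tau0 _ tauc gx xc]]].
pose dv n := (tau n)^-1 *: ((x n).1 - v); pose de n := (tau n)^-1 *: ((x n).2 - eta).
have tn0 n : tau n != 0 by rewrite gt_eqF.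
have fstc : (fun y : Y * Y => y.1) @ nbhs (z, nu) --> z by move=> A zA; exact: (@cvg_fst _ _ (nbhs z) (nbhs nu) _ A zA).
have sndc : (fun y : Y * Y => y.2) @ nbhs (z, nu) --> nu by move=> A zA; exact: (@cvg_snd _ _ (nbhs z) (nbhs nu) _ A zA).
have dvc : dv @ \oo --> z by exact: (cvg_comp _ _ xc fstc).
have dec : de @ \oo --> nu by exact: (cvg_comp _ _ xc sndc).
have D1 : (fun n => adj u (dv n)) @ \oo --> adj u z.
  by apply: adj_cvg => //; exact: cvg_cst.
have D2 : (fun n => - (gamma *: dv n) - de n) @ \oo --> - (gamma *: z) - nu.
  by apply: cvgB => //; apply: cvgN; exact: cvgZl_tmp dvc.
have := residual_first_order (r1 := residual1 u v) (r2 := residual2 u v eta)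
  (eu := e.1.1) (ev := e.1.2) (ee := e.2) (C := C)
  tau0 tauc D1 D2 (cvg_cst (0 : X)) dvc dec.
rewrite (dot0r ipX e.1.1) !add0r; apply=> n.
rewrite /= (dot0r ipX 0) !add0r.
have := descent (x := (u, (x n).1, (x n).2)) (gx n).
have vE : tau n *: dv n = (x n).1 - v by rewrite scalerA mulfV// scale1r.
have eE : tau n *: de n = (x n).2 - eta by rewrite scalerA mulfV// scale1r.
have -> : (u, (x n).1, (x n).2) - (u, v, eta) = (0, tau n *: dv n, tau n *: de n).
  by rewrite vE eE -[LHS]/(u - u, (x n).1 - v, (x n).2 - eta) subrr.
have L3 (a : R) (f : X * Y * Y) (y y' : Y) : L2dot3 f (0, a *: y, a *: y') =
    a * (L2dot f.1.2 y + L2dot f.2 y').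
  by rewrite /L2dot3 /dot_pair /= (dot0r ipX) add0r !(dotZr ipY) mulrDr.
rewrite !L3 /= !(dotZl ipY) -mulrDr [X in C * X]mulrA -expr2.
rewrite /residual /=.
have -> : residual1 u v + tau n *: adj u (dv n) = residual1 u (x n).1.
  by rewrite -(adj_scale hK) vE (adj_sub hK) /residual1 -addrA [adj u v + _]addrC subrK.
have -> : residual2 u v eta + tau n *: (- (gamma *: dv n) - de n) =
    residual2 u (x n).1 (x n).2.
  rewrite scalerBr scalerN scalerA mulrC -scalerA vE eE scalerBr /residual2.
  by rewrite !opprB addrACA subrKA addKr.
by [].
Qed.

Lemma first_order_cone (V : set Y) : cone V ->
  (forall dv, convexified_derivative (subdiff F) v eta dv =
    if `[< V dv >] then [set 0 *: dv + nu | nu in polar V] else set0) ->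
  forall z nu, V z -> polar V nu ->
  0 <= L2dot (residual1 u v) (adj u z) + L2dot (residual2 u v eta) (- (gamma *: z) - nu) +
    rho * (L2dot e.1.2 z + L2dot e.2 nu).
Proof.
move=> Vc VD z nu Vz Pnu; have := hull_of_cone VD Vz Pnu.
apply: (convex_hull_halfspace (phi := fun y : Y * Y =>
  L2dot (residual1 u v) (adj u y.1) +
  L2dot (residual2 u v eta) (- (gamma *: y.1) - y.2) +
  rho * (L2dot e.1.2 y.1 + L2dot e.2 y.2))) => [y y'|a y|y].
- rewrite /= (adj_add hK) !(dotDr ipX) !(dotDr ipY) !(dotNr ipY) !(dotZr ipY) !(dotDr ipY).
  move: (L2dot _ y.1) => *; ring.
- rewrite /= (adj_scale hK) !(dotZr ipX) !(dotDr ipY) !(dotNr ipY) !(dotZr ipY).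
  move: (L2dot _ y.1) => *; ring.
- by case: y => y1 y2 /first_order_tangent.
Qed.

End optimality.

Lemma perturbed_sum_le (R : realDomainType) (x y e1 e2 e3 M : R) :
  x + e1 + (y + e2) + e3 <= 0 -> `|e1| <= M -> `|e2| <= M -> `|e3| <= M ->
  x + y <= 3 * M.
Proof. rewrite !ler_norml => h /andP[a _] /andP[b _] /andP[c _]; lra. Qed.

(** * Estimates at a minimiser and stability *)

Section normal_estimate.
Local Opaque L2dot.
Context d (T : measurableType d) (R : realType) (mu : {measure set T -> \bar R}).
Context {p m : nat} {K : L2 mu p -> L2 mu m}.
Context {DK : L2 mu p -> L2 mu p -> L2 mu m} {D2K : L2 mu p -> L2 mu p -> L2 mu p -> L2 mu m}.
Context {adj : L2 mu p -> L2 mu m -> L2 mu p}.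
Context {adj2 : L2 mu p -> L2 mu m -> L2 mu p -> L2 mu p}.
Hypothesis hK : second_order K DK D2K adj adj2.
Notation X := (L2 mu p).
Notation Y := (L2 mu m).
Let ipX := L2_inner_product mu p.
Let ipY := L2_inner_product mu m.

Variables (alpha c k b : R) (u0 : X) (v0 : Y) (B : Y -> Y).
Hypotheses (c0 : 0 < c) (k0 : 0 <= k) (b0 : 0 < b).
Let A w := alpha *: w + adj2 u0 v0 w.
Hypothesis A_coercive : forall x, c * `|x| ^+ 2 <= L2dot (A x) x.
Hypothesis DK_le : forall x, `|DK u0 x| <= k * `|x|.
Hypothesis B_spec : forall z, exists w, A w = adj u0 z /\ B z = DK u0 w.

Lemma coercive_norm x : c * `|x| <= `|A x|.
Proof.
have [->|x0] := eqVneq x 0; first by rewrite normr0 mulr0.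
have xp : 0 < `|x| by rewrite normr_gt0.
rewrite -(ler_pM2r xp) -mulrA -expr2; apply: le_trans (A_coercive x) _.
exact: (cauchy_schwarz ipX).
Qed.

Lemma A_sym x y : L2dot (A x) y = L2dot x (A y).
Proof.
rewrite (dotDl ipX) (dotDr ipX) (dotZl ipX) (dotZr ipX); congr (_ + _).
by rewrite (adj2P hK) (D2K_symmetric hK) -(adj2P hK) L2dotC.
Qed.

Lemma A_add x y : A (x + y) = A x + A y.
Proof. by rewrite /A scalerDr (adj2D hK) addrACA. Qed.

Lemma adj_le y : `|adj u0 y| <= k * `|y|.
Proof.
apply: norm_le_L2dot => [|x]; first exact: mulr_ge0.
rewrite (adjP hK); apply: le_trans (cauchy_schwarz ipY _ _) _.
by rewrite (mulrC k) -mulrA ler_wpM2l ?dot_norm_ge0//; exact: DK_le.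
Qed.

Context {s gamma : R} {u : X} {v : Y} {r1 eu : X} {r2 ev ee : Y} {V : set Y}.
Hypotheses (s0 : 0 < s) (r1_le1 : `|r1| <= 1) (r2_le1 : `|r2| <= 1).
Hypotheses (eu_le : `|eu| <= s) (ev_le : `|ev| <= s) (ee_le : `|ee| <= s).
Hypotheses (gamma0 : 0 <= gamma) (gamma_le : gamma <= s).
Hypothesis DK_near0 : forall x, `|DK u x - DK u0 x| <= s * `|x|.
Hypothesis adj2_near0 : forall h, `|adj2 u v h - adj2 u0 v0 h| <= s * `|h|.
Hypotheses (V_cone : cone V) (V0 : V 0) (V_add : forall y z, V y -> V z -> V (y + z)).
Hypothesis B_le : forall z nu, V z -> polar V nu -> b * `|z| <= `|B z - nu|.
Hypothesis first_order1 : forall h,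
  0 <= L2dot r1 (alpha *: h + adj2 u v h) + L2dot r2 (DK u h) + L2dot eu h.
Hypothesis first_order2 : forall z nu, V z -> polar V nu ->
  0 <= L2dot r1 (adj u z) + L2dot r2 (- (gamma *: z) - nu) +
    (L2dot ev z + L2dot ee nu).

Let defect := A r1 + adj u0 r2.

(** The first-order condition at [- h], with [adj2] and [DK] frozen at [(u0, v0)]. The two
    replacements and the slope [eu] each cost at most [s |h|], because [r1] and [r2] have norm at
    most 1. *)
Let defect_le : `|defect| <= 3 * s.
Proof.
apply: norm_le_L2dot => [|h]; first by rewrite mulr_ge0// ltW.
pose e1 := adj2 u v h - adj2 u0 v0 h; pose e2 := DK u h - DK u0 h.
have -> : L2dot defect h = L2dot r1 (A h) + L2dot r2 (DK u0 h).
  by rewrite (dotDl ipX) A_sym (adjP hK).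
have h0 : L2dot r1 (A h) + L2dot r1 e1 + (L2dot r2 (DK u0 h) + L2dot r2 e2) + L2dot eu h <= 0.
  have := first_order1 (- h).
  rewrite -(scaleN1r h) (adj2Z hK) (DKZ hK) !scaleN1r scalerN -opprD.
  rewrite (dotNr ipX) (dotNr ipY) (dotNr ipX) -!opprD oppr_ge0.
  have E1 : A h + e1 = alpha *: h + adj2 u v h.
    by rewrite /A /e1 -addrA [adj2 u0 v0 h + _]addrC subrK.
  have E2 : DK u0 h + e2 = DK u h by rewrite /e2 addrC subrK.
  by rewrite -(dotDr ipX) -(dotDr ipY) E1 E2.
have h1 : `|L2dot r1 e1| <= s * `|h|.
  apply: le_trans (normr_dot_le ipX _ _) _.
  apply: le_trans (ler_pM (dot_norm_ge0 _) (dot_norm_ge0 _) r1_le1 (adj2_near0 h)) _.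
  by rewrite mul1r.
have h2 : `|L2dot r2 e2| <= s * `|h|.
  apply: le_trans (normr_dot_le ipY _ _) _.
  apply: le_trans (ler_pM (dot_norm_ge0 _) (dot_norm_ge0 _) r2_le1 (DK_near0 h)) _.
  by rewrite mul1r.
have h3 : `|L2dot eu h| <= s * `|h|.
  apply: le_trans (normr_dot_le ipX _ _) _.
  by rewrite ler_wpM2r ?dot_norm_ge0.
by rewrite -mulrA; exact: perturbed_sum_le h0 h1 h2 h3.
Qed.

(** Coercivity bounds [r1] by [A r1], which is the defect minus the adjoint applied to [r2]. *)
Lemma normal_estimate1 : c * `|r1| <= k * `|r2| + 3 * s.
Proof.
apply: le_trans (coercive_norm _) _.
have -> : A r1 = defect - adj u0 r2 by rewrite /defect addrK.
by rewrite [leRHS]addrC; apply: le_trans (ler_normB _ _) (lerD defect_le (adj_le _)).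
Qed.

(** The bound [B_le] is applied to some [z] in [V] near [r2] and to a polar vector [nu] near
    [- DK u0 r1]; since [w] nearly equals [- r1], the two almost cancel in [B z - nu]. The constant
    collects [k (2 k + 3) / c] from [w + r1] and three further errors [s]. *)
Lemma normal_estimate2 : b * (`|r2| - 2 * s) <= (k / c * (2 * k + 3) + 3) * s.
Proof.
have adj0 : adj u 0 = 0.
  by rewrite -(scale0r (0 : Y)) (adj_scale hK) scale0r.
(* By the bipolar theorem r2 is close to V; [first_order2] with z = 0. *)
have z2V : forall nu, polar V nu -> L2dot (r2 - ee) nu <= 0.
  move=> nu Pnu; have := first_order2 V0 Pnu.
  rewrite adj0 scaler0 oppr0 add0r !(dot0r ipX) !(dot0r ipY) !add0r (dotNr ipY).
  by rewrite (dotBl ipY) subr_le0 addrC subr_ge0.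
have [z Vz zr] := bipolar ipY (@L2_geometrically_complete _ _ _ mu m)
  (ex_intro _ _ V0) V_cone V_add s0 z2V.
rewrite L2_dot_norm in zr.
have zr2 : `|z - r2| <= 2 * s.
  have -> : z - r2 = - ((r2 - ee - z) + ee) by rewrite addrAC subrK opprB.
  rewrite normrN; apply: le_trans (ler_normD _ _) _.
  by rewrite mulr_natl mulr2n; exact: lerD.
(* The condition [first_order2] with zero polar component says exactly that this vector is polar to
   [V]. *)
pose nu := - (DK u r1 - gamma *: r2 + ev).
have Pnu : polar V nu.
  move=> y Vy; have := first_order2 Vy (polar_0 (V := V)).
  rewrite subr0 (dot0r ipY ee) addr0 (dotNr ipY) (dotZr ipY) (dotC ipX) (adjP hK).
  rewrite /nu (dotNl ipY) oppr_le0 (dotDl ipY) (dotBl ipY) (dotZl ipY).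
  by rewrite (dotC ipY y).
have [w [Aw Bw]] := B_spec z.
(* [A (w + r1)] consists of the adjoint applied to [z - r2], of size [2 k s], and of the defect, of
   size [3 s]; coercivity divides by [c]. *)
have k1 : `|w + r1| <= (k * (2 * s) + 3 * s) / c.
  rewrite ler_pdivlMr// mulrC; apply: le_trans (coercive_norm _) _.
  have -> : A (w + r1) = (adj u0 z - adj u0 r2) + defect.
    by rewrite A_add Aw /defect [A r1 + _]addrC subrKA.
  rewrite -(adj_sub hK); apply: le_trans (ler_normD _ _) _.
  exact: (lerD (le_trans (adj_le _) (ler_wpM2l k0 zr2)) defect_le).
have := B_le Vz Pnu; rewrite Bw.
have -> : DK u0 w - nu = DK u0 (w + r1) + (DK u r1 - DK u0 r1) - gamma *: r2 + ev.
  rewrite /nu opprK (DKD hK) !addrA; congr (_ + _ + _).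
  by rewrite [RHS]addrAC addrK.
have kw := ler_wpM2l k0 k1.
have e1 : `|DK u r1 - DK u0 r1| <= s.
  by apply: le_trans (DK_near0 _) _; rewrite ler_piMr// ltW.
have e2 : `|gamma *: r2| <= s.
  rewrite normrZ ger0_norm//; apply: le_trans (ler_wpM2l gamma0 r2_le1) _.
  by rewrite mulr1.
have n1 : `|DK u0 (w + r1) + (DK u r1 - DK u0 r1) - gamma *: r2 + ev| <=
    k * ((k * (2 * s) + 3 * s) / c) + s + s + s.
  apply: le_trans (ler_normD _ _) (lerD _ ev_le).
  apply: le_trans (ler_normB _ _) (lerD _ e2).
  apply: le_trans (ler_normD _ _) (lerD _ e1).
  exact: le_trans (DK_le _) kw.
move=> h; apply: le_trans (le_trans (ler_wpM2l (ltW b0) _) (le_trans h n1)) _.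
  rewrite lerBlDr addrC -(subrK z r2); apply: le_trans (ler_normD _ _) _.
  by rewrite lerD2r distrC.
by rewrite le_eqVlt; apply/orP; left; apply/eqP; field; rewrite gt_eqF.
Qed.

End normal_estimate.

(** The second estimate bounds [y] by a multiple of [s], the first then bounds [x], and numbers in
    [[0, 1]] satisfy [x ^+ 2 + y ^+ 2 <= x + y]. A small [s] is thus contradictory. *)
Lemma small_unit_bound (R : realFieldType) (x y c k b E s : R) :
  0 < c -> 0 < b -> 0 <= k -> 0 <= x <= 1 -> 0 <= y <= 1 -> x ^+ 2 + y ^+ 2 = 1 ->
  c * x <= k * y + 3 * s -> b * (y - 2 * s) <= E * s ->
  1 <= (2 + E / b + (k * (2 + E / b) + 3) / c) * s.
Proof.
move=> c0 b0 k0 /andP[x0 x1] /andP[y0 y1] xy cx by_.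
have yP : y <= (2 + E / b) * s.
  rewrite mulrDl -lerBlDl -(ler_pM2l b0); apply: le_trans by_ _.
  by rewrite le_eqVlt; apply/orP; left; apply/eqP; field; rewrite gt_eqF.
have xP : x <= (k * (2 + E / b) + 3) / c * s.
  rewrite mulrAC ler_pdivlMr// mulrC; apply: le_trans cx _.
  by have := ler_wpM2l k0 yP; rewrite mulrA => h; rewrite [leRHS]mulrDl lerD2r.
apply: le_trans (_ : x + y <= _); last by rewrite addrC mulrDl lerD.
by rewrite -xy lerD// expr2 ler_piMl.
Qed.

Section solutions.
Local Opaque L2dot.
Context d (T : measurableType d) (R : realType) (mu : {measure set T -> \bar R}).
Context {p m : nat}.
Let ipX := L2_inner_product mu p.
Let ipY := L2_inner_product mu m.

Lemma regularized0 (F : L2 mu m -> \bar R) : regularized F 0 = F.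
Proof. by apply/funext => v; rewrite /regularized mul0r mul0r adde0. Qed.

(** For the quadratic term the subgradient inequality is [|w - v|^2 >= 0]. *)
Lemma subdiff_regularized (F : L2 mu m -> \bar R) (gamma : R) v eta : 0 <= gamma ->
  subdiff F v eta -> subdiff (regularized F gamma) v (eta + gamma *: v).
Proof.
move=> g0 sub w; rewrite /regularized -addeA -EFinD.
rewrite (dotDl ipY) (dotZl ipY) addrCA EFinD addeA; apply: leeD; first exact: sub.
rewrite lee_fin -mulrA -mulrDr -[leRHS]mulrA ler_wpM2l//.
rewrite !L2_sqr_norm (dotBr ipY).
have := dot_ge0 ipY (w - v); rewrite (dotBl ipY) !(dotBr ipY) (dotC ipY w v).
move: (L2dot w w) (L2dot v w) (L2dot v v) => a1 a2 a3; lra.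
Qed.

Lemma residual_eq0 K adj (alpha gamma : R) (x : L2 mu p * L2 mu m * L2 mu m) :
  residual K adj alpha gamma x = 0 ->
  alpha *: x.1.1 + adj x.1.1 x.1.2 = 0 /\ K x.1.1 = x.2 + gamma *: x.1.2.
Proof.
move/eqP; rewrite /residual sqrtr_eq0 => h.
have r1 : residual1 adj alpha x.1.1 x.1.2 = 0.
  apply: L2dot_eq0; apply/eqP; rewrite eq_le (dot_ge0 ipX) andbT.
  by apply: le_trans h; rewrite lerDl (dot_ge0 ipY).
have r2 : residual2 K gamma x.1.1 x.1.2 x.2 = 0.
  apply: L2dot_eq0; apply/eqP; rewrite eq_le (dot_ge0 ipY) andbT.
  by apply: le_trans h; rewrite lerDr (dot_ge0 ipX).
split=> //; apply/eqP; rewrite -subr_eq0 opprD addrA addrAC; exact/eqP.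
Qed.

Lemma L2dot3_inner_product : inner_product (@L2dot3 _ _ _ mu p m).
Proof. exact: (inner_product_pair (inner_product_pair ipX ipY) ipY). Qed.

Lemma L2dot3_complete : geometrically_complete (@L2dot3 _ _ _ mu p m).
Proof.
apply: geometrically_complete_pair.
- exact: inner_product_pair.
- exact: ipY.
- apply: geometrically_complete_pair => //; exact: L2_geometrically_complete.
- exact: L2_geometrically_complete.
Qed.

Lemma L2dot3_norms (x : L2 mu p * L2 mu m * L2 mu m) :
  [/\ `|x.1.1| <= dot_norm (@L2dot3 _ _ _ mu p m) x,
      `|x.1.2| <= dot_norm (@L2dot3 _ _ _ mu p m) x,
      `|x.2| <= dot_norm (@L2dot3 _ _ _ mu p m) x &
      Num.sqrt (`|x.1.1| ^+ 2 + `|x.1.2| ^+ 2) <= dot_norm (@L2dot3 _ _ _ mu p m) x].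
Proof.
have ipXY := inner_product_pair ipX ipY.
have h1 := dot_norm_fst (dot_pair (@L2dot _ _ _ mu p) (@L2dot _ _ _ mu m)) ipY x.
have h2 := dot_norm_snd (@L2dot _ _ _ mu m) ipXY x.
have h3 := dot_norm_fst (@L2dot _ _ _ mu p) ipY x.1.
have h4 := dot_norm_snd (@L2dot _ _ _ mu m) ipX x.1.
split; [exact: le_trans h3 h1|exact: le_trans h4 h1|exact: h2|].
suff -> : `|x.1.1| ^+ 2 + `|x.1.2| ^+ 2 =
  dot_pair (@L2dot _ _ _ mu p) (@L2dot _ _ _ mu m) x.1 x.1 by exact: h1.
by congr (_ + _); exact: L2_sqr_norm.
Qed.

Lemma residual_cvg K DK D2K adj adj2 (hK : second_order K DK D2K adj adj2)
    (alpha gamma : R) (x : nat -> L2 mu p * L2 mu m * L2 mu m) y D :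
  (forall n, dot_norm (@L2dot3 _ _ _ mu p m) (y - x n) <= D * 2^-1 ^+ n) ->
  residual K adj alpha gamma \o x @ \oo --> residual K adj alpha gamma y.
Proof.
move=> xy.
have cvgG q (z : nat -> L2 mu q) (z0 : L2 mu q) :
    (forall n, `|z0 - z n| <= D * 2^-1 ^+ n) -> z @ \oo --> z0.
  move=> h; apply/subr_cvg0/norm_cvg0P.
  by apply: (@geometric_cvg _ _ _ D) => n; rewrite subr0 normr_id distrC.
have uc : (fun n => (x n).1.1) @ \oo --> y.1.1.
  by apply: cvgG => n; have [h _ _ _] := L2dot3_norms (y - x n); exact: le_trans h (xy n).
have vc : (fun n => (x n).1.2) @ \oo --> y.1.2.
  by apply: cvgG => n; have [_ h _ _] := L2dot3_norms (y - x n); exact: le_trans h (xy n).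
have ec : (fun n => (x n).2) @ \oo --> y.2.
  by apply: cvgG => n; have [_ _ h _] := L2dot3_norms (y - x n); exact: le_trans h (xy n).
have c1 : (fun n => residual1 adj alpha (x n).1.1 (x n).1.2) @ \oo -->
    residual1 adj alpha y.1.1 y.1.2.
  by apply: cvgD; [exact: cvgZl_tmp uc|exact: adj_cvg hK _ _ _ _ uc vc].
have Kc : (fun n => K (x n).1.1) @ \oo --> K y.1.1.
  have [k k0 kP] := DK_bounded hK y.1.1.
  have Kc := frechet_continuous k0 (K_frechet hK y.1.1) kP.
  exact: (cvg_comp _ _ uc Kc).
have c2 : (fun n => residual2 K gamma (x n).1.1 (x n).1.2 (x n).2) @ \oo -->
    residual2 K gamma y.1.1 y.1.2 y.2.
  by apply: cvgB => //; apply: cvgB => //; exact: cvgZl_tmp vc.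
pose g n := L2dot (residual1 adj alpha (x n).1.1 (x n).1.2) (residual1 adj alpha (x n).1.1 (x n).1.2) +
  L2dot (residual2 K gamma (x n).1.1 (x n).1.2 (x n).2)
    (residual2 K gamma (x n).1.1 (x n).1.2 (x n).2).
have Q : g @ \oo --> L2dot (residual1 adj alpha y.1.1 y.1.2) (residual1 adj alpha y.1.1 y.1.2) +
    L2dot (residual2 K gamma y.1.1 y.1.2 y.2) (residual2 K gamma y.1.1 y.1.2 y.2).
  by apply: cvgD; [exact: (cvg_L2dot c1 c1)|exact: (cvg_L2dot c2 c2)].
exact: (cvg_comp g Num.sqrt Q (@sqrt_continuous R _)).
Qed.

End solutions.

Section stability.
Local Opaque L2dot.
Context d (T : measurableType d) (R : realType) (mu : {measure set T -> \bar R}).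
Context {p m : nat}.
Notation X := (L2 mu p).
Notation Y := (L2 mu m).
Let ipX := L2_inner_product mu p.
Let ipY := L2_inner_product mu m.

Lemma regularized_solution (f : 'rV[R]_m -> \bar R) (K : X -> Y)
    DK D2K adj adj2 (V : Y -> Y -> set Y) (B : Y -> Y)
    (alpha c k b s t gamma : R) (u0 : X) (v0 : Y) (l : R) :
  let F := @integral_functional _ _ _ mu m f in
  sigma_finite setT mu -> proper_fun f -> lower_semicontinuous f -> proper_fun F ->
  second_order K DK D2K adj adj2 ->
  (forall v eta, subdiff F v eta -> cone (V v eta)) ->
  (forall v eta, subdiff F v eta -> forall dv,
    convexified_derivative (subdiff F) v eta dv =
    if `[< V v eta dv >] then [set 0 *: dv + nu | nu in polar (V v eta)] else set0) ->
  alpha *: u0 + adj u0 v0 = 0 -> subdiff F v0 (K u0) ->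
  0 < c -> 0 <= k -> 0 < b -> 0 < s -> 0 < t -> 0 < gamma <= s ->
  (forall x, c * `|x| ^+ 2 <= L2dot (alpha *: x + adj2 u0 v0 x) x) ->
  (forall x, `|DK u0 x| <= k * `|x|) ->
  (forall z, exists w, alpha *: w + adj2 u0 v0 w = adj u0 z /\ B z = DK u0 w) ->
  (forall v eta z nu, subdiff F v eta -> `|v - v0| < t -> `|eta - K u0| < t ->
    V v eta z -> polar (V v eta) nu -> b * `|z| <= `|B z - nu|) ->
  (forall u, `|u - u0| < t -> forall x, `|DK u x - DK u0 x| <= s * `|x|) ->
  (forall u v, `|u - u0| < t -> `|v - v0| < t ->
    forall h, `|adj2 u v h - adj2 u0 v0 h| <= s * `|h|) ->
  (let P := 2 + (k / c * (2 * k + 3) + 3) / b in (P + (k * P + 3) / c) * s < 1) ->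
  v0 != 0 -> 0 < l -> l < t -> 32 * (gamma * `|v0|) / l <= s ->
  exists u v, [/\ alpha *: u + adj u v = 0,
    subdiff (regularized F gamma) v (K u) &
    Num.sqrt (`|u0 - u| ^+ 2 + `|v0 - v| ^+ 2) <= l].
Proof.
move=> F sf fp flsc Fp hK Vcone Vder opt0 sub0 c0 k0 b0 s0 t0 /andP[g0 gs] hc hk hB
  hb hDK hadj2 small v0n l0 lt ls.
pose S : set (X * Y * Y) := [set x | subdiff F x.1.2 x.2].
pose x0 : X * Y * Y := (u0, v0, K u0).
(* The residual at [x0]; as residuals are nonnegative, [x0] minimises over [S] up to [M]. *)
pose M := gamma * `|v0|.
have M0 : 0 < M by rewrite mulr_gt0// normr_gt0.
pose r := residual K adj alpha gamma.
have r_ge0 x : 0 <= r x by exact: sqrtr_ge0.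
have rx0 : r x0 = M.
  rewrite /r /residual /residual1 /residual2 /= opt0 (dot0l ipX) add0r.
  rewrite addrAC subrr sub0r (dotNl ipY) (dotNr ipY) opprK (dotZl ipY) (dotZr ipY).
  by rewrite mulrA -expr2 sqrtrM ?sqr_ge0// sqrtr_sqr gtr0_norm// -L2normE.
have rM x : S x -> r x0 <= r x + M by move=> _; rewrite rx0 lerDr.
have Scl (x : nat -> X * Y * Y) y D : (forall n, S (x n)) ->
    (forall n, dot_norm (@L2dot3 _ _ _ mu p m) (y - x n) <= D * 2^-1 ^+ n) ->
    S y /\ r \o x @ \oo --> r y.
  move=> Sx xy; split; last exact: (residual_cvg hK xy).
  apply: (@subdiff_geometrically_closed _ _ _ _ _ _ fp flsc
    (fun n => (x n).1.2) (fun n => (x n).2) _ _ D) => // n.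
    by have [_ h _ _] := L2dot3_norms (y - x n); exact: le_trans h (xy n).
  by have [_ _ h _] := L2dot3_norms (y - x n); exact: le_trans h (xy n).
have [[[u v] eta] [e [C [Sy yx0 el descent]]]] := smooth_variational_principle
  (@L2dot3_inner_product _ _ _ mu p m) (@L2dot3_complete _ _ _ mu p m) M0 l0
  (sub0 : S x0) rM Scl.
have [du dv de duv] := L2dot3_norms ((u, v, eta) - x0).
have {}du : `|u - u0| < t by apply: le_lt_trans du (le_lt_trans yx0 lt).
have {}dv : `|v - v0| < t by apply: le_lt_trans dv (le_lt_trans yx0 lt).
have {}de : `|eta - K u0| < t by apply: le_lt_trans de (le_lt_trans yx0 lt).
have {}duv : Num.sqrt (`|u0 - u| ^+ 2 + `|v0 - v| ^+ 2) <= l.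
  by rewrite (distrC u0) (distrC v0); exact: le_trans duv yx0.
have [ryE|ry] := eqVneq (r (u, v, eta)) 0.
  have [h1 h2] := residual_eq0 ryE; exists u, v; split=> //.
  by rewrite h2; apply: subdiff_regularized => //; exact: ltW.
exfalso.
have rho0 : 0 < r (u, v, eta) by rewrite lt_neqAle eq_sym ry r_ge0.
set rho := r (u, v, eta) in rho0.
have es : dot_norm (@L2dot3 _ _ _ mu p m) e <= s := le_trans el ls.
have [eu ev ee _] := L2dot3_norms e.
pose R1 := residual1 adj alpha u v; pose R2 := residual2 K gamma u v eta.
have rho2 : rho ^+ 2 = L2dot R1 R1 + L2dot R2 R2.
  by rewrite sqr_sqrtr// addr_ge0 ?(dot_ge0 ipX) ?(dot_ge0 ipY).
have rhoV : 0 <= rho^-1 by rewrite invr_ge0 ltW.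
have rho1 : rho^-1 * rho = 1 by rewrite mulVf// gt_eqF.
(* Division by [rho] also removes the factor [rho] in front of the slope [e], so the errors are of
   size [s] however small the residual is. *)
pose r1 := rho^-1 *: R1; pose r2 := rho^-1 *: R2.
have r12 : `|r1| ^+ 2 + `|r2| ^+ 2 = 1.
  transitivity (rho^-1 ^+ 2 * (L2dot R1 R1 + L2dot R2 R2)).
    rewrite mulrDr; congr (_ + _).
      by rewrite normrZ (ger0_norm rhoV) exprMn (L2_sqr_norm R1).
    by rewrite normrZ (ger0_norm rhoV) exprMn (L2_sqr_norm R2).
  by rewrite -rho2 -exprMn rho1 expr1n.
have r1_01 : 0 <= `|r1| <= 1.
  rewrite normr_ge0 /= -[leRHS]sqrtr1 -[leLHS]ger0_norm// -sqrtr_sqr ler_wsqrtr//.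
  by rewrite -r12 lerDl sqr_ge0.
have r2_01 : 0 <= `|r2| <= 1.
  rewrite normr_ge0 /= -[leRHS]sqrtr1 -[leLHS]ger0_norm// -sqrtr_sqr ler_wsqrtr//.
  by rewrite -r12 lerDr sqr_ge0.
have Vc := Vcone v eta Sy; have VD := Vder v eta Sy.
have fo1 h : 0 <= L2dot r1 (alpha *: h + adj2 u v h) + L2dot r2 (DK u h) + L2dot e.1.1 h.
  have := mulr_ge0 rhoV (first_order_u hK descent Sy h).
  by rewrite -/rho !mulrDr mulrA rho1 mul1r (dotZl ipX) (dotZl ipY).
have fo2 z nu : V v eta z -> polar (V v eta) nu ->
    0 <= L2dot r1 (adj u z) + L2dot r2 (- (gamma *: z) - nu) +
      (L2dot e.1.2 z + L2dot e.2 nu).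
  move=> Vz Pnu; have := mulr_ge0 rhoV (first_order_cone hK descent Vc VD Vz Pnu).
  by rewrite -/rho !mulrDr !mulrA rho1 !mul1r (dotZl ipX) (dotZl ipY).
have V0 := cone_0 Sy VD; have Vadd y z : V v eta y -> V v eta z -> V v eta (y + z).
  by move=> Vy Vz; exact: (cone_add Vc VD Vy Vz).
have hb' z nu : V v eta z -> polar (V v eta) nu -> b * `|z| <= `|B z - nu|.
  exact: hb Sy dv de.
have [/andP[_ r1_le1] /andP[_ r2_le1]] := (r1_01, r2_01).
have eus := le_trans eu es; have evs := le_trans ev es; have ees := le_trans ee es.
have n1 := normal_estimate1 hK k0 hc hk s0 r1_le1 r2_le1 eus (hDK u du) (hadj2 u v du dv) fo1.
have n2 := normal_estimate2 hK c0 k0 b0 hc hk hB s0 r1_le1 r2_le1 eus evs ees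
  (ltW g0) gs (hDK u du) (hadj2 u v du dv) Vc V0 Vadd hb' fo1 fo2.
have := small_unit_bound c0 b0 k0 r1_01 r2_01 r12 n1 n2.
by move=> /le_lt_trans /(_ small); rewrite ltxx.
Qed.

End stability.

(** * Lebesgue measure on an open domain and the choice of constants *)

Lemma sigma_finite_lebesgue_on (R : realType) n (Omega : set 'rV[R]_n)
    (oOmega : open Omega) : sigma_finite setT (lebesgue_on oOmega).
Proof.
have [E TE Eoo] := sigma_finiteT (lebesgue_rV n : {sigma_finite_measure set 'rV[R]_n -> \bar R}).
exists E => // i; have [mE Ei] := Eoo i; split=> //.
apply: le_lt_trans Ei; rewrite /lebesgue_on /mrestr; apply: le_measure => //.
- by rewrite inE; apply: measurableI => //; exact: open_measurable_rV.
- by rewrite inE.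
Qed.

Theorem proposition4p10 (R : realType) (n p m : nat) (hn : (0 < n)%N)
  (Omega : set 'rV[R]_n) (oOmega : open Omega)
  (alpha : R) (halpha : 0 < alpha)
  (K : 'L2(oOmega)_p -> 'L2(oOmega)_m) (hK : C2 K)
  (f : 'rV[R]_m -> \bar R)
  (f_proper : proper_fun f) (f_convex : convex_efun f)
  (f_lsc : lower_semicontinuous f)
  (f_proto : proto_differentiable (subdifferential (@rVdot R m) f))
  (F : 'L2(oOmega)_m -> \bar R) (hF : F = integral_functional f)
  (F_proper : proper_fun F)
  (V : R -> 'L2(oOmega)_m -> 'L2(oOmega)_m -> set 'L2(oOmega)_m)
  (V_cone : forall (gamma : R) (v eta : 'L2(oOmega)_m), 0 <= gamma ->
     subdiff (regularized F gamma) v eta -> cone (V gamma v eta))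
  (V_derivative : forall (gamma : R) (v eta : 'L2(oOmega)_m), 0 <= gamma ->
     subdiff (regularized F gamma) v eta ->
     forall dv : 'L2(oOmega)_m,
       convexified_derivative (subdiff (regularized F gamma)) v eta dv =
       if `[< V gamma v eta dv >]
       then [set gamma *: dv + nu | nu in polar (V gamma v eta)]
       else set0)
  (uhat : 'L2(oOmega)_p) (vhat : 'L2(oOmega)_m)
  (hqhat : solves_optimality alpha K (regularized F 0%R) uhat vhat)
  (cG : R) (hcG : 0 < cG)
  (hG : forall xi : 'L2(oOmega)_p,
     alpha * `|xi| ^+ 2 + L2dot (hessian K uhat vhat xi) xi >=
     cG * `|xi| ^+ 2)
  (hb : (0 < bbar alpha K F (V 0%R) uhat vhat)%E) :
  exists rho ell : R, [/\ 0 < rho, 0 < ell &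
    forall gamma : R, 0 <= gamma <= rho ->
    exists (u : 'L2(oOmega)_p) (v : 'L2(oOmega)_m),
      solves_optimality alpha K (regularized F gamma) u v /\
      Num.sqrt (`|uhat - u| ^+ 2 + `|vhat - v| ^+ 2) <= ell * gamma].
Proof.
have sf := @sigma_finite_lebesgue_on R n Omega oOmega.
rewrite regularized0 in hqhat; have [opt0 sub0] := hqhat.
have [D2K [adj2 hK2]] := C2_second_order hK.
have [k k0 kP] := DK_bounded hK2 uhat.
have hA x : cG * `|x| ^+ 2 <= L2dot (alpha *: x + adj2 uhat vhat x) x.
  have := hG x; rewrite (hessianE hK2) (dotDl (L2_inner_product _ _)).
  by rewrite (dotZl (L2_inner_product _ _)) -L2_sqr_norm.
have hB := Bbar_spec hK2 hcG hG.
have [t0 [b [t00 b0 hb0]]] := bbar_gt0 hb.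
(* [P'] is the constant of [small_unit_bound] for the bound of [normal_estimate2]; it depends on the
   data at [qhat] only, and [s = 1 / (P' + 1)] makes [P' s < 1]. *)
pose P := 2 + (k / cG * (2 * k + 3) + 3) / b; pose P' := P + (k * P + 3) / cG.
have P0 : 0 <= P by rewrite addr_ge0// divr_ge0 ?(ltW b0)// addr_ge0// mulr_ge0 ?divr_ge0 ?(ltW hcG)// addr_ge0// mulr_ge0.
have P'0 : 0 <= P' by rewrite addr_ge0// divr_ge0 ?(ltW hcG)// addr_ge0// mulr_ge0.
have P'1 : 0 < P' + 1 by rewrite ltr_wpDl.
pose s := (P' + 1)^-1; have s0 : 0 < s by rewrite invr_gt0.
have small : P' * s < 1 by rewrite ltr_pdivrMr// mul1r ltrDl.
have [t1 t10 ht1] : exists2 t1 : R, 0 < t1 & forall u, `|u - uhat| < t1 ->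
    forall x, `|'d K u x - 'd K uhat x| <= s * `|x|.
  have /nbhs_ballP[t1 /= t10 h] := DK_near hK2 uhat s0.
  by exists t1 => // u ut; apply: h; rewrite -ball_normE /= distrC.
have [t2 t20 ht2] : exists2 t2 : R, 0 < t2 & forall u v, `|u - uhat| < t2 ->
    `|v - vhat| < t2 -> forall h, `|adj2 u v h - adj2 uhat vhat h| <= s * `|h|.
  have [[/= U U'] [/nbhs_ballP[a /= a0 aU] /nbhs_ballP[a' /= a'0 aU']] UU'] :=
    adj2_near hK2 uhat vhat s0.
  exists (Num.min a a'); first by rewrite lt_min a0.
  move=> u v; rewrite !lt_min => /andP[ua _] /andP[_ va].
  apply: (UU' (u, v)); split => /=; [apply: aU|apply: aU'];
    by rewrite -ball_normE /= distrC.
pose t := Num.min t0 (Num.min t1 t2).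
have t_gt0 : 0 < t by rewrite !lt_min t00 t10.
have tt0 : t <= t0 by rewrite /t ge_min lexx.
have tt1 : t <= t1 by rewrite /t !ge_min lexx orbT.
have tt2 : t <= t2 by rewrite /t !ge_min lexx !orbT.
(* Makes the slope [32 gamma |vhat| / (ell gamma)] at most [s]; the added 1 keeps [ell] positive
   when [vhat = 0]. *)
pose ell := 32 * `|vhat| / s + 1.
have ell0 : 0 < ell by rewrite ltr_wpDl// divr_ge0 ?mulr_ge0 ?(ltW s0).
(* The first entry lets gamma count as an error of size [s]; the second keeps the radius
   [ell * gamma] at most [t / 2], inside the neighbourhood where all estimates hold. *)
pose rho := Num.min s (t / (2 * ell)).
have rho0 : 0 < rho by rewrite lt_min s0 divr_gt0 ?mulr_gt0.
exists rho, ell; split=> // gamma /andP[g0 grho].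
(* If [gamma *: vhat = 0], the residual at [qhat] vanishes and [qhat] itself is a solution; the
   variational principle needs a positive gap. *)
have [vg0|vg0] := eqVneq (gamma *: vhat) 0.
  exists uhat, vhat; split; last by rewrite !subrr !normr0 !expr0n /= addr0 sqrtr0 mulr_ge0 ?(ltW ell0).
  split; first exact: opt0.
  by have := subdiff_regularized g0 sub0; rewrite vg0 addr0.
have [gn0 vn0] : gamma != 0 /\ vhat != 0.
  by move: vg0; rewrite scaler_eq0 negb_or => /andP[].
have gp : 0 < gamma by rewrite lt_neqAle eq_sym gn0.
have gs : gamma <= s by apply: le_trans grho _; rewrite /rho ge_min lexx.
have l0 : 0 < ell * gamma by rewrite mulr_gt0.
have lt : ell * gamma < t.
  have gt : gamma <= t / (2 * ell) by apply: le_trans grho _; rewrite /rho ge_min lexx orbT.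
  apply: le_lt_trans (ler_wpM2l (ltW ell0) gt) _.
  have -> : ell * (t / (2 * ell)) = t / 2 by field; rewrite gt_eqF.
  by rewrite ltr_pdivrMr// ltr_pMr// ltr1n.
have ls : 32 * (gamma * `|vhat|) / (ell * gamma) <= s.
  rewrite ler_pdivrMr//.
  have -> : s * (ell * gamma) = s * (32 * `|vhat| / s * gamma) + s * gamma.
    by rewrite -mulrDr [ell * _]mulrDl mul1r.
  have -> : s * (32 * `|vhat| / s * gamma) = 32 * (gamma * `|vhat|).
    by field; rewrite gt_eqF.
  by rewrite lerDl mulr_ge0// ltW.
have Vcone v eta : subdiff F v eta -> cone (V 0 v eta).
  by move=> sub; apply: V_cone => //; rewrite regularized0.
have Vder v eta : subdiff F v eta -> forall dv,
    convexified_derivative (subdiff F) v eta dv =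
    if `[< V 0 v eta dv >] then [set 0 *: dv + nu | nu in polar (V 0 v eta)] else set0.
  move=> sub dv; have := V_derivative 0 v eta (lexx 0); rewrite regularized0.
  by move=> /(_ sub dv).
have hb' v eta z nu : subdiff F v eta -> `|v - vhat| < t -> `|eta - K uhat| < t ->
    V 0 v eta z -> polar (V 0 v eta) nu ->
    b * `|z| <= `|Bbar alpha K uhat vhat z - nu|.
  by move=> sub vt et; apply: hb0 => //; [exact: lt_le_trans vt tt0|exact: lt_le_trans et tt0].
rewrite {}hF in F_proper sub0 Vcone Vder hb' *.
have gps : 0 < gamma <= s by rewrite gp.
have [u [v [h1 h2 h3]]] := regularized_solution sf f_proper f_lsc F_proper hK2
  Vcone Vder opt0 sub0 hcG k0 b0 s0 t_gt0 gps hA kP hB hb'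
  (fun u ut => ht1 u (lt_le_trans ut tt1))
  (fun u v ut vt => ht2 u v (lt_le_trans ut tt2) (lt_le_trans vt tt2)) small vn0 l0 lt ls.
by exists u, v.
Qed.
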